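(* For every constant $\kappa$, there is a fully polynomial-time approximation scheme (FPTAS) for minimizing $\sum_j w_jC_j$ on a single machine with $\kappa$ discrete speeds and a given energy budget (defined in the context): for every $\varepsilon>0$ it computes, in time polynomial in the input size and in $1/\varepsilon$, a solution using energy at most $E$ whose cost is at most $(1+\varepsilon)$ times the optimal cost for energy budget $E$.
   Context: Jobs $1,\dots,n$ have work volumes $v_j\ge 0$ and weights $w_j\ge 0$. The machine can run at any time at one of the speeds $s_1>s_2>\dots>s_\kappa>0$ or at speed $0$; running at speed $s_i$ consumes power $P(s_i)$ for a given computable function $P$, and speed $0$ consumes no power. An energy budget $E$ is given. A solution consists of a job order and a speed profile over time with values in $\{0,s_1,\dots,s_\kappa\}$ with total energy $\int P(s(t))\,dt\le E$; jobs are processed nonpreemptively in the given order (a job may be processed at several speeds), and the objective is $\sum_j w_jC_j$. *)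

(* Defs.v *)
From HB Require Import structures.
From mathcomp Require Import all_boot all_order all_algebra all_fingroup.
From mathcomp Require Import all_classical all_reals all_analysis.

Set Implicit Arguments.
Unset Strict Implicit.
Unset Printing Implicit Defensive.

Import Order.TTheory GRing.Theory Num.Theory.
Import numFieldNormedType.Exports.
Local Open Scope classical_set_scope.
Local Open Scope ring_scope.

(** * The scheduling problem *)

(* [power i] is the value P(s_i). Since the speeds are pairwise distinct, an
   arbitrary table of values is the same thing as the restriction of a function
   P to {s_1, ..., s_kappa}, and it is part of the input. Indices start at 0. *)
Record instance (kappa n : nat) := Instance {
  volume : 'I_n -> rat;
  weight : 'I_n -> rat;
  speed : 'I_kappa -> rat;
  power : 'I_kappa -> rat;
  budget : rat;
  volume_ge0 : forall j, 0 <= volume j;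
  weight_ge0 : forall j, 0 <= weight j;
  speed_gt0 : forall i, 0 < speed i;
  speed_decr : forall i j : 'I_kappa, (i < j)%N -> speed j < speed i;
  power_ge0 : forall i, 0 <= power i
}.

(* [job_order k] is the job in position k. Only the values of [profile] at
   nonnegative times matter. *)
Record solution (R : realType) (n : nat) := Solution {
  job_order : {perm 'I_n};
  profile : R -> R
}.

Section Schedules.
Variables (R : realType) (kappa n : nat).
Variables (I : instance kappa n) (S : solution R n).
Local Notation mu := (@lebesgue_measure R).

(* P as a function of the speed; it vanishes at speed 0 because the speeds of
   the instance are positive. *)
Definition power_at (x : R) : R :=
  \sum_(i < kappa | x == ratr (speed I i)) ratr (power I i).

Definition energy : \bar R :=
  \int[mu]_(t in `[0%R, +oo[) (power_at (profile S t))%:E.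

Definition work (t : R) : \bar R :=
  \int[mu]_(x in `[0%R, t]) (profile S x)%:E.

(* total volume of the jobs processed up to and including job j *)
Definition prefix_volume (j : 'I_n) : R :=
  \sum_(k < n | (k <= (job_order S)^-1%g j)%N) ratr (volume I (job_order S k)).

Definition completion_time (j : 'I_n) : R :=
  inf [set t : R | 0 <= t /\ ((prefix_volume j)%:E <= work t)%E].

Definition cost : R := \sum_(j < n) ratr (weight I j) * completion_time j.

(* The third condition says that all jobs get completed. *)
Definition feasible : Prop :=
  [/\ measurable_fun (`[0%R, +oo[ : set R) (profile S),
      forall t, 0 <= t ->
        profile S t = 0 \/ exists i : 'I_kappa, profile S t = ratr (speed I i),
      exists t, 0 <= t /\ ((\sum_(j < n) ratr (volume I j))%:E <= work t)%E &
      (energy <= (ratr (budget I))%:E)%E].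

End Schedules.

Definition opt_cost (R : realType) (kappa n : nat) (I : instance kappa n) : R :=
  inf [set cost I S | S in [set S : solution R n | feasible I S]].

(** * The model of computation

   A first-order, call-by-value functional language over binary trees whose
   leaves are integers of arbitrary precision. Trees are shared through
   pointers, so the structural operations have unit cost; an arithmetic
   operation costs the bit-length of its operands (logarithmic cost). Each
   result has at most as many bits as its operands together, up to a constant,
   so running times are polynomially related to those of Turing machines. *)

Inductive sexp : Type :=
| Atom of int
| Node of sexp & sexp.

Definition int_size (z : int) : nat := (trunc_log 2 `|z|%N).+1.

Fixpoint sexp_size (x : sexp) : nat :=
  match x with
  | Atom z => (int_size z).+1
  | Node a b => (sexp_size a + sexp_size b).+1%N
  end.

Inductive binop : Type := OAdd | OSub | OMul | ODiv | OLeq.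

(* Euclidean division; division by 0 returns 0 *)
Definition binop_sem (o : binop) (a b : int) : int :=
  match o with
  | OAdd => a + b
  | OSub => a - b
  | OMul => a * b
  | ODiv => (a %/ b)%Z
  | OLeq => if a <= b then 1 else 0
  end.

(* Variables are de Bruijn indices. [TCall f t] calls the f-th function of the
   program with the value of t as its only argument. *)
Inductive term : Type :=
| TVar of nat
| TInt of int
| TOp of binop & term & term
| TPair of term & term
| TFst of term
| TSnd of term
| TIsPair of term
| TIf of term & term & term
| TLet of term & term
| TCall of nat & term.

Definition program : Type := seq term.

(* [evaluates p e t x c]: in environment e, the term t evaluates to x in time c. *)
Inductive evaluates (p : program) : seq sexp -> term -> sexp -> nat -> Prop :=
| EVar e k : evaluates p e (TVar k) (nth (Atom 0) e k) 1%N
| EInt e z : evaluates p e (TInt z) (Atom z) 1%N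
| EOp e o t u a b c d :
    evaluates p e t (Atom a) c -> evaluates p e u (Atom b) d ->
    evaluates p e (TOp o t u) (Atom (binop_sem o a b))
      (c + d + int_size a + int_size b).+1%N
| EPair e t u x y c d :
    evaluates p e t x c -> evaluates p e u y d ->
    evaluates p e (TPair t u) (Node x y) (c + d).+1%N
| EFst e t x y c : evaluates p e t (Node x y) c -> evaluates p e (TFst t) x c.+1
| ESnd e t x y c : evaluates p e t (Node x y) c -> evaluates p e (TSnd t) y c.+1
| EIsPairN e t x y c :
    evaluates p e t (Node x y) c -> evaluates p e (TIsPair t) (Atom 1) c.+1
| EIsPairA e t a c :
    evaluates p e t (Atom a) c -> evaluates p e (TIsPair t) (Atom 0) c.+1
| EIfT e t u v a x c d :
    evaluates p e t (Atom a) c -> a != 0 -> evaluates p e u x d ->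
    evaluates p e (TIf t u v) x (c + d).+1%N
| EIfF e t u v x c d :
    evaluates p e t (Atom 0) c -> evaluates p e v x d ->
    evaluates p e (TIf t u v) x (c + d).+1%N
| ELet e t u x y c d :
    evaluates p e t x c -> evaluates p (x :: e) u y d ->
    evaluates p e (TLet t u) y (c + d).+1%N
| ECall e f t x y c d :
    evaluates p e t x c -> evaluates p [:: x] (nth (TInt 0) p f) y d ->
    evaluates p e (TCall f t) y (c + d).+1%N.

Lemma evaluates_deterministic p e t x c y d :
  evaluates p e t x c -> evaluates p e t y d -> x = y /\ c = d.
Proof.
move=> H; elim: H y d => {e t x c}; intros;
  match goal with H : evaluates _ _ _ _ _ |- _ => inversion H; subst end;
  repeat match goal with
  | IH : (forall y d, evaluates p ?e ?t y d -> _), H : evaluates p ?e ?t _ _ |- _ =>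
      let E := fresh "E" in
      have [E ?] := IH _ _ H; clear IH; try (inversion E; clear E); subst
  end; by [].
Qed.

(* The entry point is function 0. Writing down the output is part of the
   running time: sharing makes it possible to build a tree that is
   exponentially larger than the time taken to build it. *)
Definition runs_in (p : program) (input output : sexp) (time : nat) : Prop :=
  exists2 c, evaluates p [:: input] (nth (TInt 0) p 0%N) output c
           & time = (c + sexp_size output)%N.

(** * Encoding of inputs and outputs *)

Definition enc_seq (T : Type) (enc : T -> sexp) (s : seq T) : sexp :=
  foldr (fun x r => Node (enc x) r) (Atom 0) s.

Definition enc_pair (T U : Type) (encT : T -> sexp) (encU : U -> sexp)
  (x : T * U) : sexp := Node (encT x.1) (encU x.2).

Definition enc_frac : int * int -> sexp := enc_pair Atom Atom.

Definition enc_rat (q : rat) : sexp := enc_frac (numq q, denq q).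

Definition enc_instance (kappa n : nat) (I : instance kappa n) : sexp :=
  Node (enc_seq (enc_pair enc_rat enc_rat)
          [seq (volume I j, weight I j) | j <- enum 'I_n])
    (Node (enc_seq (enc_pair enc_rat enc_rat)
             [seq (speed I i, power I i) | i <- enum 'I_kappa])
       (enc_rat (budget I))).

Definition enc_input (kappa n : nat) (I : instance kappa n) (eps : rat) : sexp :=
  Node (enc_instance I) (enc_rat eps).

Definition frac_val (R : realType) (f : int * int) : R := f.1%:~R / f.2%:~R.

(* A segment is a pair (speed, duration); after the last one the machine
   idles. *)
Fixpoint step_profile (R : realType) (segs : seq ((int * int) * (int * int)))
    (t : R) : R :=
  if segs is (s, d) :: segs' then
    if t < frac_val R d then frac_val R s
    else step_profile segs' (t - frac_val R d)
  else 0.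

(* An output lists the jobs in processing order, followed by the segments of
   the speed profile. The fractions in it need not be reduced. *)
Definition represents (R : realType) (n : nat) (x : sexp) (S : solution R n) :=
  exists segs : seq ((int * int) * (int * int)),
    [/\ x = Node (enc_seq (fun j : 'I_n => Atom (j : nat)%:Z)
                    [seq job_order S k | k <- enum 'I_n])
                 (enc_seq (enc_pair enc_frac enc_frac) segs),
        all (fun sd => [&& 0 < sd.1.2, 0 < sd.2.2 & 0 <= sd.2.1]) segs &
        profile S = @step_profile R segs].

(* Main.v *)
(* Fix a multiplier lambda for the energy. While jobs of total weight W are uncompleted, a
   unit of work costs at least the minimum of (W + lambda * P(s)) / s over the speeds s, and
   integrating this bound over the work gives a lower bound on the cost of every schedule
   within the budget. As W decreases in time, the minimizing speed never increases, so one
   may assign a speed class to each job, process the classes from fast to slow and use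
   Smith's order inside each class. At the critical lambda all jobs but one run at a single
   speed, and the remaining one mixes two speeds and uses up the energy.

   The algorithm guesses this special job and inserts the other jobs into the classes in
   Smith's order by dynamic programming. The cost of inserting a job into class c depends only
   on the processing time of the classes up to c and on the weight of the classes after c.
   The key of a state consists of the cost and of these 2 * kappa numbers, rounded down to
   about log N significant bits; for every key the table keeps a state of least energy,
   energies being exact. For fixed kappa the number of keys is polynomial in N and in the bit
   length of the numbers. An insertion loses a factor of at most 1 - 1 / N, so that
   N >= (n + 1) * (1 + 1 / eps) suffices. *)

Require Import Defs.
From HB Require Import structures.
From mathcomp Require Import all_boot all_order all_algebra all_fingroup.
From mathcomp Require Import all_classical all_reals all_analysis.
From mathcomp Require Import measurable_realfun zify ring lra.

Set Implicit Arguments.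
Unset Strict Implicit.
Unset Printing Implicit Defensive.

Import Order.TTheory GRing.Theory Num.Theory.
Import numFieldNormedType.Exports.
Local Open Scope ring_scope.

(** * Bit lengths *)

(** Rounding down makes the value of a candidate a lower estimate of the cost of the schedule it
    encodes. So for each feasible schedule some candidate has a value at most its cost, and the loss
    [(1 - 1 / N) ^ n] is paid only once, when the best candidate is turned into a schedule. The
    comparison is made with each feasible schedule because the optimum is an infimum. Times and
    weights are stored as cumulative sums: adding nonnegative numbers preserves a relative error,
    subtracting does not. Energies stay outside the key because they are additive, so among equal
    keys less energy is always at least as good. The special job has to be inserted last, as the
    mixture of its speeds depends on the energy left by the others. This ignores Smith's order but
    is harmless: at the critical [lambda], a job with less remaining weight is in a class strictly
    behind the faster of the two classes. The data are scaled by the product of the positive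
    integers in the input, a common multiple of the denominators and of the numerators of the
    speeds, so that the divisions of the scaling are exact. *)

Lemma int_size_gt0 z : (0 < int_size z)%N. Proof. by []. Qed.

Lemma ltn_int_size z : (`|z| < 2 ^ int_size z)%N.
Proof. exact: trunc_log_ltn. Qed.

Lemma int_size_le z q : (`|z| < 2 ^ q.+1)%N -> (int_size z <= q.+1)%N.
Proof.
rewrite /int_size; case: (posnP `|z|%N) => [->|z0 zq]; first by rewrite trunc_log0.
rewrite ltnS -ltnS -(@ltn_exp2l 2)//.
by apply: leq_ltn_trans zq; apply: trunc_logP.
Qed.

Lemma int_size0 : int_size 0 = 1%N. Proof. by rewrite /int_size trunc_log0. Qed.
Lemma int_size1 : int_size 1 = 1%N. Proof. by rewrite /int_size trunc_log1. Qed.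
Lemma int_size2 : int_size 2 = 2%N. Proof. by rewrite /int_size (trunc_log_eq _ (n:=1)). Qed.

Lemma leq_int_size a b : (`|a| <= `|b|)%N -> (int_size a <= int_size b)%N.
Proof. by move=> ab; apply: int_size_le; apply: leq_ltn_trans (ltn_int_size b). Qed.

Lemma int_sizeN a : int_size (- a) = int_size a.
Proof. by rewrite /int_size abszN. Qed.

Lemma int_sizeD a b : (int_size (a + b) <= (maxn (int_size a) (int_size b)).+1)%N.
Proof.
apply: int_size_le; rewrite expnS.
have h1 : (`|a| < 2 ^ maxn (int_size a) (int_size b))%N.
  by apply: leq_trans (ltn_int_size a) _; rewrite leq_exp2l// leq_maxl.
have h2 : (`|b| < 2 ^ maxn (int_size a) (int_size b))%N.
  by apply: leq_trans (ltn_int_size b) _; rewrite leq_exp2l// leq_maxr.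
lia.
Qed.

Lemma int_sizeM a b : (int_size (a * b) <= int_size a + int_size b)%N.
Proof.
rewrite {2}/int_size addSn; apply: int_size_le.
rewrite abszM -addSn expnD.
have := ltn_int_size a; have := ltn_int_size b; rewrite {2}/int_size.
set x := (2 ^ _)%N; set y := (2 ^ _)%N => *.
by case: (posnP `|a|%N) => [->|a0]; [rewrite mul0n; nia|apply: ltn_mul].
Qed.

(** Euclidean quotients are not truncated towards 0: for negative [a] the absolute value of the
    quotient is rounded up or down according to the sign of the remainder, but it never exceeds that
    of [a]. *)
Lemma abs_divz_le (a b : int) : (`|(a %/ b)%Z| <= `|a|)%N.
Proof.
have [->|b0] := eqVneq b 0; first by rewrite divz0.
have := divz_eq a b; have := modz_ge0 a b0; have := ltz_mod a b0.
set q := (a %/ b)%Z; set r := (a %% b)%Z => h1 h2 h3.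
have hb : 1 <= `|b| by lia.
case: (ltrgtP q 0) => hq; [|nia|lia].
case: (lerP 0 b) => hb'; [|].
- have : q * b <= q by nia.
  nia.
- nia.
Qed.

Lemma int_size_div a b : (int_size (a %/ b)%Z <= int_size a)%N.
Proof. exact/leq_int_size/abs_divz_le. Qed.

Lemma int_size_bool (c : bool) : int_size (if c then 1 else 0) = 1%N.
Proof. by case: c; rewrite ?int_size1 ?int_size0. Qed.

(** * Evaluation with an upper bound on the running time *)

(** The times in [evaluates] are exact and depend on the bit lengths of all operands. An upper bound
    can be weakened freely, so that each function of the program needs just one estimate. *)
Definition evaluates_within p e t x b := exists2 c, evaluates p e t x c & (c <= b)%N.

Section EvaluatesWithin.
Variable p : program.
Local Notation ev := (evaluates_within p).

Lemma ev_le e t x b b' : ev e t x b -> (b <= b')%N -> ev e t x b'.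
Proof. by move=> [c h hc] hb; exists c => //; apply: leq_trans hb. Qed.

Lemma ev_var e k : ev e (TVar k) (nth (Atom 0) e k) 1.
Proof. by exists 1%N => //; constructor. Qed.

Lemma ev_var' e k x : nth (Atom 0) e k = x -> ev e (TVar k) x 1.
Proof. by move=> <-; exact: ev_var. Qed.

Lemma ev_int e z : ev e (TInt z) (Atom z) 1.
Proof. by exists 1%N => //; constructor. Qed.

Lemma ev_op e o t u a b c d : ev e t (Atom a) c -> ev e u (Atom b) d ->
  ev e (TOp o t u) (Atom (binop_sem o a b)) (c + d + int_size a + int_size b).+1%N.
Proof.
move=> [c' h1 h2] [d' h3 h4].
exists (c' + d' + int_size a + int_size b).+1%N; first by constructor.
by rewrite ltnS !leq_add.
Qed.

Lemma ev_leq e t u a b c d : ev e t (Atom a) c -> ev e u (Atom b) d ->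
  ev e (TOp OLeq t u) (Atom (if a <= b then 1 else 0))
    (c + d + int_size a + int_size b).+1%N.
Proof. exact: ev_op. Qed.

Lemma ev_pair e t u x y c d : ev e t x c -> ev e u y d ->
  ev e (TPair t u) (Node x y) (c + d).+1.
Proof.
move=> [c' h1 h2] [d' h3 h4]; exists (c' + d').+1%N; first by constructor.
by rewrite ltnS !leq_add.
Qed.

Lemma ev_fst e t x y c : ev e t (Node x y) c -> ev e (TFst t) x c.+1.
Proof. by move=> [c' h1 h2]; exists c'.+1 => //; apply: EFst h1. Qed.

Lemma ev_snd e t x y c : ev e t (Node x y) c -> ev e (TSnd t) y c.+1.
Proof. by move=> [c' h1 h2]; exists c'.+1 => //; apply: ESnd h1. Qed.

(** The bound charges both branches, which spares a case distinction in the time estimates. Each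
    branch is evaluated only under its own condition. *)
Lemma ev_if e t u v a x c d d' : ev e t (Atom a) c ->
  (a != 0 -> ev e u x d) -> (a = 0 -> ev e v x d') ->
  ev e (TIf t u v) x (c + (d + d')).+1.
Proof.
move=> [c' h1 h2]; have [a0 _|a0] := eqVneq a 0.
  case=> // d1 h3 h4; exists (c' + d1).+1%N; first by subst a; apply: EIfF h1 h3.
  by rewrite ltnS leq_add// (leq_trans h4)// leq_addl.
case=> // d1 h3 h4 _; exists (c' + d1).+1%N; first by apply: EIfT h1 a0 h3.
by rewrite ltnS leq_add// (leq_trans h4)// leq_addr.
Qed.

Lemma ev_if_node e t u v y z x c d : ev e t (Node y z) c -> ev e u x d ->
  ev e (TIf (TIsPair t) u v) x (c + d).+2.
Proof.
move=> [c' h1 h2] [d' h3 h4]; exists (c'.+1 + d').+1%N; last by rewrite addSn !ltnS leq_add.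
exact: (EIfT v (EIsPairN h1) isT h3).
Qed.

Lemma ev_if_atom e t u v a x c d : ev e t (Atom a) c -> ev e v x d ->
  ev e (TIf (TIsPair t) u v) x (c + d).+2.
Proof.
move=> [c' h1 h2] [d' h3 h4]; exists (c'.+1 + d').+1%N; last by rewrite addSn !ltnS leq_add.
exact: (EIfF u (EIsPairA h1) h3).
Qed.

Lemma ev_let e t u x y c d : ev e t x c -> ev (x :: e) u y d ->
  ev e (TLet t u) y (c + d).+1.
Proof.
move=> [c' h1 h2] [d' h3 h4]; exists (c' + d').+1%N; first by apply: ELet h1 h3.
by rewrite ltnS leq_add.
Qed.

Lemma ev_call e f t x y c d : ev e t x c -> ev [:: x] (nth (TInt 0) p f) y d ->
  ev e (TCall f t) y (c + d).+1.
Proof.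
move=> [c' h1 h2] [d' h3 h4]; exists (c' + d').+1%N; first by apply: ECall h1 h3.
by rewrite ltnS leq_add.
Qed.

End EvaluatesWithin.

Notation arg := (TVar 0).

(** Left fold with argument [(env, (acc, list))]. The environment is passed along because a called
    function sees nothing but its argument; [TIsPair] detects the end of the list, which is encoded
    by an atom. *)
Definition fold_term (f g : nat) : term :=
  TIf (TIsPair (TSnd (TSnd arg)))
    (TCall f (TPair (TFst arg)
      (TPair (TCall g (TPair (TFst arg)
                        (TPair (TFst (TSnd arg)) (TFst (TSnd (TSnd arg))))))
             (TSnd (TSnd (TSnd arg))))))
    (TFst (TSnd arg)).

Definition foldr_term (f g : nat) (base : term) : term :=
  TIf (TIsPair (TSnd arg))
    (TCall g (TPair (TFst arg)
      (TPair (TFst (TSnd arg)) (TCall f (TPair (TFst arg) (TSnd (TSnd arg)))))))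
    base.

Ltac ev_step :=
  lazymatch goal with
  | |- evaluates_within _ _ (TVar _) _ _ => eapply ev_var'; cbn [nth enc_seq foldr]; reflexivity
  | |- evaluates_within _ _ (TInt _) _ _ => eapply ev_int
  | |- evaluates_within _ _ (TOp OLeq _ _) _ _ => eapply ev_leq
  | |- evaluates_within _ _ (TOp _ _ _) _ _ => eapply ev_op
  | |- evaluates_within _ _ (TPair _ _) _ _ => eapply ev_pair
  | |- evaluates_within _ _ (TFst _) _ _ => eapply ev_fst
  | |- evaluates_within _ _ (TSnd _) _ _ => eapply ev_snd
  | |- evaluates_within _ _ (TLet _ _) _ _ => eapply ev_let
  | |- evaluates_within _ _ (TCall _ _) _ _ => eapply ev_call
  end.
Ltac evs := repeat ev_step.

Section Folds.
Variable p : program.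
Local Notation ev := (evaluates_within p).
Local Notation fn := (nth (TInt 0) p).

(** The step function has to be analysed only on accumulators that actually occur, namely those
    after a prefix [s1] of the list. This lets invariants of the accumulator, such as the size of a
    table, enter the bound [b]. *)
Lemma ev_fold (A T : Type) (encA : A -> sexp) (encT : T -> sexp) (f g : nat)
    (env : sexp) (h : A -> T -> A) (b : nat) (l : seq T) (a : A) :
  fn f = fold_term f g ->
  (forall s1 x s2, l = s1 ++ x :: s2 ->
    ev [:: Node env (Node (encA (foldl h a s1)) (encT x))] (fn g)
       (encA (h (foldl h a s1) x)) b) ->
  ev [:: Node env (Node (encA a) (enc_seq encT l))] (fn f) (encA (foldl h a l))
     ((b + 30) * (size l).+1).
Proof.
move=> fE; elim: l a => [|x l IH] a step; rewrite fE.
  apply: ev_le; first by eapply ev_if_atom; evs.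
  by rewrite /=; lia.
apply: ev_le.
  eapply ev_if_node; first by evs.
  evs.
    exact: (step [::] x l).
  apply: (IH (h a x)) => s1 y s2 ls; exact: (step (x :: s1) y s2 (congr1 _ ls)).
by rewrite /=; lia.
Qed.

Lemma ev_foldr (A T : Type) (encA : A -> sexp) (encT : T -> sexp) (f g : nat) base
    (env : sexp) (h : T -> A -> A) (b d : nat) (l : seq T) (a : A) :
  fn f = foldr_term f g base ->
  (forall e, ev e base (encA a) d) ->
  (forall s1 x s2, l = s1 ++ x :: s2 ->
    ev [:: Node env (Node (encT x) (encA (foldr h a s2)))] (fn g)
       (encA (h x (foldr h a s2))) b) ->
  ev [:: Node env (enc_seq encT l)] (fn f) (encA (foldr h a l))
     ((b + 30) * (size l) + 10 + d).
Proof.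
move=> fE hb; elim: l => [|x l IH] step; rewrite fE.
  apply: ev_le; first by eapply ev_if_atom; [evs|exact: hb].
  by rewrite /=; lia.
apply: ev_le.
  eapply ev_if_node; first by evs.
  evs; last exact: (step [::] x l).
  apply: IH => s1 y s2 ls; exact: (step (x :: s1) y s2 (congr1 _ ls)).
by rewrite /=; lia.
Qed.

End Folds.

(** * The algorithm *)

(* (index, (volume, weight)), scaled to integers *)
Definition job : Type := (int * (int * int))%type.
(* (index, (time per unit of volume, (energy per unit of volume, speed))) *)
Definition speed_class : Type := (int * (int * (int * (int * int))))%type.
(* A class c with the processing time of the classes up to c and the weight of
   the classes after c. *)
Definition entry : Type := (speed_class * (int * int))%type.
Definition segment : Type := ((int * int) * (int * int))%type.
(* ((class index, job), two consecutive segments processing the job) *)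
Definition item : Type := ((int * job) * (segment * segment))%type.
(* ((entries, cost), (energy, items)); the first component is the rounded key. *)
Definition state : Type := ((seq entry * int) * (int * seq item))%type.
(* ((numerator, denominator) of the cost, items) *)
Definition candidate : Type := ((int * int) * seq item)%type.

(** [D] will be a multiple of all denominators, so that both divisions are exact. *)
Definition mk_job (D : int) (x : int * ((int * int) * (int * int))) : job :=
  (x.1, ((D * x.2.1.1 %/ x.2.1.2)%Z, (D * x.2.2.1 %/ x.2.2.2)%Z)).

(** [D] will also be a multiple of the numerators of the speeds. Per unit of volume, time is scaled
    to [D / s] and energy to [D ^ 2 * P / s]; as volumes and weights carry a factor [D], energies
    and weighted costs both carry [D ^ 3]. *)
Definition mk_entry (D : int) (x : int * ((int * int) * (int * int))) : entry :=
  let r := (D * x.2.1.2 %/ x.2.1.1)%Z in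
  ((x.1, (r, ((D * x.2.2.1 %/ x.2.2.2)%Z * r, x.2.1))), (0, 0)).

Fixpoint index_from (T : Type) (k : int) (l : seq T) : seq (int * T) :=
  if l is x :: l' then (k, x) :: index_from (k + 1) l' else [::].

(** On the encoded input this is a common multiple of all positive integers in it, with no more bits
    than the size of the encoding. Nonpositive leaves count as 1 to keep the product positive. *)
Fixpoint atom_product (x : sexp) : int :=
  match x with
  | Atom z => if z <= 0 then 1 else z
  | Node a b => atom_product a * atom_product b
  end.

(* v_x / w_x <= v_y / w_y, where all jobs of weight 0 have ratio +oo *)
Definition smith (x y : job) : bool :=
  if y.2.2 != 0 then if x.2.2 != 0 then x.2.1 * y.2.2 <= y.2.1 * x.2.2 else false
  else true.

Fixpoint insert (x : job) (l : seq job) : seq job :=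
  if l is y :: l' then if smith x y then x :: l else y :: insert x l' else [:: x].

Definition isort (l : seq job) : seq job := foldr insert [::] l.

(* Rounds down to a number of the form m * 2 ^ k with m < 2 * N, exactly below 2 * N. *)
Fixpoint round_loop (k : nat) (N x d : int) : int :=
  if k is k'.+1 then
    if (N + N) * d <= x then round_loop k' N x (d + d) else (x %/ d)%Z * d
  else (x %/ d)%Z * d.

Definition round (N x : int) : int := round_loop (int_size x) N x 1.

Definition leqz (a b : int) : int := if a <= b then 1 else 0.

(** A job in class [i] adds to the processing time of the classes [c >= i] and to the weight behind
    the classes [c < i]; the strict inequality is written [c + 1 <= i]. *)
Definition update (N i tau w : int) (x : entry) : entry :=
  (x.1, (round N (x.2.1 + leqz i x.1.1 * tau),
         round N (x.2.2 + leqz (x.1.1 + 1) i * w))).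

(** [x / q] is a volume in scaled units. Dividing it by [D] and by the speed gives the true
    duration, kept as an unreduced fraction. *)
Definition mk_segment (D : int) (sp : int * int) (x q : int) : segment :=
  (sp, (x * sp.2, q * D * sp.1)).

Definition class_index (c : speed_class) := c.1.
Definition class_time (c : speed_class) := c.2.1.
Definition class_energy (c : speed_class) := c.2.2.1.
Definition class_speed (c : speed_class) := c.2.2.2.

Definition mk_item D (c d : speed_class) (j : job) (xa xb q : int) : item :=
  ((class_index c, j),
   (mk_segment D (class_speed c) xa q, mk_segment D (class_speed d) xb q)).

(** The new job becomes the last one of its class: it waits for all classes up to its own and delays
    all later classes by [tau]. Its second segment is empty. *)
Definition extend (N D : int) (j : job) (s : state) (x : entry) : state :=
  let c := x.1 in
  let tau := class_time c * j.2.1 in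
  (([seq update N (class_index c) tau j.2.2 y | y <- s.1.1],
    round N (s.1.2 + j.2.2 * (x.2.1 + tau) + tau * x.2.2)),
   (s.2.1 + class_energy c * j.2.1, mk_item D c c j j.2.1 0 1 :: s.2.2)).

Fixpoint put (s : state) (T : seq state) : seq state :=
  if T is t :: T' then
    if s.1 == t.1 then (if t.2.1 <= s.2.1 then T else s :: T')
    else t :: put s T'
  else [:: s].

Definition ext N D j s T := foldl (fun T x => put (extend N D j s x) T) T s.1.1.
Definition layer N D j T := foldl (fun T' s => ext N D j s T') [::] T.
Definition dp_step N D (id : int) T j := if j.1 - id != 0 then layer N D j T else T.
Definition dp N D id T jobs := foldl (dp_step N D id) T jobs.

(* The last job spends volume xa / q in the class of x and xb / q in the class of y; its
   place in the order is determined by x. *)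
Definition mk_candidate (D : int) (j : job) (s : state) (x y : entry)
    (q xa xb : int) : candidate :=
  let t := class_time x.1 * xa + class_time y.1 * xb in
  ((q * s.1.2 + j.2.2 * (q * x.2.1 + t) + t * x.2.2, q),
   (* The negative index identifies [no_job], which must not appear in the output. *)
   if 0 <= j.1 then mk_item D x.1 y.1 j xa xb q :: s.2.2 else s.2.2).

Definition better (b : option candidate) (c : candidate) : option candidate :=
  if b is Some b' then if b'.1.1 * c.1.2 <= c.1.1 * b'.1.2 then b else Some c
  else Some c.

(** The mixture solves [xa + xb = q * v] and [ea * xa + eb * xb = q * B'], so that the job uses up
    the remaining energy [B'] exactly; the choice [q = ea - eb] keeps the solution integral. If the
    class of [x] alone is affordable, the whole job goes there. *)
Definition try_pair D B j s x (b : option candidate) (y : entry) : option candidate :=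
  let B' := B - s.2.1 in
  let ea := class_energy x.1 in let eb := class_energy y.1 in
  let v := j.2.1 in
  if ea * v <= B' then better b (mk_candidate D j s x y 1 v 0) else
  if ea <= eb then b else
  if eb * v <= B'
  then better b (mk_candidate D j s x y (ea - eb) (B' - eb * v) (ea * v - B')) else b.

Definition try_entry D B j s b x := foldl (try_pair D B j s x) b s.1.1.
Definition try_state D B j b s := foldl (try_entry D B j s) b s.1.1.
Definition init_state (ents : seq entry) : state := ((ents, 0), (0, [::])).
Definition try_split N D B jobs ents b j :=
  foldl (try_state D B j) b (dp N D j.1 [:: init_state ents] jobs).
(* A job of volume 0 stands for the absence of a job that changes its speed. *)
Definition no_job : job := (-1, (0, 0)).
Definition best_candidate N D B jobs ents :=
  foldl (try_split N D B jobs ents) None (no_job :: jobs).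

Definition out : Type := (seq int * seq segment)%type.
(** Items are stored with the latest insertion first, so that prepending them one after the other
    restores the order of insertion inside a class. *)
Definition put_item (i : int) (o : out) (x : item) : out :=
  if x.1.1 - i != 0 then o else (x.1.2.1 :: o.1, x.2.1 :: x.2.2 :: o.2).
Definition put_class (items : seq item) (x : entry) (o : out) : out :=
  foldl (put_item x.1.1) o items.
Definition output (items : seq item) (ents : seq entry) : out :=
  foldr (put_class items) ([::], [::]) ents.

(** * Its implementation *)

Notation "t ._1" := (TFst t) (at level 1, left associativity, format "t ._1").
Notation "t ._2" := (TSnd t) (at level 1, left associativity, format "t ._2").
Notation "<< t , u >>" := (TPair t u).
Notation "t [+] u" := (TOp OAdd t u) (at level 50, left associativity).
Notation "t [-] u" := (TOp OSub t u) (at level 50, left associativity).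
Notation "t [*] u" := (TOp OMul t u) (at level 40, left associativity).
Notation "t [/] u" := (TOp ODiv t u) (at level 40, left associativity).
Notation "t [<=] u" := (TOp OLeq t u) (at level 70).
Coercion TInt : int >-> term.

(* Positions in the program; g_* is the step function of the list traversal f_*. *)
Notation f_prod := 1%N.
Notation f_len := 2%N.
Notation f_idx := 3%N.
Notation g_jobs := 4%N.
Notation f_jobs := 5%N.
Notation g_ents := 6%N.
Notation f_ents := 7%N.
Notation f_insert := 8%N.
Notation f_sort := 9%N.
Notation f_round := 10%N.
Notation g_update := 11%N.
Notation f_update := 12%N.
Notation f_eq := 13%N.
Notation f_put := 14%N.
Notation f_seg := 15%N.
Notation g_ext := 16%N.
Notation f_ext := 17%N.
Notation g_layer := 18%N.
Notation f_layer := 19%N.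
Notation g_dp := 20%N.
Notation f_dp := 21%N.
Notation f_cand := 22%N.
Notation g_pair := 23%N.
Notation f_pair := 24%N.
Notation g_entry := 25%N.
Notation f_entry := 26%N.
Notation g_state := 27%N.
Notation f_state := 28%N.
Notation g_split := 29%N.
Notation f_split := 30%N.
Notation g_item := 31%N.
Notation f_item := 32%N.
Notation g_out := 33%N.
Notation f_out := 34%N.
Notation g_ids := 35%N.
Notation f_ids := 36%N.

(** Without a candidate the output is the sorted list of jobs with an empty profile. This is a
    correct answer when there are no speeds, since all volumes of a feasible instance are then 0. *)
Definition t_main : term :=
  TLet (TCall f_prod arg)
  (TLet ((TCall f_len (TVar 1)._1._1 [+] 1%Z)
           [*] (2%Z [+] ((TVar 1)._2._2 [/] (TVar 1)._2._1)))
  (TLet (TCall f_ents << TVar 1, TCall f_idx << 0%Z, (TVar 2)._1._2._1 >> >>)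
  (TLet (TCall f_sort << 0%Z,
           TCall f_jobs << TVar 2, TCall f_idx << 0%Z, (TVar 3)._1._1 >> >> >>)
  (TLet (TCall f_split
           << << << TVar 2, TVar 3 >>,
                 << (TVar 3 [*] TVar 3 [*] TVar 3 [*] (TVar 4)._1._2._2._1)
                      [/] (TVar 4)._1._2._2._2,
                    << arg, << << TVar 1, 0%Z >>, << 0%Z, 0%Z >> >> >> >> >>,
              << 0%Z, << << (-1)%Z, << 0%Z, 0%Z >> >>, arg >> >> >>)
  (TIf (TIsPair arg)
     (TCall f_out << arg._2, TVar 2 >>)
     << TCall f_ids << 0%Z, TVar 1 >>, 0%Z >>))))).

Definition t_prod : term :=
  TIf (TIsPair arg) (TCall f_prod arg._1 [*] TCall f_prod arg._2)
    (TIf (arg [<=] 0%Z) 1%Z arg).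

Definition t_len : term :=
  TIf (TIsPair arg) (1%Z [+] TCall f_len arg._2) 0%Z.

Definition t_idx : term :=
  TIf (TIsPair arg._2)
    << << arg._1, arg._2._1 >>, TCall f_idx << arg._1 [+] 1%Z, arg._2._2 >> >>
    0%Z.

Definition s_jobs : term :=
  << << arg._2._1._1,
        << (arg._1 [*] arg._2._1._2._1._1) [/] arg._2._1._2._1._2,
           (arg._1 [*] arg._2._1._2._2._1) [/] arg._2._1._2._2._2 >> >>,
     arg._2._2 >>.

Definition s_ents : term :=
  TLet ((arg._1 [*] arg._2._1._2._1._2) [/] arg._2._1._2._1._1)
  (let a := TVar 1 in
   << << << a._2._1._1,
            << TVar 0,
               << ((a._1 [*] a._2._1._2._2._1) [/] a._2._1._2._2._2) [*] TVar 0,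
                  a._2._1._2._1 >> >> >>,
         << 0%Z, 0%Z >> >>,
      a._2._2 >>).

(* The first component of the argument of an insertion is a dummy. *)
Definition t_insert : term :=
  let x := arg._2._1 in let l := arg._2._2 in let y := l._1 in
  TIf (TIsPair l)
    (TIf (TIf y._2._2 (TIf x._2._2 (x._2._1 [*] y._2._2 [<=] y._2._1 [*] x._2._2) 0%Z) 1%Z)
       << x, l >>
       << y, TCall f_insert << 0%Z, << x, l._2 >> >> >>)
    << x, 0%Z >>.

Definition t_round : term :=
  let N := arg._1 in let x := arg._2._1 in let d := arg._2._2 in
  TIf ((N [+] N) [*] d [<=] x) (TCall f_round << N, << x, d [+] d >> >>) ((x [/] d) [*] d).

Definition s_update : term :=
  let N := arg._1._1 in let i := arg._1._2._1 in
  let tau := arg._1._2._2._1 in let w := arg._1._2._2._2 in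
  let x := arg._2._1 in
  << << x._1,
        << TCall f_round << N, << x._2._1 [+] (i [<=] x._1._1) [*] tau, 1%Z >> >>,
           TCall f_round << N, << x._2._2 [+] (x._1._1 [+] 1%Z [<=] i) [*] w, 1%Z >> >> >> >>,
     arg._2._2 >>.

Definition t_eq : term :=
  let x := arg._1 in let y := arg._2 in
  TIf (TIsPair x)
    (TIf (TIsPair y)
       (TIf (TCall f_eq << x._1, y._1 >>) (TCall f_eq << x._2, y._2 >>) 0%Z)
       0%Z)
    (TIf (TIsPair y) 0%Z (TIf (x [<=] y) (y [<=] x) 0%Z)).

Definition t_put : term :=
  let s := arg._1 in let T := arg._2 in let t := T._1 in
  TIf (TIsPair T)
    (TIf (TCall f_eq << s._1, t._1 >>)
       (TIf (t._2._1 [<=] s._2._1) T << s, T._2 >>)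
       << t, TCall f_put << s, T._2 >> >>)
    << s, 0%Z >>.

Definition t_seg : term :=
  let D := arg._1 in let sp := arg._2._1 in
  let x := arg._2._2._1 in let q := arg._2._2._2 in
  << sp, << x [*] sp._2, q [*] D [*] sp._1 >> >>.

Definition s_ext : term :=
  TLet (arg._2._2._1._2._1 [*] arg._1._2._1._2._1)
  (let tau := TVar 0 in let a := TVar 1 in
   let N := a._1._1._1 in let D := a._1._1._2 in
   let j := a._1._2._1 in let s := a._1._2._2 in
   let T := a._2._1 in let x := a._2._2 in
   TCall f_put
     << << << TCall f_update << << N, << x._1._1, << tau, j._2._2 >> >> >>, s._1._1 >>,
              TCall f_round
                << N, << s._1._2 [+] j._2._2 [*] (x._2._1 [+] tau) [+] tau [*] x._2._2, 1%Z >> >> >>,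
           << s._2._1 [+] x._1._2._2._1 [*] j._2._1,
              << << << x._1._1, j >>,
                    << TCall f_seg << D, << x._1._2._2._2, << j._2._1, 1%Z >> >> >>,
                       TCall f_seg << D, << x._1._2._2._2, << 0%Z, 1%Z >> >> >> >> >>,
                 s._2._2 >> >> >>,
        T >>).

Definition s_layer : term :=
  TCall f_ext
    << << arg._1._1, << arg._1._2, arg._2._2 >> >>,
       << arg._2._1, arg._2._2._1._1 >> >>.

Definition s_dp : term :=
  TIf (arg._2._2._1 [-] arg._1._2)
    (TCall f_layer << << arg._1._1, arg._2._2 >>, << 0%Z, arg._2._1 >> >>)
    arg._2._1.

Definition t_cand : term :=
  let x := arg._1._1._2 in let y := arg._1._2._2 in
  TLet (x._1._2._1 [*] arg._2._2._1 [+] y._1._2._1 [*] arg._2._2._2)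
  (let e := (TVar 1)._1._1 in
   let D := e._1._1._1._1 in let j := e._1._1._2 in let s := e._1._2 in
   let x := e._2 in
   let y := (TVar 1)._1._2._2 in let q := (TVar 1)._2._1 in
   let xa := (TVar 1)._2._2._1 in let xb := (TVar 1)._2._2._2 in
   let t := TVar 0 in
   TLet << << q [*] s._1._2 [+] j._2._2 [*] (q [*] x._2._1 [+] t) [+] t [*] x._2._2, q >>,
           TIf (0%Z [<=] j._1)
             << << << x._1._1, j >>,
                   << TCall f_seg << D, << x._1._2._2._2, << xa, q >> >> >>,
                      TCall f_seg << D, << y._1._2._2._2, << xb, q >> >> >> >> >>,
                s._2._2 >>
             s._2._2 >>
   (let c := TVar 0 in let b := (TVar 2)._1._2._1 in
    TIf (TIsPair b)
      (TIf (b._1._1 [*] c._1._2 [<=] c._1._1 [*] b._1._2) b c)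
      c)).

Definition s_pair : term :=
  TLet ((arg._1)._1._1._1._2 [-] (arg._1)._1._2._2._1)
  (TLet ((TVar 1)._1._2._1._2._2._1 [*] (TVar 1)._1._1._1._2._2._1)
  (TLet ((TVar 2)._2._2._1._2._2._1 [*] (TVar 2)._1._1._1._2._2._1)
  (let a := TVar 3 in let B := TVar 2 in let ea := TVar 1 in let eb := TVar 0 in
   let v := a._1._1._1._2._2._1 in let b := a._2._1 in
   let ca := a._1._2._1._2._2._1 in let cb := a._2._2._1._2._2._1 in
   TIf (ea [<=] B) (TCall f_cand << a, << 1%Z, << v, 0%Z >> >> >>)
   (TIf (ca [<=] cb) b
   (TIf (eb [<=] B) (TCall f_cand << a, << ca [-] cb, << B [-] eb, ea [-] B >> >> >>)
     b))))).

Definition s_entry : term :=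
  TCall f_pair << << arg._1, arg._2._2 >>, << arg._2._1, arg._1._2._1._1 >> >>.

Definition s_state : term :=
  TCall f_entry << << arg._1, arg._2._2 >>, << arg._2._1, arg._2._2._1._1 >> >>.

Definition s_split : term :=
  let ND := arg._1._1 in let D := ND._2 in let B := arg._1._2._1 in
  let jobs := arg._1._2._2._1 in let init := arg._1._2._2._2 in
  let b := arg._2._1 in let j := arg._2._2 in
  TCall f_state
    << << << D, B >>, j >>,
       << b, TCall f_dp << << ND, j._1 >>, << << init, 0%Z >>, jobs >> >> >> >>.

Definition s_item : term :=
  let o := arg._2._1 in let x := arg._2._2 in
  TIf (x._1._1 [-] arg._1) o
    << << x._1._2._1, o._1 >>, << x._2._1, << x._2._2, o._2 >> >> >>.

Definition s_out : term :=
  TCall f_item << arg._2._1._1._1, << arg._2._2, arg._1 >> >>.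

Definition s_ids : term := << arg._2._1._1, arg._2._2 >>.

Definition prog : program :=
  [:: t_main; t_prod; t_len; t_idx; s_jobs; foldr_term f_jobs g_jobs 0%Z;
      s_ents; foldr_term f_ents g_ents 0%Z; t_insert;
      foldr_term f_sort f_insert 0%Z; t_round; s_update;
      foldr_term f_update g_update 0%Z; t_eq; t_put; t_seg;
      s_ext; fold_term f_ext g_ext; s_layer; fold_term f_layer g_layer;
      s_dp; fold_term f_dp g_dp; t_cand; s_pair; fold_term f_pair g_pair;
      s_entry; fold_term f_entry g_entry; s_state; fold_term f_state g_state;
      s_split; fold_term f_split g_split; s_item; fold_term f_item g_item;
      s_out; foldr_term f_out g_out << 0%Z, 0%Z >>; s_ids;
      foldr_term f_ids g_ids 0%Z].

(** * Evaluation of the program *)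

Lemma int_size_leqz a b : int_size (leqz a b) = 1%N.
Proof. exact: int_size_bool. Qed.

Definition int_size_lit :=
  (int_size0 : int_size 0%Z = 1%N, int_size1 : int_size 1%Z = 1%N,
   int_size2 : int_size 2%Z = 2%N, int_size0, int_size1, int_size2, int_sizeN,
   int_size_leqz, int_size_bool).

Lemma int_sizeD_sum a b : (int_size (a + b) <= int_size a + int_size b)%N.
Proof. by have := int_sizeD a b; have := int_size_gt0 a; have := int_size_gt0 b; lia. Qed.

(** Replaces the bit length of each compound expression by a fresh number bounded through its parts,
    which leaves a linear problem. The variant [int_size_sum] bounds the length of a sum additively,
    more coarsely but without maxima. *)
Ltac int_size_lia :=
  cbn [binop_sem fst snd]; rewrite ?int_size_lit;
  repeat (
    match goal with
    | |- context [int_size ?e] =>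
        lazymatch e with
        | ?a + ?b =>
            generalize (int_sizeD a b : (int_size e <= (maxn (int_size a) (int_size b)).+1)%N)
        | ?a * ?b =>
            generalize (int_sizeM a b : (int_size e <= int_size a + int_size b)%N)
        | divz ?a ?b =>
            generalize (int_size_div a b : (int_size e <= int_size a)%N)
        end; let n := fresh "n" in move: (int_size e) => n; rewrite ?int_size_lit
    end); repeat (let n := fresh "n" in move: (int_size _) => n); first [clear; lia | lia].

Ltac int_size_sum :=
  cbn [binop_sem fst snd]; rewrite ?int_size_lit;
  repeat (
    match goal with
    | |- context [int_size ?e] =>
        lazymatch e with
        | ?a + ?b =>
            generalize (int_sizeD_sum a b : (int_size e <= int_size a + int_size b)%N)
        | ?a * ?b =>
            generalize (int_sizeM a b : (int_size e <= int_size a + int_size b)%N)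
        | divz ?a ?b =>
            generalize (int_size_div a b : (int_size e <= int_size a)%N)
        end; let n := fresh "n" in move: (int_size e) => n; rewrite ?int_size_lit
    end); repeat (let n := fresh "n" in move: (int_size _) => n); first [clear; lia | lia].

Definition enc_job : job -> sexp := enc_pair Atom (enc_pair Atom Atom).
Definition enc_class : speed_class -> sexp :=
  enc_pair Atom (enc_pair Atom (enc_pair Atom enc_frac)).
Definition enc_entry : entry -> sexp := enc_pair enc_class (enc_pair Atom Atom).
Definition enc_segment : segment -> sexp := enc_pair enc_frac enc_frac.
Definition enc_item : item -> sexp :=
  enc_pair (enc_pair Atom enc_job) (enc_pair enc_segment enc_segment).
Definition enc_key : seq entry * int -> sexp := enc_pair (enc_seq enc_entry) Atom.
Definition enc_state : state -> sexp :=
  enc_pair enc_key (enc_pair Atom (enc_seq enc_item)).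
Definition enc_candidate : candidate -> sexp :=
  enc_pair enc_frac (enc_seq enc_item).
Definition enc_best (b : option candidate) : sexp :=
  if b is Some c then enc_candidate c else Atom 0.
Definition enc_out : out -> sexp := enc_pair (enc_seq Atom) (enc_seq enc_segment).
Definition enc_rates : (int * int) * (int * int) -> sexp := enc_pair enc_frac enc_frac.

Lemma ev_ifb p e t u v (b : bool) x c d d' :
  evaluates_within p e t (Atom (if b then 1 else 0)) c ->
  (b -> evaluates_within p e u x d) -> (b = false -> evaluates_within p e v x d') ->
  evaluates_within p e (TIf t u v) x (c + (d + d')).+1.
Proof.
case: b => ht hu hv; apply: (ev_if ht) => [a0|a0]; first exact: hu.
- by [].
- by rewrite eqxx in a0.
- exact: hv.
Qed.

Lemma ev_ifleq p e t1 t2 u v a b x c1 c2 d d' :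
  evaluates_within p e t1 (Atom a) c1 -> evaluates_within p e t2 (Atom b) c2 ->
  (a <= b -> evaluates_within p e u x d) ->
  ((a <= b) = false -> evaluates_within p e v x d') ->
  evaluates_within p e (TIf (TOp OLeq t1 t2) u v) x
    ((c1 + c2 + int_size a + int_size b).+1 + (d + d')).+1.
Proof. by move=> h1 h2; apply: ev_ifb; apply: (ev_op OLeq h1 h2). Qed.

Local Notation ev := (evaluates_within prog).
Local Notation fn := (nth (TInt 0) prog).

Lemma atom_product_gt0 x : 0 < atom_product x.
Proof.
elim: x => [z|a ha b hb] /=; last exact: mulr_gt0.
by case: ifP => // /negbT; rewrite -ltNge.
Qed.

Lemma int_size_atom_product x : (int_size (atom_product x) <= sexp_size x)%N.
Proof.
elim: x => [z|a ha b hb] /=; first by case: ifP => _; rewrite ?int_size_lit; lia.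
by have := int_sizeM (atom_product a) (atom_product b); lia.
Qed.

Lemma sexp_size_gt0 x : (0 < sexp_size x)%N. Proof. by case: x. Qed.

(** Quadratic because the multiplication at a node costs the bit lengths of the two partial
    products, which are at most the sizes of the subtrees. *)
Lemma ev_prod x : ev [:: x] (fn f_prod) (Atom (atom_product x)) (20 * sexp_size x ^ 2).
Proof.
elim: x => [z|a ha b hb]; rewrite -[fn _]/t_prod; apply: ev_le.
- eapply ev_if_atom; first by evs.
  eapply ev_ifleq; [by evs|by evs| |].
  + by move=> hz; rewrite /= hz; evs.
  + by move=> hz; rewrite /= hz; evs.
- by rewrite !int_size_lit /=; have := int_size_gt0 z; nia.
- eapply ev_if_node; first by evs.
  eapply ev_op; evs; [exact: ha|exact: hb].
- have := int_size_atom_product a; have := int_size_atom_product b; cbn [sexp_size]; rewrite -/atom_product.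
  rewrite -!mulnn; have := sexp_size_gt0 a; have := sexp_size_gt0 b; nia.
Qed.

Lemma ev_len (T : Type) (enc : T -> sexp) (l : seq T) :
  ev [:: enc_seq enc l] (fn f_len) (Atom (size l)%:Z) ((size l + 20) * (size l).+1).
Proof.
elim: l => [|x l IH]; rewrite -[fn _]/t_len; apply: ev_le.
- by eapply ev_if_atom; evs.
- by rewrite /=; lia.
- eapply ev_if_node; first by evs.
  rewrite [(size _)%:Z]/(1 + (size l)%:Z).
  by eapply (ev_op OAdd); evs; exact: IH.
- have : (int_size (size l)%:Z <= (size l).+1)%N.
    by apply: int_size_le; apply: leq_trans (ltn_expl _ _).
  by rewrite !int_size_lit /=; nia.
Qed.

Lemma ev_idx (T : Type) (enc : T -> sexp) Q (l : seq T) k :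
  (int_size k + size l <= Q)%N ->
  ev [:: Node (Atom k) (enc_seq enc l)] (fn f_idx)
     (enc_seq (enc_pair Atom enc) (index_from k l)) ((Q + 30) * (size l).+1).
Proof.
elim: l k => [|x l IH] k hk; rewrite -[fn _]/t_idx; apply: ev_le.
- by eapply ev_if_atom; evs.
- by rewrite /=; lia.
- eapply ev_if_node; first by evs.
  evs; apply: (IH (k + 1)).
  by have := int_sizeD k 1; move: hk; rewrite !int_size_lit /=; have := int_size_gt0 k; lia.
- by move: hk; rewrite !int_size_lit /=; nia.
Qed.

Definition small Q z := (int_size z <= Q)%N.
Definition small_rates Q (x : (int * int) * (int * int)) :=
  [/\ small Q x.1.1, small Q x.1.2, small Q x.2.1 & small Q x.2.2].

Lemma ev_jobs Q D l : small Q D ->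
  (forall s1 x s2, l = s1 ++ x :: s2 -> small_rates Q x.2) ->
  ev [:: Node (Atom D) (enc_seq (enc_pair Atom enc_rates) l)] (fn f_jobs)
     (enc_seq enc_job [seq mk_job D x | x <- l]) ((10 * Q + 100) * size l + 11).
Proof.
move=> hD hl; rewrite -[map _ _]/(foldr (fun x r => mk_job D x :: r) [::] l).
apply: ev_le.
  apply: (ev_foldr (g:=g_jobs) (base:=0%Z) (b:=10 * Q + 70)).
  - by [].
  - by move=> e; evs.
  - move=> s1 x s2 lE; rewrite -[fn _]/s_jobs /s_jobs.
    have [h1 h2 h3 h4] := hl _ _ _ lE; move: (foldr _ _ _) => r.
    apply: ev_le; first by rewrite /enc_job /mk_job /=; evs.
    move: h1 h2 h3 h4 hD; rewrite /small; int_size_lia.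
by lia.
Qed.

Lemma ev_ents Q D l : small Q D ->
  (forall s1 x s2, l = s1 ++ x :: s2 -> small_rates Q x.2) ->
  ev [:: Node (Atom D) (enc_seq (enc_pair Atom enc_rates) l)] (fn f_ents)
     (enc_seq enc_entry [seq mk_entry D x | x <- l]) ((20 * Q + 130) * size l + 11).
Proof.
move=> hD hl; rewrite -[map _ _]/(foldr (fun x r => mk_entry D x :: r) [::] l).
apply: ev_le.
  apply: (ev_foldr (g:=g_ents) (base:=0%Z) (b:=20 * Q + 100)).
  - by [].
  - by move=> e; evs.
  - move=> s1 x s2 lE; rewrite -[fn _]/s_ents /s_ents; cbv zeta.
    have [h1 h2 h3 h4] := hl _ _ _ lE; move: (foldr _ _ _) => r.
    apply: ev_le; first by rewrite /enc_entry /mk_entry; cbv zeta; cbn [enc_seq foldr]; evs.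
    move: h1 h2 h3 h4 hD; rewrite /small; int_size_lia.
by lia.
Qed.

Definition small_job Q (j : job) := [/\ small Q j.1, small Q j.2.1 & small Q j.2.2].

Lemma size_insert x l : size (insert x l) = (size l).+1.
Proof. by elim: l => //= y l IH; case: ifP => //= _; rewrite IH. Qed.

Lemma mem_insert x l : insert x l =i x :: l.
Proof.
move=> y; elim: l => //= z l IH; case: ifP => //= _.
by rewrite !inE IH !inE orbCA.
Qed.

Lemma ev_insert Q env x l : small_job Q x -> (forall y, y \in l -> small_job Q y) ->
  ev [:: Node env (Node (enc_job x) (enc_seq enc_job l))] (fn f_insert)
     (enc_seq enc_job (insert x l)) ((10 * Q + 100) * (size l).+1).
Proof.
move=> hx; elim: l env => [|y l IH] env hl; rewrite -[fn _]/t_insert /t_insert; cbv zeta; apply: ev_le.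
- by eapply ev_if_atom; evs.
- by rewrite /=; lia.
- rewrite [insert _ _]/=.
  eapply ev_if_node; first by evs.
  eapply (@ev_ifb _ _ _ _ _ (smith x y)).
  + rewrite /smith; eapply ev_if; first by evs.
      move=> ->; eapply ev_if; first by evs.
        by move=> ->; evs.
      by move=> ->; rewrite eqxx; evs.
    by move=> ->; rewrite eqxx; evs.
  + by move=> ->; evs.
  + move=> ->; evs; apply: IH => z zl; apply: hl.
    by rewrite inE zl orbT.
- have [h1 h2 h3] := hx; have [h4 h5 h6] := hl y (mem_head _ _).
  by move: h1 h2 h3 h4 h5 h6; rewrite /small; cbn [size]; int_size_lia.
Qed.

Lemma mem_isort l : isort l =i l.
Proof. by elim: l => //= x l IH y; rewrite mem_insert !inE IH. Qed.

Lemma size_isort l : size (isort l) = size l.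
Proof. by elim: l => //= x l IH; rewrite size_insert IH. Qed.

Lemma ev_sort Q l : (forall y, y \in l -> small_job Q y) ->
  ev [:: Node (Atom 0) (enc_seq enc_job l)] (fn f_sort)
     (enc_seq enc_job (isort l)) ((10 * Q + 130) * (size l).+1 * (size l).+1).
Proof.
move=> hl; apply: ev_le.
  apply: (ev_foldr (f:=f_sort) (g:=f_insert) (base:=0%Z) (b:=(10 * Q + 100) * (size l).+1)).
  - by [].
  - by move=> e; evs.
  - move=> s1 x s2 lE; apply: ev_le.
      apply: (ev_insert (Q:=Q)); first by apply: hl; rewrite lE mem_cat mem_head orbT.
      move=> y; rewrite -/(isort s2) mem_isort => ys2.
      by apply: hl; rewrite lE mem_cat inE ys2 !orbT.
    rewrite -/(isort s2) size_isort lE size_cat /=.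
    by rewrite leq_mul // ltnS (leq_trans (leqnSn _)) ?leq_addl.
move: (size l) => k; nia.
Qed.

(** The fuel [k] has no counterpart in the code. By [x < d * 2 ^ k], the code stops doubling no
    later than the fuel runs out: at [k = 0] the test [2 * N * d <= x] is bound to fail. *)
Lemma ev_round_loop Q N x k d : small Q N -> small Q x -> (int_size d <= (int_size x).+1)%N ->
  0 < N -> 0 < d -> x < d * 2 ^+ k ->
  ev [:: Node (Atom N) (Node (Atom x) (Atom d))] (fn f_round)
     (Atom (round_loop k N x d)) ((20 * Q + 200) * k.+1).
Proof.
rewrite /small => hN hx; elim: k d => [|k IH] d hd N0 d0 hk; rewrite -[fn _]/t_round /t_round; cbv zeta; apply: ev_le.
- eapply (ev_ifleq (d:=0%N)); [by evs|by evs| |].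
    by move: hk; rewrite expr0 mulr1 /= => *; exfalso; nia.
  by move=> _; rewrite [round_loop _ _ _ _]/=; evs.
- move: hN hx hd; int_size_lia.
- eapply ev_ifleq; [by evs|by evs| |].
    cbn [binop_sem] => hle; rewrite [round_loop _ _ _ _]/= hle; evs.
    cbn [binop_sem]; apply: IH => //; last 1 first.
    + by have -> : (d + d) * 2 ^+ k = d * 2 ^+ k.+1 by rewrite exprS; ring.
    + apply: leqW; apply: leq_int_size; have : d + d <= x by apply: le_trans hle; nia.
      move: d0; clear; lia.
    + by nia.
  by cbn [binop_sem] => hle; rewrite [round_loop _ _ _ _]/= hle; evs.
- move: hN hx hd; int_size_lia.
Qed.

Definition b_round Q := ((20 * Q + 200) * Q.+1)%N.

Lemma ev_round Q N x : small Q N -> small Q x -> 0 < N ->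
  ev [:: Node (Atom N) (Node (Atom x) (Atom 1))] (fn f_round)
     (Atom (round N x)) (b_round Q).
Proof.
move=> hN hx N0; apply: ev_le.
  apply: ev_round_loop hN hx _ N0 _ _ => //.
  rewrite mul1r; have := ltn_int_size x; rewrite -(ltr_nat int).
  by rewrite natrX; apply: le_lt_trans; lia.
by rewrite leq_mul2l; apply/orP; right.
Qed.

Lemma sub_small Q Q' z : small Q z -> (Q <= Q')%N -> small Q' z.
Proof. exact: leq_trans. Qed.

Lemma small_addM Q a b c : small Q a -> int_size b = 1%N -> small Q c -> small (2 * Q + 2) (a + b * c).
Proof. by rewrite /small => h1 h2 h3; move: h1 h2 h3; int_size_lia. Qed.

Definition b_update Q := (2 * b_round (2 * Q + 2) + 20 * Q + 200)%N.

Lemma ev_update Q N i tau w l : small Q N -> 0 < N -> small Q i -> small Q tau -> small Q w ->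
  (forall x, x \in l -> [/\ small Q x.1.1, small Q x.2.1 & small Q x.2.2]) ->
  ev [:: Node (Node (Atom N) (Node (Atom i) (Node (Atom tau) (Atom w)))) (enc_seq enc_entry l)]
     (fn f_update) (enc_seq enc_entry [seq update N i tau w y | y <- l])
     ((b_update Q + 30) * size l + 11).
Proof.
move=> hN N0 hi ht hw hl; rewrite -[map _ _]/(foldr (fun y r => update N i tau w y :: r) [::] l).
have hN' : small (2 * Q + 2) N by apply: sub_small hN _; lia.
apply: ev_le.
  apply: (ev_foldr (g:=g_update) (base:=0%Z) (b:=b_update Q)).
  - by [].
  - by move=> e; evs.
  - move=> s1 x s2 lE; rewrite -[fn _]/s_update /s_update; cbv zeta.
    have [h1 h2 h3] : [/\ small Q x.1.1, small Q x.2.1 & small Q x.2.2].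
      by apply: hl; rewrite lE mem_cat mem_head orbT.
    move: (foldr _ _ _) => r; apply: ev_le.
      rewrite /enc_entry /update; cbn [enc_seq foldr]; evs.
        by apply: (ev_round (Q:=2 * Q + 2)) => //; cbn [binop_sem]; rewrite -!/(leqz _ _);
          apply: small_addM => //; exact: int_size_leqz.
      by apply: (ev_round (Q:=2 * Q + 2)) => //; cbn [binop_sem]; rewrite -!/(leqz _ _);
          apply: small_addM => //; exact: int_size_leqz.
    move: hi ht hw hN h1 h2 h3; rewrite /small /b_update; cbn [binop_sem].
    rewrite -!/(leqz _ _); int_size_lia.
by rewrite -addnA.
Qed.

Lemma sexp_eq_dec (x y : sexp) : {x = y} + {x <> y}.
Proof. by decide equality; exact: eq_comparable. Qed.

(** With [reflect], the result can be identified with any boolean deciding the equality; for keys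
    this is their own [==], by injectivity of the encoding. Leaves are compared by two inequalities,
    [OLeq] being the only comparison of the language. *)
Lemma ev_eq x y (b : bool) : reflect (x = y) b ->
  ev [:: Node x y] (fn f_eq) (Atom (if b then 1 else 0))
     (20 * (sexp_size x + sexp_size y)).
Proof.
elim: x y b => [z|x1 IH1 x2 IH2] [z'|y1 y2] b hb; rewrite -[fn _]/t_eq /t_eq; cbv zeta; apply: ev_le.
- eapply ev_if_atom; first by evs.
  eapply ev_if_atom; first by evs.
  eapply ev_ifleq; [by evs|by evs| |].
    move=> h1; have -> : b = (z' <= z).
      by apply/hb/idP => [[->]//|h2]; congr Atom; apply/le_anti/andP.
    by evs.
  move=> h1; have -> : b = false by apply/hb => -[zz]; move: h1; rewrite zz lexx.
  by evs.
- by rewrite /=; have := int_size_gt0 z; have := int_size_gt0 z'; lia.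
- eapply ev_if_atom; first by evs.
  eapply ev_if_node; first by evs.
  have -> : b = false by apply/hb.
  by evs.
- by rewrite /=; lia.
- eapply ev_if_node; first by evs.
  eapply ev_if_atom; first by evs.
  have -> : b = false by apply/hb.
  by evs.
- by rewrite /=; lia.
- eapply ev_if_node; first by evs.
  eapply ev_if_node; first by evs.
  have [b1 hb1] : {b1 & reflect (x1 = y1) b1}.
    by case: (sexp_eq_dec x1 y1) => h; [exists true|exists false]; constructor.
  have [b2 hb2] : {b2 & reflect (x2 = y2) b2}.
    by case: (sexp_eq_dec x2 y2) => h; [exists true|exists false]; constructor.
  have -> : b = b1 && b2.
    by apply/hb/andP => [[/hb1 -> /hb2 ->]|[/hb1 -> /hb2 ->]].
  eapply ev_ifb; first by evs; exact: IH1 hb1.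
    by move=> ->; evs; exact: IH2 hb2.
  by move=> ->; evs.
- by cbn [sexp_size]; lia.
Qed.

Lemma enc_seq_inj (T : Type) (enc : T -> sexp) : injective enc -> injective (enc_seq enc).
Proof. by move=> inj; elim=> [|x l IH] [|y l'] //= [/inj -> /IH ->]. Qed.

Lemma enc_pair_inj (T U : Type) (f : T -> sexp) (g : U -> sexp) :
  injective f -> injective g -> injective (enc_pair f g).
Proof. by move=> hf hg [a b] [c d] [/= /hf -> /hg ->]. Qed.

Lemma Atom_inj : injective Atom. Proof. by move=> a b []. Qed.

Lemma enc_key_inj : injective enc_key.
Proof.
apply: enc_pair_inj Atom_inj; apply: enc_seq_inj; apply: enc_pair_inj.
  do 3! [apply: enc_pair_inj; first exact: Atom_inj].
  exact: enc_pair_inj Atom_inj Atom_inj.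
exact: enc_pair_inj Atom_inj Atom_inj.
Qed.

Definition small_entry Q (x : entry) :=
  [/\ small Q x.1.1, small Q x.1.2.1, small Q x.1.2.2.1 &
      [/\ small Q x.1.2.2.2.1, small Q x.1.2.2.2.2, small Q x.2.1 & small Q x.2.2]].

Definition small_state Q (s : state) :=
  [/\ forall x : entry, x \in s.1.1 -> small_entry Q x, (size s.1.1 <= Q)%N,
      small Q s.1.2 & small Q s.2.1].

Definition b_key Q := (Q * (7 * Q + 30) + 2 * Q + 10)%N.

Lemma key_size_le Q (s : state) : small_state Q s -> (sexp_size (enc_key s.1) <= b_key Q)%N.
Proof.
move=> [h1 h2 h3 h4]; rewrite /enc_key /=.
have : (sexp_size (enc_seq enc_entry s.1.1) <= size s.1.1 * (7 * Q + 30) + 2)%N.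
  elim: (s.1.1) h1 => [|x l IH] hl; first by rewrite /= int_size_lit.
  have [] := hl x (mem_head _ _); rewrite /small => ? ? ? [? ? ? ?].
  have {}IH : (sexp_size (enc_seq enc_entry l) <= size l * (7 * Q + 30) + 2)%N.
    by apply: IH => y yl; apply: hl; rewrite inE yl orbT.
  by move: IH; rewrite /=; lia.
move: h3; rewrite /small /b_key.
have : (size s.1.1 * (7 * Q + 30) <= Q * (7 * Q + 30))%N by rewrite leq_mul2r h2 orbT.
lia.
Qed.

Definition b_put Q n := ((40 * b_key Q + 2 * Q + 100) * n.+1)%N.

Lemma ev_put Q (s : state) (T : seq state) : small_state Q s -> (forall t : state, t \in T -> small_state Q t) ->
  ev [:: Node (enc_state s) (enc_seq enc_state T)] (fn f_put)
     (enc_seq enc_state (put s T)) (b_put Q (size T)).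
Proof.
move=> hs; elim: T => [|t T IH] hT; rewrite -[fn _]/t_put /t_put; cbv zeta; apply: ev_le.
- by eapply ev_if_atom; evs.
- by rewrite /b_put /=; lia.
- eapply ev_if_node; first by evs.
  rewrite [put _ _]/=; eapply (@ev_ifb _ _ _ _ _ (s.1 == t.1)).
  + evs; apply: (@ev_eq (enc_key s.1) (enc_key t.1)).
    by apply: (iffP eqP) => [->//|/enc_key_inj].
  + move=> ->; eapply ev_ifleq; [by evs|by evs| |].
      by move=> ->; evs.
    by move=> ->; evs.
  + move=> ->; evs; apply: IH => u uT; apply: hT.
    by rewrite inE uT orbT.
- have ht := hT t (mem_head _ _).
  have := key_size_le hs; have := key_size_le ht; move: hs ht => [_ _ _ h1] [_ _ _ h2].
  have -> : b_put Q (size (t :: T)) = (b_put Q (size T) + (40 * b_key Q + 2 * Q + 100))%N.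
    by rewrite /b_put /= [LHS]mulnSr.
  rewrite /small in h1 h2; move: h1 h2 (b_put _ _).
  move: (sexp_size _) (sexp_size _) (int_size _) (int_size _) (b_key _); lia.
Qed.

Lemma ev_seg Q D sp x q : small Q D -> small Q sp.1 -> small Q sp.2 -> small Q x -> small Q q ->
  ev [:: Node (Atom D) (Node (enc_frac sp) (Node (Atom x) (Atom q)))] (fn f_seg)
     (enc_segment (mk_segment D sp x q)) (20 * Q + 100).
Proof.
move=> h1 h2 h3 h4 h5; rewrite -[fn _]/t_seg /t_seg; cbv zeta; apply: ev_le.
  by rewrite /enc_segment /mk_segment /enc_frac; evs.
by move: h1 h2 h3 h4 h5; rewrite /small; int_size_lia.
Qed.

Definition b_extend Q := (b_round (5 * Q + 10) + b_update (2 * Q) * Q + 30 * Q + 2 * (20 * Q + 100) + 60 * Q + 1000)%N.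

Lemma ev_ext_step Q N D (j : job) (s : state) (x : entry) (T : seq state) : 0 < N -> small Q N -> small Q D -> small_job Q j ->
  small_state Q s -> x \in s.1.1 -> small_state Q (extend N D j s x) ->
  (forall t : state, t \in T -> small_state Q t) ->
  ev [:: Node (Node (Node (Atom N) (Atom D)) (Node (enc_job j) (enc_state s)))
              (Node (enc_seq enc_state T) (enc_entry x))] (fn g_ext)
     (enc_seq enc_state (put (extend N D j s x) T)) (b_extend Q + b_put Q (size T)).
Proof.
have Q5 : (Q <= 5 * Q + 10)%N by lia.
move=> N0 hN hD [hj1 hj2 hj3] hs xs hs' hT.
have [hs1 hs2 hs3 hs4] := hs.
have [hx1 hx2 hx3 [hx4 hx5 hx6 hx7]] := hs1 x xs.
have tau_small : small (2 * Q) (x.1.2.1 * j.2.1).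
  by move: hx2 hj2; rewrite /small; int_size_lia.
have mono z : small Q z -> small (2 * Q) z by move=> /sub_small; apply; exact: leq_pmull.
have Q0 : (0 < Q)%N by apply: leq_trans hN.
have small0 : small Q 0 by rewrite /small int_size_lit.
have small1 : small Q 1 by rewrite /small int_size_lit.
rewrite -[fn _]/s_ext /s_ext; cbv zeta; apply: ev_le.
  evs.
  - apply: (ev_update (Q := 2 * Q)); try exact: mono; try exact: tau_small; first by [].
    move=> y /hs1[? ? ? [? ? ? ?]]; split; exact: mono.
  - apply: (ev_round (Q := 5 * Q + 10)) => //; first exact: sub_small hN _.
    by move: hj2 hx2 hj3 hx6 hx7 hs3 tau_small; rewrite /small; int_size_lia.
  - by apply: (ev_seg (Q := Q)).
  - by apply: (ev_seg (Q := Q)).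
  - exact: (ev_put hs' hT).
have : ((b_update (2 * Q) + 30) * size s.1.1 <= b_update (2 * Q) * Q + 30 * Q)%N.
  by rewrite -mulnDl leq_mul2l hs2 orbT.
move: hj1 hj2 hj3 hs2 hs3 hs4 hx1 hx2 hx3 hx4 hx5 hx6 hx7 tau_small.
rewrite /small /b_extend.
move: (b_round _) (b_update _ * Q)%N (b_put _ _) => u v w.
move: (_ * size _)%N => y; int_size_lia.
Qed.

(** * Reachable states and evaluation of the dynamic program *)

Inductive reach (N D : int) (s0 : state) : seq job -> state -> Prop :=
| reach_nil : reach N D s0 [::] s0
| reach_cons js j s x : reach N D s0 js s -> x \in s.1.1 ->
    reach N D s0 (j :: js) (extend N D j s x).

Lemma put_keys (s : state) (T : seq state) :
  [seq t.1 | t <- put s T] =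
  if s.1 \in [seq t.1 | t <- T] then [seq t.1 | t <- T]
  else rcons [seq t.1 | t <- T] s.1.
Proof.
elim: T => //= t T IH; rewrite inE.
case: eqP => [st|_] /=; first by case: ifP => _ //=; rewrite st.
by rewrite IH; case: ifP.
Qed.

Lemma mem_put (s t : state) (T : seq state) : t \in put s T -> t = s \/ t \in T.
Proof.
elim: T => [|u T IH] /=; first by rewrite inE => /eqP; left.
case: eqP => _; last first.
  by rewrite !inE => /predU1P[->|/IH[->|->]]; [right; rewrite eqxx|left|right; rewrite orbT].
by case: ifP => _; rewrite ?inE; [right|move=> /predU1P[->|->]; [left|right; rewrite orbT]].
Qed.

Section Table.
Variables (N D : int) (s0 : state) (J : seq job) (Q : nat).
Local Notation reach := (reach N D s0).

Definition subjobs (js : seq job) := (size js <= size J)%N /\ {subset js <= J}.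

(** Distinct keys bound the length of a table by the number of possible keys, and reachability
    bounds the integers in it; the time analysis rests on these two facts. *)
Definition table (js : seq job) (T : seq state) : Prop :=
  uniq [seq t.1 | t : state <- T] /\ (forall t : state, t \in T -> reach js t).

Hypothesis N_gt0 : 0 < N.
Hypothesis N_small : small Q N.
Hypothesis D_small : small Q D.
Hypothesis J_small : forall j : job, j \in J -> small_job Q j.
Hypothesis reach_small : forall js s, subjobs js -> reach js s -> small_state Q s.
Hypothesis table_small : forall js (T : seq state), subjobs js -> table js T -> (size T <= Q)%N.

Lemma put_table js j (s : state) (x : entry) (T : seq state) : reach js s -> x \in s.1.1 ->
  table (j :: js) T -> table (j :: js) (put (extend N D j s x) T).
Proof.
move=> hs xs [h1 h2]; split.
  by rewrite put_keys; case: ifP => // h; rewrite rcons_uniq h.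
by move=> t /mem_put[->|/h2//]; apply: reach_cons.
Qed.

Lemma ext_table js (j : job) (s : state) (T : seq state) : reach js s -> table (j :: js) T ->
  forall l : seq entry, {subset l <= s.1.1} ->
  table (j :: js) (foldl (fun T x => put (extend N D j s x) T) T l).
Proof.
move=> hs hT l; elim: l T hT => //= x l IH T hT hl; apply: IH => [|y yl].
  by apply: put_table => //; apply: hl; exact: mem_head.
by apply: hl; rewrite inE yl orbT.
Qed.

Definition b_ext := ((b_extend Q + b_put Q Q + 30) * Q.+1)%N.

Lemma ev_ext js (j : job) (s : state) (T : seq state) : subjobs (j :: js) -> subjobs js -> reach js s ->
  table (j :: js) T ->
  ev [:: Node (Node (Node (Atom N) (Atom D)) (Node (enc_job j) (enc_state s)))
              (Node (enc_seq enc_state T) (enc_seq enc_entry s.1.1))] (fn f_ext)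
     (enc_seq enc_state (ext N D j s T)) b_ext.
Proof.
move=> hjs hjs' hs hT.
have ss := reach_small hjs' hs; have [h1 h2 h3 h4] := ss.
apply: ev_le.
  apply: (ev_fold (f:=f_ext) (g:=g_ext) (b:=b_extend Q + b_put Q Q) (encT:=enc_entry)) => //.
  move=> s1 x s2 lE.
  have xs : x \in s.1.1 by rewrite lE mem_cat mem_head orbT.
  have hT' : table (j :: js) (foldl (fun T x => put (extend N D j s x) T) T s1).
    by apply: (ext_table hs hT) => y ys; rewrite lE mem_cat ys.
  apply: ev_le.
    apply: (ev_ext_step _ _ _ _ ss xs) => //.
    - by apply: J_small; case: hjs => _; apply; exact: mem_head.
    - by apply: (reach_small hjs); apply: reach_cons.
    - by move=> t; case: hT' => _ /[apply]; apply: reach_small.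
  by rewrite leq_add2l leq_mul2l ltnS (table_small hjs hT') orbT.
by rewrite leq_mul2l ltnS h2 orbT.
Qed.

Definition b_layer := ((b_ext + 60) * Q.+1)%N.

Lemma layer_table js (j : job) (T : seq state) : (forall s : state, s \in T -> reach js s) ->
  table (j :: js) (layer N D j T).
Proof.
move=> hT; rewrite /layer.
have : table (j :: js) [::] by [].
elim: T [::] hT => //= s T IH T' hT hT'; apply: IH => [t tT|].
  by apply: hT; rewrite inE tT orbT.
by apply: (ext_table _ hT') => //; apply: hT; exact: mem_head.
Qed.

Lemma ev_layer js (j : job) (T : seq state) : subjobs (j :: js) -> subjobs js -> table js T ->
  ev [:: Node (Node (Node (Atom N) (Atom D)) (enc_job j))
              (Node (Atom 0) (enc_seq enc_state T))] (fn f_layer)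
     (enc_seq enc_state (layer N D j T)) b_layer.
Proof.
move=> hjs hjs' hT; have [h1 h2] := hT.
apply: ev_le.
  apply: (ev_fold (f:=f_layer) (g:=g_layer) (b:=b_ext + 30) (encT:=enc_state)
     (encA:=enc_seq enc_state) (h:=fun T' s => ext N D j s T') (a:=[::])) => //.
  move=> s1 s s2 lE.
  have hT' : table (j :: js) (layer N D j s1).
    by apply: layer_table => t ts; apply: h2; rewrite lE mem_cat ts.
  rewrite -[fn g_layer]/s_layer /s_layer; apply: ev_le.
    evs; apply: (ev_ext hjs hjs' _ hT').
    by apply: h2; rewrite lE mem_cat mem_head orbT.
  by rewrite /=; lia.
rewrite /b_layer -addnA leq_mul// ltnS; exact: table_small hT.
Qed.

Definition kept (id : int) (l : seq job) := [seq j <- l | j.1 - id != 0].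

Lemma dpE id (T : seq state) l :
  dp N D id T l = foldl (fun T j => layer N D j T) T (kept id l).
Proof. by elim: l T => //= j l IH T; rewrite /dp /= -/(dp _ _ _ _ _) IH /dp_step; case: ifP. Qed.

(** [reach] lists the latest insertion first, hence the reversal. *)
Lemma dp_table id l : table (rev (kept id l)) (dp N D id [:: s0] l).
Proof.
rewrite dpE; elim/last_ind: (kept id l) => [|js j [h1 h2]].
  by split => // t; rewrite inE => /eqP ->; exact: reach_nil.
by rewrite rev_rcons foldl_rcons; exact: layer_table.
Qed.

Lemma subjobs_kept id l1 l2 : J = l1 ++ l2 -> subjobs (rev (kept id l1)).
Proof.
move=> JE; split.
  by rewrite size_rev size_filter JE size_cat (leq_trans (count_size _ _)) ?leq_addr.
by move=> j; rewrite mem_rev mem_filter JE mem_cat => /andP[_ ->].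
Qed.

Definition b_dp := ((b_layer + 10 * Q + 200) * Q.+1)%N.

Lemma ev_dp (id : int) : small Q id -> (size J <= Q)%N ->
  ev [:: Node (Node (Node (Atom N) (Atom D)) (Atom id))
              (Node (enc_seq enc_state [:: s0]) (enc_seq enc_job J))] (fn f_dp)
     (enc_seq enc_state (dp N D id [:: s0] J)) b_dp.
Proof.
move=> hid hJ; apply: ev_le.
  apply: (ev_fold (f:=f_dp) (g:=g_dp) (b:=b_layer + 10 * Q + 100) (encT:=enc_job)
     (encA:=enc_seq enc_state) (h:=dp_step N D id) (a:=[:: s0])) => //.
  move=> s1 j s2 lE.
  have [jid _ _] : small_job Q j by apply: J_small; rewrite lE mem_cat mem_head orbT.
  have hT := dp_table id s1; rewrite -/(dp N D id [:: s0] s1).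
  rewrite -[fn g_dp]/s_dp /s_dp; apply: ev_le.
    rewrite /dp_step; eapply ev_if; first by evs.
      cbn [binop_sem] => hne; rewrite (ifT _ _ hne); evs.
      apply: ev_layer hT.
        rewrite (_ : j :: _ = rev (kept id (rcons s1 j))).
          by apply: (@subjobs_kept _ _ s2); rewrite lE cat_rcons.
        by rewrite /kept filter_rcons hne rev_rcons.
      exact: subjobs_kept lE.
    cbn [binop_sem] => /eqP /negbF h0; rewrite (ifF _ _ h0); evs.
  by move: jid hid; rewrite /small; int_size_lia.
rewrite /b_dp -addnA leq_mul//; lia.
Qed.

End Table.

Definition small_best Q (b : option candidate) : Prop :=
  if b is Some c then small Q c.1.1 /\ small Q c.1.2 else True.

Definition enc_split (D B : int) (j : job) (s : state) (x : entry) : sexp :=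
  Node (Node (Node (Node (Atom D) (Atom B)) (enc_job j)) (enc_state s)) (enc_entry x).

Lemma ev_cand Q D B (j : job) (s : state) (x y : entry) b q xa xb :
  small Q D -> small_job Q j -> small Q s.1.2 -> small_entry Q x -> small_entry Q y ->
  small_best Q b -> small Q q -> small Q xa -> small Q xb ->
  ev [:: Node (Node (enc_split D B j s x) (Node (enc_best b) (enc_entry y)))
              (Node (Atom q) (Node (Atom xa) (Atom xb)))]
     (fn f_cand) (enc_best (better b (mk_candidate D j s x y q xa xb)))
     (500 * Q + 1000).
Proof.
move=> hD [hj1 hj2 hj3] hK [hx1 hx2 hx3 [hx4 hx5 hx6 hx7]] [hy1 hy2 hy3 [hy4 hy5 hy6 hy7]].
move=> hb hq ha hb'.
have small0 : small Q 0 by rewrite /small int_size_lit; apply: leq_trans hq.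
have small1 : small Q 1 by rewrite /small int_size_lit; apply: leq_trans hq.
rewrite -[fn _]/t_cand /t_cand; cbv zeta.
pose c := mk_candidate D j s x y q xa xb; rewrite -/c.
apply: ev_le.
  eapply ev_let; first by evs.
  cbn [binop_sem].
  eapply (@ev_let _ _ _ _ (enc_candidate c)).
    eapply ev_pair; first by evs.
    rewrite /c /mk_candidate; cbn [fst snd].
    eapply ev_ifleq; [by evs|by evs| |].
      move=> h; rewrite h; evs.
        exact: (@ev_seg Q D x.1.2.2.2 xa q).
      exact: (@ev_seg Q D y.1.2.2.2 xb q).
    by move=> h; rewrite h; evs.
  instantiate (1 := (100 * Q + 200)%N).
  case: b hb => [b [hb1 hb2]|_]; last first.
    by apply: ev_le; [eapply ev_if_atom; evs|clear; lia].
  apply: ev_le.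
    eapply ev_if_node; first by evs.
    eapply ev_ifleq; [by evs|by evs| |].
      by move=> h; cbn [binop_sem] in h; rewrite /= h; evs.
    by move=> h; cbn [binop_sem] in h; rewrite /= h; evs.
  move: hb1 hb2 hq ha hb' hK hj3 hx2 hx6 hx7 hy2.
  rewrite /c /mk_candidate /class_time /small.
int_size_sum.
move: hq ha hb' hK hj1 hj3 hx2 hx6 hx7 hy2.
rewrite /small /class_time; int_size_sum.
Qed.

Lemma small_better Q b c : small_best Q b -> small Q c.1.1 -> small Q c.1.2 ->
  small_best Q (better b c).
Proof. by case: b => [b|] hb h1 h2 //=; case: ifP. Qed.

Section Candidates.
Variables (Q : nat) (D B : int).
Hypotheses (D_small : small Q D) (B_small : small Q B).
(** Every integer in a candidate is obtained from [Q]-bit integers by a bounded number of additions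
    and multiplications, so that a fixed multiple of [Q] bits suffices. *)
Let Q' := (40 * Q + 40)%N.

Lemma small_Q' z : small Q z -> small Q' z.
Proof. by move=> /sub_small; apply; rewrite /Q'; lia. Qed.

Lemma small_entry_Q' x : small_entry Q x -> small_entry Q' x.
Proof. by move=> [? ? ? [? ? ? ?]]; split; [..|split]; exact: small_Q'. Qed.

Definition b_pair := (2000 * Q' + 9000)%N.

Lemma try_pair_small (j : job) (s : state) (x y : entry) b :
  small_job Q j -> small_state Q s -> small_entry Q x -> small_entry Q y ->
  small_best Q' b -> small_best Q' (try_pair D B j s x b y).
Proof.
move=> [hj1 hj2 hj3] [_ _ hK hE] [_ hx2 hx3 [_ _ hx6 hx7]] [_ hy2 hy3 _] hb.
rewrite /try_pair; case: ifP => _.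
  apply: small_better => //; rewrite /mk_candidate /class_time.
    move: hj2 hj3 hK hx2 hx6 hx7 hy2; rewrite /small /Q'; int_size_sum.
  by rewrite /small /= int_size_lit; clear; lia.
case: ifP => // _; case: ifP => // _.
apply: small_better => //; rewrite /mk_candidate /class_time /class_energy.
  move: B_small hj2 hj3 hK hE hx2 hx3 hx6 hx7 hy2 hy3; rewrite /small /Q'; int_size_sum.
move: hx3 hy3; rewrite /small /Q'; int_size_sum.
Qed.

Lemma ev_try_pair (j : job) (s : state) (x y : entry) b :
  small_job Q j -> small_state Q s -> small_entry Q x -> small_entry Q y ->
  small_best Q' b ->
  ev [:: Node (enc_split D B j s x) (Node (enc_best b) (enc_entry y))]
     (fn g_pair) (enc_best (try_pair D B j s x b y)) b_pair.
Proof.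
move=> hj [_ _ hK hE] hx hy hb.
have hj' : small_job Q' j by case: hj => ? ? ?; split; exact: small_Q'.
have [_ hj2 _] := hj; have [_ _ hx3 _] := hx; have [_ _ hy3 _] := hy.
rewrite -[fn _]/s_pair /s_pair; cbv zeta.
apply: ev_le.
  eapply ev_let; first by evs.
  eapply ev_let; first by evs.
  eapply ev_let; first by evs.
  rewrite /try_pair /class_energy; cbv zeta; cbn [binop_sem].
  eapply ev_ifleq; [by evs|by evs| |].
    move=> h; rewrite h; evs; cbn [binop_sem].
    apply: (@ev_cand Q'); try exact: small_Q'; try exact: small_entry_Q'; try by [].
    - by rewrite /small int_size_lit /Q'; clear; lia.
    - by rewrite /small int_size_lit /Q'; clear; lia.
  move=> h; rewrite h; eapply ev_ifleq; [by evs|by evs| |].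
    by move=> h'; rewrite h'; evs.
  move=> h'; rewrite h'; eapply ev_ifleq; [by evs|by evs| |].
    move=> h''; rewrite h''; evs; cbn [binop_sem].
    apply: (@ev_cand Q'); try exact: small_Q'; try exact: small_entry_Q'; try by [].
    - move: hx3 hy3; rewrite /small /Q'; int_size_sum.
    - move: B_small hE hj2 hy3; rewrite /small /Q'; int_size_sum.
    - move: B_small hE hj2 hx3; rewrite /small /Q'; int_size_sum.
  by move=> h''; rewrite h''; evs.
move: B_small hE hj2 hx3 hy3.
rewrite /small /b_pair /Q'; int_size_sum.
Qed.

Definition b_entry := ((b_pair + 30) * Q.+1)%N.

Lemma try_entry_small (j : job) (s : state) (x : entry) l b :
  small_job Q j -> small_state Q s -> small_entry Q x ->
  (forall y : entry, y \in l -> small_entry Q y) ->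
  small_best Q' b -> small_best Q' (foldl (try_pair D B j s x) b l).
Proof.
move=> hj hs hx; elim: l b => //= y l IH b hl hb; apply: IH.
  by move=> z zl; apply: hl; rewrite inE zl orbT.
by apply: try_pair_small => //; apply: hl; exact: mem_head.
Qed.

Lemma ev_try_entry (j : job) (s : state) (x : entry) b :
  small_job Q j -> small_state Q s -> small_entry Q x -> small_best Q' b ->
  ev [:: Node (enc_split D B j s x) (Node (enc_best b) (enc_seq enc_entry s.1.1))]
     (fn f_pair) (enc_best (try_entry D B j s b x)) b_entry.
Proof.
move=> hj hs hx hb; have [h1 h2 _ _] := hs; apply: ev_le.
  apply: (ev_fold (f:=f_pair) (g:=g_pair) (b:=b_pair) (encT:=enc_entry)) => //.
  move=> s1 y s2 lE; apply: ev_try_pair => //.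
    by apply: h1; rewrite lE mem_cat mem_head orbT.
  by apply: try_entry_small => // z zs; apply: h1; rewrite lE mem_cat zs.
by rewrite leq_mul2l ltnS h2 orbT.
Qed.

Definition b_state := ((b_entry + 60) * Q.+1)%N.

Lemma try_state_small (j : job) (s : state) l b :
  small_job Q j -> small_state Q s -> (forall y : entry, y \in l -> small_entry Q y) ->
  small_best Q' b -> small_best Q' (foldl (try_entry D B j s) b l).
Proof.
move=> hj hs; elim: l b => //= y l IH b hl hb; apply: IH.
  by move=> z zl; apply: hl; rewrite inE zl orbT.
apply: try_entry_small => //; first by apply: hl; exact: mem_head.
by case: hs.
Qed.

Lemma ev_try_state (j : job) (s : state) b :
  small_job Q j -> small_state Q s -> small_best Q' b ->
  ev [:: Node (Node (Node (Node (Atom D) (Atom B)) (enc_job j)) (enc_state s))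
              (Node (enc_best b) (enc_seq enc_entry s.1.1))]
     (fn f_entry) (enc_best (try_state D B j b s)) b_state.
Proof.
move=> hj hs hb; have [h1 h2 _ _] := hs; apply: ev_le.
  apply: (ev_fold (f:=f_entry) (g:=g_entry) (b:=b_entry + 30) (encT:=enc_entry)) => //.
  move=> s1 x s2 lE; rewrite -[fn _]/s_entry /s_entry; apply: ev_le.
    evs; apply: (ev_try_entry hj hs).
      by apply: h1; rewrite lE mem_cat mem_head orbT.
    by apply: try_state_small => // z zs; apply: h1; rewrite lE mem_cat zs.
  by clear; lia.
by rewrite /b_state -addnA leq_mul2l ltnS h2 orbT.
Qed.

Definition b_table := ((b_state + 60) * Q.+1)%N.

Lemma try_table_small (j : job) (T : seq state) b :
  small_job Q j -> (forall s : state, s \in T -> small_state Q s) ->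
  small_best Q' b -> small_best Q' (foldl (try_state D B j) b T).
Proof.
move=> hj; elim: T b => //= s l IH b hl hb; apply: IH.
  by move=> z zl; apply: hl; rewrite inE zl orbT.
have hs : small_state Q s by apply: hl; exact: mem_head.
by apply: try_state_small => //; case: hs.
Qed.

Lemma ev_try_table (j : job) (T : seq state) b :
  small_job Q j -> (forall s : state, s \in T -> small_state Q s) ->
  (size T <= Q)%N -> small_best Q' b ->
  ev [:: Node (Node (Node (Atom D) (Atom B)) (enc_job j))
              (Node (enc_best b) (enc_seq enc_state T))]
     (fn f_state) (enc_best (foldl (try_state D B j) b T)) b_table.
Proof.
move=> hj hT h2 hb; apply: ev_le.
  apply: (ev_fold (f:=f_state) (g:=g_state) (b:=b_state + 30) (encT:=enc_state)) => //.
  move=> s1 s s2 lE; rewrite -[fn _]/s_state /s_state; apply: ev_le.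
    evs; apply: ev_try_state => //.
      by apply: hT; rewrite lE mem_cat mem_head orbT.
    by apply: try_table_small => // z zs; apply: hT; rewrite lE mem_cat zs.
  by clear; lia.
by rewrite /b_table -addnA leq_mul2l ltnS h2 orbT.
Qed.

End Candidates.

Section Output.
Variable Q : nat.

Lemma ev_put_item i (o : out) (x : item) : small Q i -> small Q x.1.1 ->
  ev [:: Node (Atom i) (Node (enc_out o) (enc_item x))] (fn g_item)
     (enc_out (put_item i o x)) (10 * Q + 100).
Proof.
move=> hi hx; rewrite -[fn _]/s_item /s_item; cbv zeta; apply: ev_le.
  rewrite /put_item; eapply ev_if; first by evs.
    by cbn [binop_sem] => h; rewrite (ifT _ _ h); evs.
  by cbn [binop_sem] => /eqP /negbF h; rewrite (ifF _ _ h) /enc_out; evs.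
by move: hi hx; rewrite /small; int_size_lia.
Qed.

Lemma ev_output (items : seq item) (ents : seq entry) :
  (forall x : item, x \in items -> small Q x.1.1) ->
  (forall x : entry, x \in ents -> small Q x.1.1) ->
  ev [:: Node (enc_seq enc_item items) (enc_seq enc_entry ents)] (fn f_out)
     (enc_out (output items ents))
     (((10 * Q + 130) * (size items).+1 + 60) * (size ents).+1).
Proof.
move=> hi he; apply: ev_le.
  apply: (ev_foldr (f:=f_out) (g:=g_out) (encA:=enc_out) (encT:=enc_entry) (d:=10)
    (b:=(10 * Q + 130) * (size items).+1 + 30)) => //.
    by move=> e; apply: ev_le; first by rewrite /enc_out; evs.
  move=> s1 x s2 lE; rewrite -[fn _]/s_out /s_out; apply: ev_le.
    evs; apply: (ev_fold (f:=f_item) (g:=g_item) (encA:=enc_out) (encT:=enc_item)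
      (b:=10 * Q + 100) (h:=put_item x.1.1)) => //.
    move=> s3 y s4 lE'; apply: ev_put_item.
      by apply: he; rewrite lE mem_cat mem_head orbT.
    by apply: hi; rewrite lE' mem_cat mem_head orbT.
  by rewrite -addnA; move: (_ * _.+1)%N => z; clear; lia.
by move: (_ * (size items).+1)%N (size ents) => z n; clear; nia.
Qed.

Lemma ev_ids (J : seq job) :
  ev [:: Node (Atom 0) (enc_seq enc_job J)] (fn f_ids)
     (enc_seq Atom [seq j.1 | j <- J]) (100 * (size J).+1).
Proof.
rewrite -[map _ _]/(foldr (fun j r => j.1 :: r) [::] J).
apply: ev_le.
  apply: (ev_foldr (f:=f_ids) (g:=g_ids) (base:=0%Z) (encA:=enc_seq Atom) (encT:=enc_job) (d:=1) (b:=30)) => //.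
    by move=> e; evs.
  move=> s1 x s2 lE; rewrite -[fn _]/s_ids /s_ids; move: (foldr _ _ _) => r; apply: ev_le; first by evs.
  by [].
by move: (size J); clear; lia.
Qed.

End Output.

(** * Evaluation of the search for the best candidate *)

Section Main.
Variables (N D B : int) (J : seq job) (ents : seq entry) (Q : nat).
Local Notation reach := (reach N D (init_state ents)).

Hypothesis N_gt0 : 0 < N.
Hypothesis N_small : small Q N.
Hypothesis D_small : small Q D.
Hypothesis B_small : small Q B.
Hypothesis J_small : forall j : job, j \in J -> small_job Q j.
Hypothesis J_size : (size J <= Q)%N.
Hypothesis reach_small : forall js s, subjobs J js -> reach js s -> small_state Q s.
Hypothesis table_small : forall js (T : seq state), subjobs J js ->
  table N D (init_state ents) js T -> (size T <= Q)%N.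

Lemma no_job_small : small_job Q no_job.
Proof. by have h : (1 <= Q)%N by apply: leq_trans N_small; split; rewrite /small /= ?int_size_lit. Qed.

Lemma split_jobs_small (j : job) : j \in no_job :: J -> small_job Q j.
Proof. by rewrite inE => /predU1P[->|/J_small//]; exact: no_job_small. Qed.

Lemma dp_small id (s : state) : s \in dp N D id [:: init_state ents] J -> small_state Q s.
Proof.
have [_ h] := dp_table N D (init_state ents) id J.
by move=> /h; apply: reach_small; apply: (@subjobs_kept _ _ _ [::]); rewrite cats0.
Qed.

Lemma try_split_small b l : {subset l <= no_job :: J} -> small_best (40 * Q + 40) b ->
  small_best (40 * Q + 40) (foldl (try_split N D B J ents) b l).
Proof.
elim: l b => //= j l IH b hl hb; apply: IH => [k kl|].
  by apply: hl; rewrite inE kl orbT.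
apply: try_table_small => //; last by move=> s; exact: dp_small.
by apply: split_jobs_small; apply: hl; exact: mem_head.
Qed.

Definition b_split := ((b_table Q + b_dp Q + 100) * Q.+2)%N.

Lemma ev_best :
  ev [:: Node (Node (Node (Atom N) (Atom D))
                 (Node (Atom B) (Node (enc_seq enc_job J) (enc_state (init_state ents)))))
              (Node (Atom 0) (enc_seq enc_job (no_job :: J)))] (fn f_split)
     (enc_best (best_candidate N D B J ents)) b_split.
Proof.
apply: ev_le.
  apply: (ev_fold (f:=f_split) (g:=g_split) (encA:=enc_best) (encT:=enc_job)
    (b:=b_table Q + b_dp Q + 60) (a:=None)) => //.
  move=> s1 j s2 lE.
  have hs1 : {subset s1 <= no_job :: J} by move=> k ks; rewrite lE mem_cat ks.
  have hj : small_job Q j by apply: split_jobs_small; rewrite lE mem_cat mem_head orbT.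
  have [hj1 _ _] := hj.
  have hT := dp_table N D (init_state ents) j.1 J.
  rewrite -[fn _]/s_split /s_split; cbv zeta; apply: ev_le.
    evs.
      exact: (ev_dp N_gt0 N_small D_small J_small reach_small table_small hj1 J_size).
    apply: (ev_try_table D_small B_small hj) => [s|/=|].
    - exact: dp_small.
    - by apply: table_small hT; apply: (@subjobs_kept _ _ _ [::]); rewrite cats0.
    - exact: try_split_small.
  by move: (b_table Q) (b_dp Q); clear; lia.
rewrite /b_split leq_mul //; first by rewrite -addnA leq_add2l.
Qed.

End Main.

Lemma size_enc_seq (T : Type) (enc : T -> sexp) l : (size l < sexp_size (enc_seq enc l))%N.
Proof. by elim: l => //= x l IH; lia. Qed.

Lemma enc_rates_small Q (l : seq ((int * int) * (int * int))) x :
  (sexp_size (enc_seq enc_rates l) <= Q)%N -> x \in l -> small_rates Q x.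
Proof.
elim: l => //= y l IH h; rewrite inE => /predU1P[->|xl]; last by apply: IH xl; lia.
by rewrite /small_rates /small; split; lia.
Qed.

Lemma index_fromP (T : eqType) k (l : seq T) (x : int * T) : x \in index_from k l -> x.2 \in l.
Proof.
elim: l k => //= y l IH k; rewrite !inE => /predU1P[->|/IH ->]; first by rewrite eqxx.
by rewrite orbT.
Qed.

Lemma size_index_from (T : Type) k (l : seq T) : size (index_from k l) = size l.
Proof. by elim: l k => //= y l IH k; rewrite IH. Qed.

(** * Evaluation of the whole program on an encoded input *)

Section Program.
Variables (vw sp : seq ((int * int) * (int * int))) (bn bd en ed : int).

Definition enc_raw : sexp :=
  Node (Node (enc_seq enc_rates vw) (Node (enc_seq enc_rates sp) (Node (Atom bn) (Atom bd))))
       (Node (Atom en) (Atom ed)).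

Definition scale : int := atom_product enc_raw.
(** The quotient is the integer part of [1 / eps], so that the second factor exceeds [1 + 1 / eps]
    while staying linear in it. *)
Definition precision : int := ((size vw)%:Z + 1) * (2 + (ed %/ en)%Z).
Definition scaled_budget : int := (scale * scale * scale * bn %/ bd)%Z.
Definition scaled_jobs : seq job := isort [seq mk_job scale x | x <- index_from 0 vw].
Definition scaled_entries : seq entry := [seq mk_entry scale x | x <- index_from 0 sp].
Definition best : option candidate :=
  best_candidate precision scale scaled_budget scaled_jobs scaled_entries.
Definition result : sexp :=
  if best is Some c then enc_out (output c.2 scaled_entries)
  else Node (enc_seq Atom [seq j.1 | j <- scaled_jobs]) (Atom 0).

Lemma size_scaled_jobs : size scaled_jobs = size vw.
Proof. by rewrite size_isort size_map size_index_from. Qed.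

Variable Q : nat.
Hypothesis raw_size : (sexp_size enc_raw <= Q)%N.
Hypothesis precision_gt0 : 0 < precision.
Hypothesis precision_small : small Q precision.
Hypothesis budget_small : small Q scaled_budget.
Hypothesis jobs_small : forall j : job, j \in scaled_jobs -> small_job Q j.
Hypothesis entries_small : forall x : entry, x \in scaled_entries -> small Q x.1.1.
Hypothesis reach_small : forall js s, subjobs scaled_jobs js ->
  reach precision scale (init_state scaled_entries) js s -> small_state Q s.
Hypothesis table_small : forall js (T : seq state), subjobs scaled_jobs js ->
  table precision scale (init_state scaled_entries) js T -> (size T <= Q)%N.
Hypothesis best_small : forall c, best = Some c ->
  (size c.2 <= Q)%N /\ forall x : item, x \in c.2 -> small Q x.1.1.

Definition b_main := (1000 * Q * Q * Q + b_split Q + 4000 * Q * Q + 4000)%N.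

Lemma ev_main : ev [:: enc_raw] (fn 0) result b_main.
Proof.
have D_small : small Q scale by apply: leq_trans (int_size_atom_product _) raw_size.
have hvw : (size vw < Q)%N.
  by have := size_enc_seq enc_rates vw; move: raw_size; rewrite /enc_raw /=; lia.
have hsp : (size sp < Q)%N.
  by have := size_enc_seq enc_rates sp; move: raw_size; rewrite /enc_raw /=; lia.
have vw_small x : x \in vw -> small_rates Q x.
  by apply: (enc_rates_small (Q:=Q)); move: raw_size; rewrite /enc_raw /=; lia.
have sp_small x : x \in sp -> small_rates Q x.
  by apply: (enc_rates_small (Q:=Q)); move: raw_size; rewrite /enc_raw /=; lia.
have en_small : small Q en by move: raw_size; rewrite /enc_raw /small /=; lia.
have ed_small : small Q ed by move: raw_size; rewrite /enc_raw /small /=; lia.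
have bn_small : small Q bn by move: raw_size; rewrite /enc_raw /small /=; lia.
have bd_small : small Q bd by move: raw_size; rewrite /enc_raw /small /=; lia.
have jobs_small' (x : job) : x \in [seq mk_job scale x | x <- index_from 0 vw] -> small_job Q x.
  by rewrite -mem_isort; exact: jobs_small.
rewrite -[fn _]/t_main /t_main; apply: ev_le.
  eapply ev_let; first by evs; exact: ev_prod.
  eapply (@ev_let _ _ _ _ (Atom precision)).
    eapply (ev_op OMul); last by evs.
    eapply (ev_op OAdd); last by evs.
    by evs; exact: (ev_len enc_rates).
  eapply (@ev_let _ _ _ _ (enc_seq enc_entry scaled_entries)).
    evs; first by apply: (ev_idx enc_rates (Q:=Q.+1)); rewrite int_size_lit add1n ltnS ltnW.
    apply: (ev_ents (Q:=Q)) => // s1 x s2 lE; apply: sp_small.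
    by apply: (@index_fromP _ 0); rewrite lE mem_cat mem_head orbT.
  eapply (@ev_let _ _ _ _ (enc_seq enc_job scaled_jobs)).
    evs.
      - by apply: (ev_idx enc_rates (Q:=Q.+1)); rewrite int_size_lit add1n ltnS ltnW.
      - apply: (ev_jobs (Q:=Q)) => // s1 x s2 lE; apply: vw_small.
        by apply: (@index_fromP _ 0); rewrite lE mem_cat mem_head orbT.
      - exact: (ev_sort (Q:=Q)).
  eapply (@ev_let _ _ _ _ (enc_best best)).
    evs; apply: (ev_best precision_gt0 precision_small D_small budget_small jobs_small _ reach_small table_small).
    by rewrite size_scaled_jobs ltnW.
  rewrite /result; instantiate (1 := (((10 * Q + 130) * Q.+1 + 60) * Q.+1 + 200 * Q.+1 + 100)%N).
  case: best best_small => [c /(_ _ erefl) [hc1 hc2]|_].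
    apply: ev_le.
      eapply ev_if_node; first by evs.
      by evs; exact: (ev_output (Q:=Q)).
    rewrite size_map size_index_from.
    move: hc1 hsp; move: (size c.2) (size sp) => a b; clear; nia.
  apply: ev_le.
    eapply ev_if_atom; first by evs.
    by evs; exact: ev_ids.
  by rewrite size_scaled_jobs; move: (size vw) hvw => n; clear; nia.
rewrite !size_map !size_index_from -mulnn.
have size_vw_small : (int_size (size vw)%:Z <= Q)%N.
  have /leq_trans : (int_size (size vw)%:Z <= (size vw).+1)%N.
    by apply: int_size_le; apply: leq_trans (ltn_expl _ _).
  exact.
move: D_small en_small ed_small bn_small bd_small size_vw_small raw_size.
rewrite /small /b_main.
move: (b_split _) (sexp_size _) => u z.
move: (size vw) (size sp) hvw hsp => n m hn hm.
rewrite -/scale => h1 h2 h3 h4 h5 h6 h7.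
have b1 : ((n + 20) * n.+1 <= (Q + 20) * Q)%N by rewrite leq_mul // leq_add2r ltnW.
have b2 : ((Q.+1 + 30) * n.+1 <= (Q.+1 + 30) * Q)%N by rewrite leq_mul.
have b3 : ((Q.+1 + 30) * m.+1 <= (Q.+1 + 30) * Q)%N by rewrite leq_mul.
have b4 : ((20 * Q + 130) * m <= (20 * Q + 130) * Q)%N by rewrite leq_mul // ltnW.
have b5 : ((10 * Q + 100) * n <= (10 * Q + 100) * Q)%N by rewrite leq_mul // ltnW.
have b6 : ((10 * Q + 130) * n.+1 * n.+1 <= (10 * Q + 130) * Q * Q)%N.
  by rewrite leq_mul // leq_mul.
have b7 : (z * z <= Q * Q)%N by rewrite leq_mul.
have b8 : (Q <= Q * Q)%N by rewrite leq_pmulr // (leq_ltn_trans _ hn).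
move: h1 h2 h3 h4 h5 h6 b1 b2 b3 b4 b5 b6 b7 b8.
move: ((n + 20) * n.+1)%N ((_ + 30) * n.+1)%N (_ * m.+1)%N (_ * m)%N ((_ + 100) * n)%N
  (_ * n.+1 * n.+1)%N (z * z)%N => y1 y2 y3 y4 y5 y6 y7.
int_size_sum.
Qed.

End Program.

(** * Size of the table *)

(** Doubling [d] requires [2 * N * d <= x], which is [N * d' <= x] for the new [d' = 2 * d]. The
    final exponent therefore satisfies [N * 2 ^ k <= x < 2 * N * 2 ^ k] unless [k = 0]: the lower
    end controls the relative error, the upper end the number of significant bits. *)
Lemma round_loopP f (N x : int) j : 0 <= x -> 0 < N -> x < 2 ^+ j * 2 ^+ f ->
  (j = 0%N \/ N * 2 ^+ j <= x) ->
  exists k, [/\ (k <= j + f)%N, round_loop f N x (2 ^+ j) = (x %/ 2 ^+ k)%Z * 2 ^+ k,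
                x < (N + N) * 2 ^+ k & k = 0%N \/ N * 2 ^+ k <= x].
Proof.
move=> x0 N0; elim: f j => [|f IH] j hx hj.
  exists j; split=> //; first by rewrite addn0.
  have : 0 < 2 ^+ j :> int by exact: exprn_gt0.
  by move: hx; rewrite expr0 mulr1; set d := 2 ^+ j => *; nia.
rewrite /=; case: ifPn => [h|]; last first.
  by rewrite -ltNge => h; exists j; split=> //; rewrite leq_addr.
have E : 2 ^+ j + 2 ^+ j = 2 ^+ j.+1 :> int by rewrite exprS; ring.
have [||k [h1 h2 h3 h4]] := IH j.+1.
- by rewrite exprS -mulrA mulrCA -exprS.
- by right; rewrite -E mulrDr -mulrDl.
by exists k; rewrite E; split=> //; rewrite addnS -addSn.
Qed.

Lemma roundP (N x : int) : 0 <= x -> 0 < N ->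
  exists k, [/\ (k <= int_size x)%N, round N x = (x %/ 2 ^+ k)%Z * 2 ^+ k,
                x < (N + N) * 2 ^+ k & k = 0%N \/ N * 2 ^+ k <= x].
Proof.
move=> x0 N0; have [||k] := @round_loopP (int_size x) N x 0 x0 N0; [|by left|by exists k].
rewrite expr0 mul1r; have := ltn_int_size x; rewrite -(ltr_nat int) natrX.
by apply: le_lt_trans; lia.
Qed.

Lemma round_ge0 (N x : int) : 0 <= x -> 0 < N -> 0 <= round N x.
Proof.
move=> x0 N0; have [k [_ -> _ _]] := roundP x0 N0.
have d0 : 0 < 2 ^+ k :> int by exact: exprn_gt0.
by apply: mulr_ge0; [rewrite divz_ge0|apply: ltW].
Qed.

Lemma round_le (N x : int) : 0 <= x -> 0 < N -> round N x <= x.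
Proof.
move=> x0 N0; have [k [_ -> _ _]] := roundP x0 N0.
have d0 : 0 < 2 ^+ k :> int by exact: exprn_gt0.
exact: lez_floor (lt0r_neq0 d0).
Qed.

(** The error is a remainder below [2 ^ k], and [N * 2 ^ k <= x] unless [k = 0], where nothing is
    lost. *)
Lemma round_error (N x : int) : 0 <= x -> 0 < N -> N * (x - round N x) <= x.
Proof.
move=> x0 N0; have [k [_ -> _ h]] := roundP x0 N0.
have d0 : 0 < 2 ^+ k :> int by exact: exprn_gt0.
have := divz_eq x (2 ^+ k); have := ltz_pmod x d0.
case: h => [->|h]; first by rewrite expr0 divz1 mulr1 subrr mulr0.
set q := (x %/ _)%Z; set r := (x %% _)%Z => h1 h2.
have -> : x - q * 2 ^+ k = r by rewrite {1}h2; ring.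
by apply: le_trans h; rewrite ler_pM2l// ltW.
Qed.

Lemma int_size_round (N x : int) : 0 <= x -> 0 < N -> (int_size (round N x) <= int_size x)%N.
Proof.
by move=> x0 N0; apply: leq_int_size; have := round_le x0 N0; have := round_ge0 x0 N0; lia.
Qed.

(** Contains the rounded values of all nonnegative integers with at most [S] bits, possibly with
    repetitions; its length is polynomial in [N] and [S]. *)
Definition grid (N : int) (S : nat) : seq int :=
  [seq m%:Z * 2 ^+ k | m <- iota 0 (absz (N + N)), k <- iota 0 S.+1].

Lemma size_grid N S : size (grid N S) = (absz (N + N)%R * S.+1)%N.
Proof. by rewrite size_allpairs !size_iota. Qed.

Lemma mem_grid0 (N : int) S : 0 < N -> 0 \in grid N S.
Proof.
move=> N0; apply/allpairsP; exists (0%N, 0%N); split; rewrite ?mem_iota ?mul0r //=.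
by lia.
Qed.

Lemma mem_grid_round (N : int) S (x : int) : 0 <= x -> 0 < N -> (int_size x <= S)%N -> round N x \in grid N S.
Proof.
move=> x0 N0 hx; have [k [h1 -> h2 _]] := roundP x0 N0.
have d0 : 0 < 2 ^+ k :> int by exact: exprn_gt0.
have q0 : 0 <= (x %/ 2 ^+ k)%Z by rewrite divz_ge0.
apply/allpairsP; exists (`|(x %/ 2 ^+ k)%Z|%N, k); split=> /=.
- rewrite mem_iota /= add0n -ltz_nat !gez0_abs //; last by lia.
  by rewrite ltz_divLR.
- by rewrite -[_ :: _]/(iota 0 S.+1) mem_iota /= add0n ltnS (leq_trans h1).
- by rewrite gez0_abs.
Qed.

Fixpoint words (T : Type) (m : nat) (g : seq T) : seq (seq T) :=
  if m is m'.+1 then [seq x :: w | x <- g, w <- words m' g] else [:: [::]].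

Lemma size_words (T : Type) m (g : seq T) : size (words m g) = (size g ^ m)%N.
Proof. by elim: m => //= m IH; rewrite size_allpairs IH expnS. Qed.

Lemma mem_words (T : eqType) (g : seq T) (w : seq T) : {subset w <= g} -> w \in words (size w) g.
Proof.
elim: w => //= x w IH hw; apply/allpairsP; exists (x, w); split=> //=.
  by apply: hw; exact: mem_head.
by apply: IH => y yw; apply: hw; rewrite inE yw orbT.
Qed.

Definition small_segment Q (s : segment) :=
  [/\ small Q s.1.1, small Q s.1.2, small Q s.2.1 & small Q s.2.2].
Definition small_item Q (x : item) :=
  [/\ small Q x.1.1, small_job Q x.1.2, small_segment Q x.2.1 & small_segment Q x.2.2].

Section Bits.
Variables (N D : int) (ents : seq entry) (J : seq job) (P n : nat).
Hypothesis N_gt0 : 0 < N.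
Hypothesis D_small : small P D.
Hypothesis ents_small : forall x : entry, x \in ents ->
  small_entry P x /\ [/\ 0 <= x.1.2.1, x.2.1 = 0 & x.2.2 = 0].
Hypothesis J_small : forall j : job, j \in J ->
  [/\ small_job P j, 0 <= j.2.1 & 0 <= j.2.2].
Hypothesis J_size : (size J <= n)%N.

Local Notation reach := (reach N D (init_state ents)).
Let S := (5 * P + 4 * n + 20)%N.

Definition entry_inv k (x : entry) :=
  [/\ 0 <= x.2.1, 0 <= x.2.2, small (2 * P + 1 + k) x.2.1, small (P + 1 + k) x.2.2 &
      x.2.1 \in grid N S /\ x.2.2 \in grid N S].

(** Each insertion adds at most one bit to the sums and to the energy, and two bits to the cost,
    which takes two additions. Rounding down adds none, so that bit lengths grow only linearly with
    the number of jobs. *)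
Record state_inv (k : nat) (s : state) : Prop := StateInv {
  inv_class : [seq x.1 | x <- s.1.1] = [seq x.1 | x <- ents];
  inv_entry : forall x, x \in s.1.1 -> entry_inv k x;
  inv_cost_ge0 : 0 <= s.1.2;
  inv_cost : small (3 * P + n + 3 + 2 * k) s.1.2;
  inv_grid : s.1.2 \in grid N S;
  inv_energy : small (2 * P + 1 + k) s.2.1;
  inv_size : size s.2.2 = k;
  inv_items : forall x, x \in s.2.2 -> small_item (3 * P + 3) x }.

Lemma class_mem (s : state) x : [seq x.1 | x <- s.1.1] = [seq x.1 | x : entry <- ents] ->
  x \in s.1.1 -> exists2 y, y \in ents & x.1 = y.1.
Proof.
move=> E xs; have : x.1 \in [seq x.1 | x <- s.1.1] by apply: map_f.
by rewrite E => /mapP[y yents ->]; exists y.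
Qed.

Lemma P_gt0 : (0 < P)%N. Proof. exact: leq_trans D_small. Qed.

Lemma update_inv k i tau w (x : entry) : (k < n)%N -> 0 <= tau -> small (2 * P) tau ->
  0 <= w -> small P w -> entry_inv k x -> entry_inv k.+1 (update N i tau w x).
Proof.
move=> kn tau0 htau w0 hw [h1 h2 h3 h4 _]; have P0 := P_gt0.
have a0 : 0 <= x.2.1 + leqz i x.1.1 * tau.
  by rewrite addr_ge0// mulr_ge0// /leqz; case: ifP.
have u0 : 0 <= x.2.2 + leqz (x.1.1 + 1) i * w.
  by rewrite addr_ge0// mulr_ge0// /leqz; case: ifP.
have hsa : (int_size (x.2.1 + leqz i x.1.1 * tau) <= 2 * P + 1 + k.+1)%N.
  by move: htau h3; rewrite /small; int_size_lia.
have hsu : (int_size (x.2.2 + leqz (x.1.1 + 1) i * w) <= P + 1 + k.+1)%N.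
  by move: hw h4; rewrite /small; int_size_lia.
have S1 : (2 * P + 1 + k.+1 <= S)%N by rewrite /S; lia.
have S2 : (P + 1 + k.+1 <= S)%N by rewrite /S; lia.
split; rewrite /update /=.
- exact: round_ge0.
- exact: round_ge0.
- exact: leq_trans (int_size_round a0 N_gt0) hsa.
- exact: leq_trans (int_size_round u0 N_gt0) hsu.
- by split; apply: mem_grid_round => //; [exact: leq_trans hsa S1|exact: leq_trans hsu S2].
Qed.

Lemma reach_inv js s : subjobs J js -> reach js s -> state_inv (size js) s.
Proof.
move=> hjs hs; elim: hs hjs => {js s} [|js j s x hs IH xs] [hsz hsub].
  split=> //=.
  - move=> x xe; have [_ [_ e1 e2]] := ents_small xe.
    by rewrite /entry_inv e1 e2; split; rewrite /small ?int_size_lit //; [lia|lia|split; exact: mem_grid0].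
  - by rewrite /small int_size_lit; lia.
  - exact: mem_grid0.
  - by rewrite /small int_size_lit; lia.
have {}IH : state_inv (size js) s.
  apply: IH; split; first exact: ltnW.
  by move=> i ijs; apply: hsub; rewrite inE ijs orbT.
have kn : (size js < n)%N by apply: leq_trans J_size.
have jJ : j \in J by apply: hsub; exact: mem_head.
have [[hj1 hj2 hj3] v0 w0] := J_small jJ.
have [y ye xy] := class_mem (inv_class IH) xs.
have [[hy1 hy2 hy3 [hy4 hy5 _ _]] [r0 _ _]] := ents_small ye.
rewrite -xy in hy1 hy2 hy3 hy4 hy5 r0.
have [a0 u0 ha hu _] := inv_entry IH xs.
have tau0 : 0 <= x.1.2.1 * j.2.1 by exact: mulr_ge0.
have htau : small (2 * P) (x.1.2.1 * j.2.1).
  by move: hy2 hj2; rewrite /small; int_size_lia.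
have k0 : 0 <= s.1.2 + j.2.2 * (x.2.1 + x.1.2.1 * j.2.1) + x.1.2.1 * j.2.1 * x.2.2.
  by rewrite addr_ge0 ?mulr_ge0 ?addr_ge0 ?(inv_cost_ge0 IH) ?mulr_ge0 ?addr_ge0.
have hk : (int_size (s.1.2 + j.2.2 * (x.2.1 + x.1.2.1 * j.2.1) + x.1.2.1 * j.2.1 * x.2.2)
           <= 3 * P + n + 3 + 2 * (size js).+1)%N.
  move: (inv_cost IH) htau hj3 ha hu kn; rewrite /small.
  move: (size js) => k; move: (x.1.2.1 * j.2.1) => tau; int_size_lia.
have hS : (3 * P + n + 3 + 2 * (size js).+1 <= S)%N.
  by rewrite /S; move: kn; clear; lia.
have P3 : (P <= 3 * P + 3)%N by rewrite (leq_trans _ (leq_addr _ _)) // leq_pmull.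
have sz0 : small (3 * P + 3) 0 by rewrite /small int_size_lit; rewrite addnS.
split.
- rewrite -(inv_class IH) /extend /= -map_comp; exact: eq_map.
- move=> z /mapP[t ts ->]; apply: update_inv => //.
  exact: inv_entry IH _ ts.
- exact: round_ge0.
- exact: leq_trans (int_size_round k0 N_gt0) hk.
- exact: mem_grid_round (leq_trans hk hS).
- move: (inv_energy IH) hy3 hj2; rewrite /extend /class_energy /small /=; move: (size js) => k.
  int_size_lia.
- by rewrite /= (inv_size IH).
- move=> z; rewrite inE => /predU1P[->|/(inv_items IH)//].
  rewrite /mk_item /mk_segment /class_index /class_speed; split=> /=.
  + exact: leq_trans P3.
  + by split; exact: leq_trans P3.
  + split=> /=; try by exact: leq_trans P3.
      by move: hj2 hy5; rewrite /small; int_size_lia.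
    by move: D_small hy4; rewrite /small; int_size_lia.
  + split=> /=; try by exact: leq_trans P3.
      by rewrite mul0r.
    by move: D_small hy4; rewrite /small; int_size_lia.
Qed.

Definition key_word (k : seq entry * int) : seq int :=
  k.2 :: flatten [seq [:: x.2.1; x.2.2] | x <- k.1].

(** The dynamic program never changes the classes of the entries, so that only the numbers
    distinguish two keys. *)
Lemma key_word_inj (k l : seq entry * int) :
  [seq x.1 | x <- k.1] = [seq x.1 | x <- l.1] -> key_word k = key_word l -> k = l.
Proof.
case: k l => [k a] [l b] /= E [-> ] E'; congr pair.
elim: k l E E' => [|[x [y z]] k IH] [|[x' [y' z']] l] //= [-> E] [-> -> E'].
by rewrite (IH l).
Qed.

Lemma size_key_word (k : seq entry * int) : size (key_word k) = (2 * size k.1).+1.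
Proof. by rewrite /=; congr _.+1; elim: k.1 => //= x l IH; rewrite IH; lia. Qed.

(** The keys are distinct words of length [2 * kappa + 1] over the grid. This is the place where the
    number of speeds enters the exponent. *)
Lemma table_size js (T : seq state) : subjobs J js -> table N D (init_state ents) js T ->
  (size T <= (absz (N + N)%R * S.+1) ^ (2 * size ents).+1)%N.
Proof.
move=> hjs [hu hr].
rewrite -size_grid -size_words -(size_map (fun t : state => t.1) T).
have hr' k : k \in [seq t.1 | t : state <- T] ->
    [seq x.1 | x <- k.1] = [seq x.1 | x <- ents] /\ {subset key_word k <= grid N S}.
  move=> /mapP[t /hr /(reach_inv hjs) ht ->]; split; first exact: inv_class ht.
  move=> z; rewrite inE => /predU1P[->|]; first exact: inv_grid ht.
  move=> /flattenP[w /mapP[x xt ->]]; have [_ _ _ _ [ga gu]] := inv_entry ht xt.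
  by rewrite !inE => /orP[] /eqP ->.
rewrite -(size_map key_word); apply: uniq_leq_size.
  rewrite map_inj_in_uniq // => k l /hr'[hk _] /hr'[hl _].
  by apply: key_word_inj; rewrite hk hl.
move=> w /mapP[k /hr'[hk hw] ->].
have <- : size (key_word k) = (2 * size ents).+1.
  by rewrite size_key_word -(size_map fst k.1) hk size_map.
exact: mem_words.
Qed.

End Bits.

(** * Minimality of the best candidate *)

(** The part of [try_pair] that does not involve the best candidate so far. It turns the nested
    searches into one fold of [better] over an explicit list. *)
Definition pair_candidate (D B : int) (j : job) (s : state) (x y : entry) : option candidate :=
  let B' := B - s.2.1 in
  let ea := class_energy x.1 in let eb := class_energy y.1 in
  let v := j.2.1 in
  if ea * v <= B' then Some (mk_candidate D j s x y 1 v 0) else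
  if ea <= eb then None else
  if eb * v <= B'
  then Some (mk_candidate D j s x y (ea - eb) (B' - eb * v) (ea * v - B')) else None.

Definition state_candidates D B j (s : state) : seq candidate :=
  flatten [seq pmap (pair_candidate D B j s x) s.1.1 | x <- s.1.1].
Definition table_candidates D B j (T : seq state) : seq candidate :=
  flatten [seq state_candidates D B j s | s <- T].
Definition all_candidates N D B (J : seq job) (ents : seq entry) : seq candidate :=
  flatten [seq table_candidates D B j (dp N D j.1 [:: init_state ents] J) | j <- no_job :: J].

Lemma foldl_flatten (A T U : Type) (f : A -> T -> A) (g : A -> U -> A) (h : T -> seq U) l b :
  (forall a x, f a x = foldl g a (h x)) -> foldl f b l = foldl g b (flatten [seq h x | x <- l]).
Proof. by move=> fE; elim: l b => //= x l IH b; rewrite IH foldl_cat fE. Qed.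

Lemma best_candidateE N D B J ents :
  best_candidate N D B J ents = foldl better None (all_candidates N D B J ents).
Proof.
apply: foldl_flatten => b j; apply: foldl_flatten => {}b s.
apply: foldl_flatten => {}b x; rewrite /try_entry.
elim: (s.1.1) b => //= y l IH b; rewrite IH /try_pair /pair_candidate.
by case: ifP => // _; case: ifP => // _; case: ifP.
Qed.

Lemma all_candidatesP N D B J ents c :
  reflect (exists j s x y, [/\ j \in no_job :: J, s \in dp N D j.1 [:: init_state ents] J,
     x \in s.1.1, y \in s.1.1 & pair_candidate D B j s x y = Some c])
  (c \in all_candidates N D B J ents).
Proof.
apply: (iffP flattenP) => [[l1 /mapP[j hj ->] /flattenP[l2 /mapP[s hs ->]]]|].
  move=> /flattenP[l3 /mapP[x hx ->]]; rewrite mem_pmap => /mapP[y hy E].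
  by exists j, s, x, y; split.
move=> [j [s [x [y [hj hs hx hy E]]]]].
exists (table_candidates D B j (dp N D j.1 [:: init_state ents] J)).
  by apply/mapP; exists j.
apply/flattenP; exists (state_candidates D B j s); first by apply/mapP; exists s.
apply/flattenP; exists (pmap (pair_candidate D B j s x) s.1.1); first by apply/mapP; exists x.
by rewrite mem_pmap -E map_f.
Qed.

Lemma pair_candidate_den_gt0 D B j s x y c :
  pair_candidate D B j s x y = Some c -> 0 < c.1.2.
Proof.
rewrite /pair_candidate; case: ifP => [_ [<-]//|_].
case: ifP => // /negbT; rewrite -ltNge => h; case: ifP => // _ [<-] /=.
by rewrite subr_gt0.
Qed.

Lemma foldl_better_mem b (l : seq candidate) c :
  foldl better b l = Some c -> b = Some c \/ c \in l.
Proof.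
elim: l b => [|c' l IH] b /=; first by left.
move=> /IH[|h]; last by right; rewrite inE h orbT.
case: b => [b|] /=; last by move=> [->]; right; exact: mem_head.
by case: ifP => _ [->]; [left|right; exact: mem_head].
Qed.

Definition le_candidate (c c' : candidate) := c.1.1 * c'.1.2 <= c'.1.1 * c.1.2.

Lemma le_candidate_trans c1 c2 c3 : 0 < c2.1.2 -> 0 <= c3.1.2 -> 0 <= c1.1.2 ->
  le_candidate c1 c2 -> le_candidate c2 c3 -> le_candidate c1 c3.
Proof.
rewrite /le_candidate => h1 h2 h3 h4 h5; rewrite -(ler_pM2r h1).
apply: (@le_trans _ _ (c2.1.1 * c1.1.2 * c3.1.2)).
  by have := ler_wpM2r h2 h4; congr (_ <= _); ring.
by have := ler_wpM2r h3 h5; congr (_ <= _); ring.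
Qed.

Lemma foldl_better_le (l : seq candidate) b :
  (forall c, c \in l -> 0 < c.1.2) -> (forall c, b = Some c -> 0 < c.1.2) ->
  forall c', b = Some c' \/ c' \in l ->
  exists2 c, foldl better b l = Some c & le_candidate c c'.
Proof.
elim: l b => [|c l IH] b hl hb c' /=.
  by case=> // ->; exists c' => //; rewrite /le_candidate.
have hl' d : d \in l -> 0 < d.1.2 by move=> dl; apply: hl; rewrite inE dl orbT.
have hc : 0 < c.1.2 by apply: hl; exact: mem_head.
have hbc d : better b c = Some d -> 0 < d.1.2.
  case: b hb => [b|] hb /=; last by move=> [<-].
  by case: ifP => _ [<-] //; exact: hb.
case: b hb hbc => [b|] hb hbc; last first.
  case=> //; rewrite inE => /predU1P[->|h]; last by apply: IH => //; right.
  by apply: IH => //; left.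
have hb0 := hb _ erefl; case=> [[<-]|].
  move: hbc => /=; case: ifP => [_|/negbT h] hbc; first by apply: IH => //; left.
  have [//||d h1 h2] := IH (Some c) hl' _ c; [by left|exists d => //].
  move: h; rewrite -ltNge => /ltW h.
  apply: le_candidate_trans h2 _ => //; [exact: ltW|].
  have [] := foldl_better_mem h1; last by move=> /hl' /ltW.
  by move=> [<-]; exact: ltW.
rewrite inE => /predU1P[->|h]; last by apply: IH => //; right.
move: hbc => /=; case: ifP => [h|_] hbc; last by apply: IH => //; left.
have [//||d h1 h2] := IH (Some b) hl' _ b; [by left|exists d => //].
apply: le_candidate_trans h2 h => //; [exact: ltW|].
have [] := foldl_better_mem h1; last by move=> /hl' /ltW.
by move=> [<-]; exact: ltW.
Qed.

Lemma best_candidate_min N D B J ents c' : c' \in all_candidates N D B J ents ->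
  exists2 c, best_candidate N D B J ents = Some c & le_candidate c c'.
Proof.
move=> h; rewrite best_candidateE; apply: foldl_better_le => //; last by right.
by move=> c /all_candidatesP[j [s [x [y [_ _ _ _ /pair_candidate_den_gt0]]]]].
Qed.

Lemma best_candidate_mem N D B J ents c :
  best_candidate N D B J ents = Some c -> c \in all_candidates N D B J ents.
Proof. by rewrite best_candidateE => /foldl_better_mem[]. Qed.

(** * Size of the output *)

Lemma small_itemW Q Q' x : (Q <= Q')%N -> small_item Q x -> small_item Q' x.
Proof.
have tr z : (Q <= Q')%N -> small Q z -> small Q' z by move=> ? /sub_small; apply.
move=> h [? [? ? ?] [? ? ? ?] [? ? ? ?]].
by split; [|split..]; exact: tr.
Qed.

Lemma sexp_size_output Q (items : seq item) (ents : seq entry) :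
  (forall x : item, x \in items -> small_item Q x) ->
  (sexp_size (enc_out (output items ents)) <= (10 * Q + 40) * size items * size ents + 5)%N.
Proof.
move=> hi; elim: ents => [|x ents IH].
  by rewrite /output /= int_size_lit; lia.
rewrite [output _ _]/= /put_class -/(output items ents).
suff H o l : {subset l <= items} ->
    (sexp_size (enc_out (foldl (put_item x.1.1) o l)) <=
       sexp_size (enc_out o) + (10 * Q + 40) * size l)%N.
  apply: leq_trans (H _ items _) _; first by [].
  move: IH => /=; move: (sexp_size _) (_ * size items)%N (size ents) => a b c; clear; nia.
elim: l o => [|y l IHl] o hl /=; first by rewrite muln0 addn0.
apply: leq_trans (IHl _ _) _; first by move=> z zl; apply: hl; rewrite inE zl orbT.
rewrite mulnS addnA leq_add2r.
have [h1 [h2 h3 h4] [h5 h6 h7 h8] [h9 h10 h11 h12]] := hi _ (hl _ (mem_head _ _)).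
rewrite /put_item; case: ifP => _; first exact: leq_addr.
move: h1 h2 h3 h4 h5 h6 h7 h8 h9 h10 h11 h12; rewrite /small /enc_out /=; clear; lia.
Qed.

Lemma sexp_size_ids Q (J : seq job) : (forall j : job, j \in J -> small_job Q j) ->
  (sexp_size (enc_seq Atom [seq j.1 | j <- J]) <= (Q + 2) * size J + 2)%N.
Proof.
elim: J => [|j J IH] hJ /=; first by rewrite int_size_lit; lia.
have [+ _ _] := hJ j (mem_head _ _); rewrite /small => h.
have {IH} : (sexp_size (enc_seq Atom [seq j.1 | j <- J]) <= (Q + 2) * size J + 2)%N.
  by apply: IH => k kJ; apply: hJ; rewrite inE kJ orbT.
by rewrite mulnS; move: h; clear; lia.
Qed.

(** * Polynomial bounds *)

(** With the base [y.+1], which is at least 1, powers increase with the exponent, and the bounds of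
    two functions can be brought to a common degree. *)
Definition poly_bounded (f : nat -> nat) :=
  exists c d, forall y, (f y <= c * y.+1 ^ d)%N.

Lemma poly_bounded_const k : poly_bounded (fun=> k).
Proof. by exists k, 0%N => y; rewrite expn0 muln1. Qed.

Lemma poly_bounded_id : poly_bounded id.
Proof. by exists 1%N, 1%N => y; rewrite expn1 mul1n leqnSn. Qed.

Lemma poly_boundedD f g : poly_bounded f -> poly_bounded g ->
  poly_bounded (fun y => f y + g y)%N.
Proof.
move=> [c [d h]] [c' [d' h']]; exists (c + c')%N, (d + d')%N => y.
apply: leq_trans (leq_add (h y) (h' y)) _.
rewrite mulnDl leq_add// leq_mul2l leq_pexp2l ?orbT ?leq_addr ?leq_addl //.
Qed.

Lemma poly_boundedM f g : poly_bounded f -> poly_bounded g ->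
  poly_bounded (fun y => f y * g y)%N.
Proof.
move=> [c [d h]] [c' [d' h']]; exists (c * c')%N, (d + d')%N => y.
by apply: leq_trans (leq_mul (h y) (h' y)) _; rewrite expnD mulnACA.
Qed.

Lemma poly_boundedX f k : poly_bounded f -> poly_bounded (fun y => f y ^ k)%N.
Proof.
move=> hf; elim: k => [|k IH].
  by have [c [d h]] := poly_bounded_const 1; exists c, d.
by have [c [d h]] := poly_boundedM hf IH; exists c, d => y; rewrite expnS.
Qed.

Lemma poly_boundedS f : poly_bounded f -> poly_bounded (fun y => (f y).+1).
Proof.
move=> hf; have [c [d h]] := poly_boundedD hf (poly_bounded_const 1).
by exists c, d => y; rewrite -addn1.
Qed.

Lemma poly_bounded_comp f g : poly_bounded f -> poly_bounded g ->
  poly_bounded (fun y => f (g y)).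
Proof.
move=> [c [d h]] hg.
have [c' [d' h']] := poly_boundedM (poly_bounded_const c) (poly_boundedX d (poly_boundedS hg)).
by exists c', d' => y; apply: leq_trans (h _) (h' y).
Qed.

Ltac poly_bounded :=
  repeat first [assumption
    | match goal with |- poly_bounded (fun y => ?k) => exact (poly_bounded_const k) end
    | lazymatch goal with
      | |- poly_bounded (fun y => y) => exact poly_bounded_id
      | |- poly_bounded (fun y => addn (@?f y) (@?g y)) => apply: (@poly_boundedD f g)
      | |- poly_bounded (fun y => muln (@?f y) (@?g y)) => apply: (@poly_boundedM f g)
      | |- poly_bounded (fun y => expn (@?f y) _) => apply: (@poly_boundedX f)
      | |- poly_bounded (fun y => (@?f y).+1) => apply: (@poly_boundedS f)
      | |- poly_bounded (fun y => ?f (@?g y)) => apply: (@poly_bounded_comp f g)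
      end].

Lemma poly_bounded_b_main : poly_bounded b_main.
Proof.
have h1 : poly_bounded b_round by rewrite /b_round; poly_bounded.
have h2 : poly_bounded b_update by rewrite /b_update; poly_bounded.
have h3 : poly_bounded b_key by rewrite /b_key; poly_bounded.
have h4 : poly_bounded (fun Q => b_put Q Q) by rewrite /b_put; poly_bounded.
have h5 : poly_bounded b_extend by rewrite /b_extend; poly_bounded.
have h6 : poly_bounded b_ext by rewrite /b_ext; poly_bounded.
have h7 : poly_bounded b_layer by rewrite /b_layer; poly_bounded.
have h8 : poly_bounded b_dp by rewrite /b_dp; poly_bounded.
have h9 : poly_bounded b_table by rewrite /b_table /b_state /b_entry /b_pair; poly_bounded.
have h10 : poly_bounded b_split by rewrite /b_split; poly_bounded.
by rewrite /b_main; poly_bounded.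
Qed.

Lemma index_from_bounds (T : eqType) k (l : seq T) (x : int * T) :
  x \in index_from k l -> k <= x.1 < k + (size l)%:Z.
Proof.
elim: l k => //= y l IH k; rewrite inE => /predU1P[->|/IH]; first by rewrite /=; lia.
by move=> /andP[h1 h2]; apply/andP; split; lia.
Qed.

Definition valid_job (x : (int * int) * (int * int)) :=
  [/\ 0 <= x.1.1, 0 < x.1.2, 0 <= x.2.1 & 0 < x.2.2].
Definition valid_speed (x : (int * int) * (int * int)) :=
  [/\ 0 < x.1.1, 0 < x.1.2, 0 <= x.2.1 & 0 < x.2.2].

(** The input integers and the scale have at most [Y] bits. The factor 4 comes from the budget and
    the energies per unit of volume, which are built from products of four such integers. *)
Definition int_bits (Y : nat) : nat := (4 * Y + 10)%N.
(** The bound of [table_size] for [N <= (Y + 1) * (Y + 2)] and at most [Y] jobs. *)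
Definition table_bound (kappa Y : nat) : nat :=
  ((2 * ((Y + 1) * (Y + 2)) * (5 * int_bits Y + 4 * Y + 21)) ^ (2 * kappa).+1)%N.
Definition size_bound (kappa Y : nat) : nat :=
  (table_bound kappa Y + 10 * int_bits Y + 10 * Y + (Y + 1) * (Y + 2) + 30)%N.

Section Time.
Variables (vw sp : seq ((int * int) * (int * int))) (bn bd en ed : int) (Y : nat).
Hypothesis jobs_valid : forall x, x \in vw -> valid_job x.
Hypothesis speeds_valid : forall x, x \in sp -> valid_speed x.
Hypotheses (en_gt0 : 0 < en) (ed_gt0 : 0 < ed).

Let raw := enc_raw vw sp bn bd en ed.
Let D := scale vw sp bn bd en ed.
Let N := precision vw en ed.
Let B := scaled_budget vw sp bn bd en ed.
Let J := scaled_jobs vw sp bn bd en ed.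
Let ents := scaled_entries vw sp bn bd en ed.

Hypothesis raw_le : (sexp_size raw <= Y)%N.
Hypothesis inv_eps_le : (absz (ed %/ en)%Z <= Y)%N.
Let P := int_bits Y.

Let vw_size : (size vw < Y)%N.
Proof. by have := size_enc_seq enc_rates vw; move: raw_le; rewrite /raw /enc_raw /=; lia. Qed.

Let sp_size : (size sp < Y)%N.
Proof. by have := size_enc_seq enc_rates sp; move: raw_le; rewrite /raw /enc_raw /=; lia. Qed.

Let vw_small x : x \in vw -> small_rates Y x.
Proof. by apply: enc_rates_small; move: raw_le; rewrite /raw /enc_raw /=; lia. Qed.

Let sp_small x : x \in sp -> small_rates Y x.
Proof. by apply: enc_rates_small; move: raw_le; rewrite /raw /enc_raw /=; lia. Qed.

Lemma scale_gt0 : 0 < D. Proof. exact: atom_product_gt0. Qed.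

Let D_small : small Y D.
Proof. exact: leq_trans (int_size_atom_product _) raw_le. Qed.

Let small_index k : 0 <= k -> k < Y%:Z -> small Y k.
Proof.
move=> k0 kY; have Y0 : (0 < Y)%N by lia.
rewrite /small -(prednK Y0); apply: int_size_le; rewrite prednK //.
apply: leq_ltn_trans (ltn_expl Y (isT : (1 < 2)%N)); lia.
Qed.

Let YP : (Y <= P)%N. Proof. by rewrite /P /int_bits; lia. Qed.

Let YP4 : (4 * Y + 10 <= P)%N. Proof. by []. Qed.

Lemma precision_gt0 : 0 < N.
Proof.
rewrite /N /precision; have : 0 <= (ed %/ en)%Z by rewrite divz_ge0 // ltW.
by move=> ?; apply: mulr_gt0; lia.
Qed.

Lemma precision_le : (absz N <= (Y + 1) * (Y + 2))%N.
Proof.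
rewrite /N /precision; have : 0 <= (ed %/ en)%Z by rewrite divz_ge0 // ltW.
move=> h; rewrite abszM leq_mul //.
  by move: vw_size; lia.
by move: inv_eps_le h; move: (_ %/ _)%Z => z; lia.
Qed.

Lemma scaled_jobs_valid (j : job) : j \in J -> [/\ small_job P j, 0 <= j.2.1 & 0 <= j.2.2].
Proof.
rewrite mem_isort => /mapP[[k [[vn vd] [wn wd]]] hk ->].
have /andP[k0 kn] := index_from_bounds hk; have := index_fromP hk => /= hx.
have [/= h1 h2 h3 h4] := vw_small hx; have [/= g1 g2 g3 g4] := jobs_valid hx.
have D0 := scale_gt0.
split=> /=; last 2 first.
- by rewrite divz_ge0 // mulr_ge0 // ltW.
- by rewrite divz_ge0 // mulr_ge0 // ltW.
split=> /=.
- by apply: sub_small YP; apply: small_index => //; move: kn => /=; move: vw_size; lia.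
- by move: h1 D_small; rewrite /small /P /int_bits -/D; int_size_lia.
- by move: h3 D_small; rewrite /small /P /int_bits -/D; int_size_lia.
Qed.

Lemma scaled_entries_valid (x : entry) : x \in ents ->
  small_entry P x /\ [/\ 0 <= x.1.2.1, x.2.1 = 0 & x.2.2 = 0].
Proof.
move=> /mapP[[k [[sn sd] [pn pd]]] hk ->].
have /andP[k0 kn] := index_from_bounds hk; have := index_fromP hk => /= hx.
have [/= h1 h2 h3 h4] := sp_small hx; have [/= g1 g2 g3 g4] := speeds_valid hx.
have D0 := scale_gt0.
split; last by split=> //=; rewrite divz_ge0 // mulr_ge0 // ltW.
have P1 : (1 <= P)%N by rewrite /P /int_bits; lia.
split=> /=; last split=> /=.
- by apply: sub_small YP; apply: small_index => //; move: kn => /=; move: sp_size; lia.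
- by move: h2 D_small; rewrite /small /P /int_bits -/D; int_size_lia.
- by move: h2 h3 D_small; rewrite /small /P /int_bits -/D; int_size_sum.
- exact: sub_small h1 YP.
- exact: sub_small h2 YP.
- by rewrite /small int_size_lit.
- by rewrite /small int_size_lit.
Qed.

Let Q := size_bound (size sp) Y.
Let PQ : (4 * P + Y + 20 <= Q)%N. Proof. by rewrite /Q /size_bound /P; lia. Qed.

Let J_size : (size J <= Y)%N.
Proof. by rewrite size_scaled_jobs ltnW. Qed.

Let D_smallP : small P D. Proof. exact: sub_small D_small YP. Qed.

Let reach_inv' js s : subjobs J js -> reach N D (init_state ents) js s ->
  state_inv N ents P Y (size js) s.
Proof. exact: (reach_inv precision_gt0 D_smallP scaled_entries_valid scaled_jobs_valid J_size). Qed.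

Lemma reach_small js s : subjobs J js -> reach N D (init_state ents) js s -> small_state Q s.
Proof.
move=> hjs /(reach_inv' hjs) h; have hs : (size js <= Y)%N by apply: leq_trans hjs.1 J_size.
split.
- move=> x xs; have [y ye xy] := class_mem (inv_class h) xs.
  have [[h1 h2 h3 [h4 h5 _ _]] _] := scaled_entries_valid ye.
  have [_ _ ha hu _] := inv_entry h xs.
  by split; rewrite ?xy; last split; apply: leq_trans PQ;
     try (apply: leq_trans ha _); try (apply: leq_trans hu _);
     try (apply: leq_trans h1 _); try (apply: leq_trans h2 _);
     try (apply: leq_trans h3 _); try (apply: leq_trans h4 _);
     try (apply: leq_trans h5 _); move: hs; clear; lia.
- rewrite -(size_map fst) (inv_class h) size_map size_map size_index_from.
  by move: sp_size PQ; clear; lia.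
- by apply: leq_trans (inv_cost h) _; move: hs PQ YP4; clear; lia.
- by apply: leq_trans (inv_energy h) _; move: hs PQ; clear; lia.
Qed.

Lemma table_small js (T : seq state) : subjobs J js ->
  table N D (init_state ents) js T -> (size T <= Q)%N.
Proof.
move=> hjs hT; apply: leq_trans (_ : table_bound (size sp) Y <= _)%N; last first.
  by rewrite /Q /size_bound; lia.
apply: leq_trans
  (table_size precision_gt0 D_smallP scaled_entries_valid scaled_jobs_valid J_size hjs hT) _.
rewrite size_map size_index_from /table_bound leq_exp2r // leq_mul //.
  by have := precision_le; have := precision_gt0; lia.
by rewrite -/P; clear; lia.
Qed.

Let B_small : small P B.
Proof.
have : small Y bn by move: raw_le; rewrite /raw /enc_raw /small /=; lia.
by move: D_small; rewrite /B /scaled_budget -/D /small /P /int_bits; int_size_sum.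
Qed.

Lemma best_items c : best vw sp bn bd en ed = Some c ->
  (size c.2 <= Y.+1)%N /\ forall x : item, x \in c.2 -> small_item (4 * P + Y + 20) x.
Proof.
move=> /best_candidate_mem /all_candidatesP[j [s [x [y [hj hs hx hy E]]]]].
have hjs : subjobs J (rev (kept j.1 J)) by apply: (@subjobs_kept _ _ _ [::]); rewrite cats0.
have [_ /(_ _ hs) hr] := dp_table N D (init_state ents) j.1 J.
have h := reach_inv' hjs hr.
have hsz : (size (rev (kept j.1 J)) <= Y)%N by apply: leq_trans hjs.1 J_size.
have small_j : small_job P j.
  move: hj; rewrite inE => /predU1P[->|/scaled_jobs_valid[]//].
  by split; rewrite /small /= ?int_size_lit // /P /int_bits; lia.
have items_small z : z \in s.2.2 -> small_item (4 * P + Y + 20) z.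
  by move=> /(inv_items h); apply: small_itemW; clear; lia.
have class_small z : z \in s.1.1 -> [/\ small P z.1.1, small P z.1.2.1, small P z.1.2.2.1,
    small P z.1.2.2.2.1 & small P z.1.2.2.2.2].
  move=> zs; have [z' ze zz] := class_mem (inv_class h) zs.
  by have [[h1 h2 h3 [h4 h5 _ _]] _] := scaled_entries_valid ze; rewrite zz; split.
have mk_small (a b : speed_class) xa xb q :
    small P a.1 -> small P a.2.2.2.1 -> small P a.2.2.2.2 ->
    small P b.2.2.2.1 -> small P b.2.2.2.2 ->
    small (2 * P + Y + 5) xa -> small (2 * P + Y + 5) xb -> small (P + 1) q ->
    small_item (4 * P + Y + 20) (mk_item D a b j xa xb q).
  have [k1 k2 k3] := small_j.
  move=> a1 a2 a3 b1 b2 ha hb hq.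
  have w z : small P z -> small (4 * P + Y + 20) z by move=> /sub_small; apply; clear; lia.
  have Dw := D_smallP.
  split; [exact: w|split; exact: w|split; try exact: w|split; try exact: w];
    rewrite /mk_item /mk_segment /class_speed.
  - by move: ha a3; rewrite /small; int_size_sum.
  - by move: hq Dw a2; rewrite /small; int_size_sum.
  - by move: hb b2; rewrite /small; int_size_sum.
  - by move: hq Dw b1; rewrite /small; int_size_sum.
have [k1 k2 k3] := small_j.
have [x1 x2 x3 x4 x5] := class_small x hx; have [y1 y2 y3 y4 y5] := class_small y hy.
have En_small : small (2 * P + 1 + Y) s.2.1.
  by apply: leq_trans (inv_energy h) _; rewrite leq_add2l.
have w (z : int) : small P z -> small (2 * P + Y + 5) z by move=> /sub_small; apply; clear; lia.
have mk_items q xa xb : small (2 * P + Y + 5) xa -> small (2 * P + Y + 5) xb -> small (P + 1) q ->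
    (size (mk_candidate D j s x y q xa xb).2 <= Y.+1)%N /\
    forall z, z \in (mk_candidate D j s x y q xa xb).2 -> small_item (4 * P + Y + 20) z.
  move=> ha hb hq; rewrite /mk_candidate /=; case: ifP => _ /=; rewrite (inv_size h).
    split; first by rewrite ltnS.
    by move=> z; rewrite inE => /predU1P[->|/items_small//]; exact: mk_small.
  by split; [exact: leqW|exact: items_small].
move: E; rewrite /pair_candidate; case: ifP => [_ [<-]|_].
  apply: mk_items; [exact: w| |]; by rewrite /small int_size_lit; clear; lia.
case: ifP => // _; case: ifP => // _ [<-]; rewrite /class_energy; apply: mk_items.
- by move: B_small En_small k2 y3; rewrite /small; int_size_lia.
- by move: B_small En_small k2 x3; rewrite /small; int_size_lia.
- by move: x3 y3; rewrite /small; int_size_lia.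
Qed.

Lemma ev_raw : evaluates_within prog [:: raw] (nth (TInt 0) prog 0)
  (result vw sp bn bd en ed) (b_main Q).
Proof.
have P_le z : small P z -> small Q z.
  by move=> /sub_small; apply; move: PQ; clear; lia.
have big z : small (4 * P + Y + 20) z -> small Q z by move=> /sub_small; apply.
apply: ev_main.
- by apply: leq_trans raw_le _; move: PQ; clear; lia.
- exact: precision_gt0.
- rewrite /small; have h : (0 < Q)%N by move: PQ; clear; lia.
  rewrite -(prednK h); apply: int_size_le; rewrite prednK //.
  apply: leq_ltn_trans precision_le _; apply: leq_ltn_trans (ltn_expl Q (isT : (1 < 2)%N)).
  by rewrite /Q /size_bound; move: ((Y + 1) * _)%N; clear; lia.
- exact: P_le.
- by move=> j /scaled_jobs_valid[[h1 h2 h3] _ _]; split; exact: P_le.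
- by move=> x /scaled_entries_valid[[h1 _ _ _] _]; exact: P_le.
- exact: reach_small.
- exact: table_small.
- move=> c /best_items[h1 h2]; split; first by apply: leq_trans h1 _; move: PQ; clear; lia.
  by move=> x /h2[h _ _ _]; exact: big.
Qed.

Definition output_bound (kappa Y : nat) : nat :=
  ((10 * (4 * int_bits Y + Y + 20) + 40) * Y.+1 * kappa + (int_bits Y + 2) * Y + 30)%N.

Lemma sexp_size_result : (sexp_size (result vw sp bn bd en ed) <= output_bound (size sp) Y)%N.
Proof.
rewrite /result /output_bound -/P; case E: best => [c|].
  have [h1 h2] := best_items E; apply: leq_trans (sexp_size_output _ h2) _.
  rewrite size_map size_index_from.
  have : ((10 * (4 * P + Y + 20) + 40) * size c.2 * size sp <=
          (10 * (4 * P + Y + 20) + 40) * Y.+1 * size sp)%N by rewrite !leq_mul.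
  by clear; lia.
rewrite /= int_size_lit; have := @sexp_size_ids P J.
move=> /(_ (fun j hj => let: And3 h _ _ := scaled_jobs_valid hj in h)).
have : ((P + 2) * size J <= (P + 2) * Y)%N by rewrite leq_mul.
by rewrite -/J; clear; lia.
Qed.

End Time.

Lemma poly_bounded_time kappa :
  poly_bounded (fun Y => b_main (size_bound kappa Y) + output_bound kappa Y)%N.
Proof.
have h := poly_bounded_b_main.
have h1 : poly_bounded int_bits by rewrite /int_bits; poly_bounded.
have h2 : poly_bounded (table_bound kappa) by rewrite /table_bound; poly_bounded.
have h3 : poly_bounded (size_bound kappa) by rewrite /size_bound; poly_bounded.
have h4 : poly_bounded (output_bound kappa) by rewrite /output_bound; poly_bounded.
by poly_bounded.
Qed.

(** * The energy-constrained assignment of speeds *)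

Section OneSplit.
Variables (R : realFieldType) (J K : finType) (u v : J -> R) (r e : K -> R) (E : R).
Hypothesis u_ge0 : forall j, 0 <= u j.
Hypothesis r_ge0 : forall i, 0 <= r i.

(** [r] and [e] are time and energy per unit of work, and [lambda] is the price of energy: [i]
    minimizes the Lagrangian cost of a unit of work while weight [W] is waiting. *)
Definition cheapest (lambda W : R) (i : K) :=
  forall k, W * r i + lambda * e i <= W * r k + lambda * e k.

Definition energy_of (sigma : J -> K) : R := \sum_j v j * e (sigma j).

Definition switch (sigma : J -> K) (j : J) (a : K) : J -> K :=
  fun k => if k == j then a else sigma k.

Lemma energy_switch sigma j a :
  energy_of (switch sigma j a) = energy_of sigma + v j * (e a - e (sigma j)).
Proof.
rewrite /energy_of (bigD1 j) //= [in RHS](bigD1 j) //= /switch eqxx.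
rewrite (eq_bigr (fun k => v k * e (sigma k))); last by move=> k /negbTE ->.
ring.
Qed.

(** The price of energy at which job [p.1] is indifferent between its present class and the class
    [p.2]; it is used for classes [p.2] that need more energy. *)
Definition ratio (sigma : J -> K) (p : J * K) : R :=
  u p.1 * (r (sigma p.1) - r p.2) / (e p.2 - e (sigma p.1)).

Definition costlier (sigma : J -> K) : {set J * K} :=
  [set p | e (sigma p.1) < e p.2].

(** Complementary slackness: either energy is free, or some job has a second cheapest class, faster
    than its own, and moving it there entirely would exceed the budget, so that a mixture of the two
    uses up the energy exactly. *)
Definition optimal_split lambda sigma :=
  [/\ 0 <= lambda, forall j, cheapest lambda (u j) (sigma j), energy_of sigma <= E &
     lambda = 0 \/ exists j a, [/\ cheapest lambda (u j) a, e (sigma j) < e a,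
       r a < r (sigma j) & E < energy_of sigma + v j * (e a - e (sigma j))]].

(** The price is lowered to the largest breakpoint [mu], down to which all assignments stay
    cheapest. There, a job attaining it moves to its costlier class if the budget permits; otherwise
    the price is critical. Every move removes a pair from [costlier], so the process ends. If no
    breakpoint is positive, the price drops to 0. *)
Lemma sweep_down sigma lambda : 0 <= lambda ->
  (forall j, cheapest lambda (u j) (sigma j)) -> energy_of sigma <= E ->
  exists lambda' sigma', optimal_split lambda' sigma'.
Proof.
have [m] := ubnP #|costlier sigma|; elim: m sigma lambda => // m IH sigma lambda.
rewrite ltnS => hm l0 hc hE.
have ratio_le p mu : p \in costlier sigma -> ratio sigma p <= mu ->
    u p.1 * r (sigma p.1) + mu * e (sigma p.1) <= u p.1 * r p.2 + mu * e p.2.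
  rewrite inE /ratio -subr_gt0 => d0; rewrite ler_pdivrMr // => h; lra.
have keep mu j k : 0 <= mu <= lambda -> e k <= e (sigma j) ->
    u j * r (sigma j) + mu * e (sigma j) <= u j * r k + mu * e k.
  move=> /andP[m0 ml] hk; have := hc j k; nra.
have cheap mu : 0 <= mu <= lambda -> (forall p, p \in costlier sigma -> ratio sigma p <= mu) ->
    forall j, cheapest mu (u j) (sigma j).
  move=> hmu hp j k; case: (lerP (e k) (e (sigma j))) => [|h]; first exact: keep.
  by apply: (ratio_le (j, k)); [rewrite inE|apply: hp; rewrite inE].
have [hpos|] := boolP [exists p in costlier sigma, 0 < ratio sigma p]; last first.
  rewrite negb_exists_in => /forall_inP hneg; exists 0, sigma; split=> //; last by left.
  by apply: cheap => [|p /hneg]; [rewrite lexx l0|rewrite -leNgt].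
have {hpos} [p0 p0c p00] := exists_inP hpos.
have [p pc' pmax] := @Order.TotalTheory.arg_maxP _ R _ p0 (mem (costlier sigma)) (ratio sigma) p0c.
have pc : p \in costlier sigma := pc'.
set mu := ratio sigma p in pmax.
have mu0 : 0 < mu by apply: lt_le_trans p00 (pmax _ p0c).
have d0 : 0 < e p.2 - e (sigma p.1) by rewrite subr_gt0; move: pc; rewrite inE.
have muE : mu * (e p.2 - e (sigma p.1)) = u p.1 * (r (sigma p.1) - r p.2).
  by rewrite /mu /ratio divfK // lt0r_neq0.
have mul : mu <= lambda.
  rewrite -(ler_pM2r d0) muE; have := hc p.1 p.2; lra.
have hmu : 0 <= mu <= lambda by rewrite ltW.
have hsig := cheap mu hmu pmax.
have ha : cheapest mu (u p.1) p.2 by move=> k; have := hsig p.1 k; lra.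
have [hE'|hE'] := lerP (energy_of (switch sigma p.1 p.2)) E.
  apply: (IH (switch sigma p.1 p.2) mu) => //; [|exact: ltW|].
    apply: leq_trans hm; apply/proper_card/properP; split.
      apply/fintype.subsetP => q; rewrite !inE /switch; case: eqP => [->|_] //.
      by apply: lt_trans; rewrite -subr_gt0.
    by exists p => //; rewrite inE /switch eqxx ltxx.
  by move=> j; rewrite /switch; case: eqP => [->|_].
exists mu, sigma; split=> //; first exact: ltW.
right; exists p.1, p.2; split=> //.
- by rewrite -subr_gt0.
- have : 0 < u p.1 * (r (sigma p.1) - r p.2) by rewrite -muE mulr_gt0.
  have := u_ge0 p.1; rewrite le_eqVlt => /orP[/eqP <-|u0]; first by rewrite mul0r ltxx.
  by rewrite pmulr_rgt0 // subr_gt0.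
- by rewrite -energy_switch.
Qed.

(** At a high price all jobs take the class [i1] of least energy, the fastest one in case of ties,
    which is affordable. The initial [lambda] is a sum of nonnegative upper bounds for the
    breakpoints and thus exceeds or equals each of them. *)
Lemma exists_optimal_split (i0 : K) : (\sum_j v j) * e i0 <= E -> (forall i, e i0 <= e i) ->
  exists lambda sigma, optimal_split lambda sigma.
Proof.
move=> hE hmin.
have [i1 /eqP i1e i1min] := @Order.TotalTheory.arg_minP _ R _ i0 (fun i => e i == e i0) r (eqxx _).
pose q j i := u j * r i1 / (e i - e i1).
pose lambda := \sum_j \sum_(i | e i1 < e i) q j i.
have q0 j i : e i1 < e i -> 0 <= q j i.
  by move=> h; rewrite /q mulr_ge0 ?mulr_ge0 ?invr_ge0 // subr_ge0 ltW.
have l0 : 0 <= lambda by apply: sumr_ge0 => j _; apply: sumr_ge0 => i; exact: q0.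
apply: (@sweep_down (fun=> i1) lambda) => //; last by rewrite /energy_of -mulr_suml i1e.
move=> j k; case: (ltrP (e i1) (e k)) => [h|h]; last first.
  have ek : e k = e i1 by apply/le_anti; rewrite h i1e hmin.
  by rewrite ek lerD2r ler_wpM2l // i1min // -i1e ek.
have d0 : 0 < e k - e i1 by rewrite subr_gt0.
have ql : q j k <= lambda.
  rewrite /lambda (bigD1 j) //= (bigD1 k) //= -addrA lerDl.
  rewrite addr_ge0 ?sumr_ge0 // => [i /andP[hi _]|i _]; first exact: q0.
  by apply: sumr_ge0 => i'; exact: q0.
have : u j * r i1 <= lambda * (e k - e i1).
  by rewrite -ler_pdivrMr.
have : 0 <= u j * r k by exact: mulr_ge0.
lra.
Qed.

End OneSplit.

(** * Costs of class schedules as sums over pairs of jobs *)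

Section PairwiseCost.
Variables (R : realFieldType) (X : Type) (d : Order.disp_t) (C : orderType d).
Variables (w t : X -> R) (c : X -> C).

Definition time_upto (k : C) (l : seq X) : R := \sum_(y <- l | (c y <= k)%O) t y.
Definition weight_after (k : C) (l : seq X) : R := \sum_(y <- l | ~~ (c y <= k)%O) w y.

(* The cost of the schedule ordered by class where, inside a class, the jobs
   are ordered as in the reversed list. *)
Fixpoint class_cost (l : seq X) : R :=
  if l is x :: l' then
    class_cost l' + w x * (time_upto (c x) l' + t x) + t x * weight_after (c x) l'
  else 0.

Lemma class_cost_cons x l : class_cost (x :: l) =
  class_cost l + w x * t x + \sum_(y <- l) if (c y <= c x)%O then w x * t y else w y * t x.
Proof.
rewrite /= /time_upto /weight_after mulrDr -!addrA; congr (_ + _).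
rewrite addrCA; congr (_ + _); rewrite !mulr_sumr big_mkcond [X in _ + X]big_mkcond -big_split.
apply: eq_bigr => y _ /=; case: ifP => _ /=; first by rewrite addr0.
by rewrite add0r mulrC.
Qed.

Variable b : X -> X -> R.

Definition pair_cost (l : seq X) : R := \sum_(x <- l) \sum_(y <- l) b x y.

Lemma pair_cost_cons x l :
  pair_cost (x :: l) = pair_cost l + b x x + \sum_(y <- l) (b x y + b y x).
Proof.
rewrite /pair_cost big_cons big_cons.
rewrite [X in _ + X = _](eq_bigr (fun z => b z x + \sum_(y <- l) b z y)); last first.
  by move=> z _; rewrite big_cons.
rewrite !big_split /=; ring.
Qed.

(** A [Prop] version of [pairwise]. Membership is expressed by splittings, so that no decidable
    equality on [X] is required. *)
Fixpoint pairs_all (P : X -> X -> Prop) (l : seq X) : Prop :=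
  if l is x :: l' then (forall l1 y l2, l' = l1 ++ y :: l2 -> P x y) /\ pairs_all P l' else True.

Lemma class_cost_le l : (forall x, w x * t x <= b x x) ->
  pairs_all (fun x y => (if (c y <= c x)%O then w x * t y else w y * t x) <= b x y + b y x) l ->
  class_cost l <= pair_cost l.
Proof.
move=> hb; elim: l => [|x l IH]; first by rewrite /pair_cost big_nil.
move=> [hx /IH hl]; rewrite class_cost_cons pair_cost_cons !lerD //.
elim: l hx {hl IH} => [|y l IH] hx; first by rewrite !big_nil.
rewrite !big_cons lerD //; first exact: (hx [::] y l).
by apply: IH => l1 z l2 lE; apply: (hx (y :: l1) z l2); rewrite lE.
Qed.

End PairwiseCost.

Lemma pairs_all_imply (X : Type) (P Q : X -> X -> Prop) l :
  (forall x y, P x y -> Q x y) -> pairs_all P l -> pairs_all Q l.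
Proof. by move=> h; elim: l => //= x l IH [hx /IH]; split=> // l1 y l2 /hx /h. Qed.

Lemma pairs_all_and (X : Type) (P Q : X -> X -> Prop) l :
  pairs_all P l -> pairs_all Q l -> pairs_all (fun x y => P x y /\ Q x y) l.
Proof.
elim: l => //= x l IH [hx hl] [kx kl]; split; last exact: IH.
by move=> l1 y l2 lE; split; [exact: hx lE|exact: kx lE].
Qed.

Lemma pairs_allP (X : eqType) (P : X -> X -> Prop) x l :
  (forall l1 y l2, l = l1 ++ y :: l2 -> P x y) <-> (forall y, y \in l -> P x y).
Proof.
split=> [h y yl|h l1 y l2 lE]; last by apply: h; rewrite lE mem_cat mem_head orbT.
by case/splitPr: yl h => l1 l2 h; exact: (h l1 y l2).
Qed.

Lemma pairs_all_filter (X : eqType) (P : X -> X -> Prop) (a : pred X) l :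
  pairs_all P l -> pairs_all P [seq x <- l | a x].
Proof.
elim: l => //= x l IH [/pairs_allP hx /IH hl]; case: ifP => //= _; split=> //.
by apply/pairs_allP => y; rewrite mem_filter => /andP[_ /hx].
Qed.

Lemma pairs_all_neq (X : eqType) (l : seq X) : uniq l -> pairs_all (fun x y => x != y) l.
Proof.
elim: l => //= x l IH /andP[xl /IH]; split=> //.
apply/(pairs_allP (fun x y : X => is_true (x != y))) => y yl.
by apply: contraNneq xl => ->.
Qed.

(** * Rounding errors *)

(** Refines [reach] by the class chosen at each insertion; these choices determine the exact
    quantities that the rounded numbers approximate. *)
Inductive runs (N D : int) (s0 : state) : seq (job * speed_class) -> state -> Prop :=
| runs_nil : runs N D s0 [::] s0
| runs_cons l j s x : runs N D s0 l s -> x \in s.1.1 ->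
    runs N D s0 ((j, x.1) :: l) (extend N D j s x).

Lemma reach_runs N D s0 js s : reach N D s0 js s ->
  exists2 l, js = [seq x.1 | x <- l] & runs N D s0 l s.
Proof.
elim=> [|{}js j {}s x hs [l -> hl] xs]; first by exists [::] => //; exact: runs_nil.
by exists ((j, x.1) :: l) => //; exact: runs_cons.
Qed.

Section Rounding.
Variables (R : realFieldType) (N D : int) (ents : seq entry).
Hypothesis N_gt0 : 0 < N.
Hypothesis ents_valid : forall x : entry, x \in ents -> [/\ 0 <= x.1.2.1, x.2.1 = 0 & x.2.2 = 0].
Local Notation runs := (runs N D (init_state ents)).
Local Notation X := (job * speed_class)%type.

Definition item_weight (x : X) : R := x.1.2.2%:~R.
Definition item_time (x : X) : R := (class_time x.2 * x.1.2.1)%:~R.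
Definition item_class (x : X) : int := class_index x.2.
Definition item_energy (x : X) : int := class_energy x.2 * x.1.2.1.
Definition item_of (x : X) : item := mk_item D x.2 x.2 x.1 x.1.2.1 0 1.
Definition rho : R := 1 - N%:~R^-1.

Lemma rho_ge0 : 0 <= rho.
Proof. by rewrite subr_ge0 invf_le1 ?ltr0z // ler1z; lia. Qed.

Lemma rho_le1 : rho <= 1.
Proof. by rewrite gerBl invr_ge0 ler0z ltW. Qed.

Lemma round_ge_rho (x : int) : 0 <= x -> rho * x%:~R <= (round N x)%:~R :> R.
Proof.
move=> x0; have NR : (0 : R) < N%:~R by rewrite ltr0z.
have := round_error x0 N_gt0; rewrite -(ler_int R) rmorphM rmorphB /= => h.
rewrite /rho mulrBl mul1r lerBlDr -lerBlDl.
by rewrite -ler_pdivlMl // mulrC in h *; rewrite mulrC.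
Qed.

Local Notation time_upto := (time_upto item_time item_class).
Local Notation weight_after := (weight_after item_weight item_class).
Local Notation class_cost := (class_cost item_weight item_time item_class).

Definition approx (m : nat) (z : int) (a : R) := 0 <= z /\ rho ^+ m * a <= z%:~R <= a.

Lemma approx_ge0 m z a : approx m z a -> 0 <= a.
Proof. by move=> [z0 /andP[_]]; apply: le_trans; rewrite ler0z. Qed.

Lemma approx_round m z a (b : int) : approx m z a -> 0 <= b ->
  approx m.+1 (round N (z + b)) (a + b%:~R).
Proof.
move=> ha b0; have a0 := approx_ge0 ha; have [z0 /andP[h1 h2]] := ha.
have zb : 0 <= z + b by exact: addr_ge0.
split; first exact: round_ge0.
apply/andP; split; last first.
  by apply: le_trans (_ : (z + b)%:~R <= _); rewrite ?ler_int ?round_le // rmorphD lerD2r.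
apply: le_trans (round_ge_rho zb); rewrite exprS -mulrA ler_wpM2l ?rho_ge0 // rmorphD mulrDr.
by rewrite lerD // ler_piMl ?ler0z // exprn_ile1 ?rho_ge0 ?rho_le1.
Qed.

(** New numbers arise by adding exact nonnegative terms and multiplying by exact nonnegative
    factors, which preserves a relative error [rho ^ m]; the rounding of an insertion contributes
    one more factor [rho]. Energies and items remain exact. *)
Lemma runs_approx l s : runs l s -> (forall x, x \in l -> 0 <= x.1.2.1 /\ 0 <= x.1.2.2) ->
  [/\ [seq x.1 | x <- s.1.1] = [seq x.1 | x <- ents],
      forall x, x \in s.1.1 -> approx (size l) x.2.1 (time_upto x.1.1 l) /\
                               approx (size l) x.2.2 (weight_after x.1.1 l),
      approx (size l) s.1.2 (class_cost l),
      s.2.1 = \sum_(x <- l) item_energy x &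
      s.2.2 = [seq item_of x | x <- l]].
Proof.
have ap0 : approx 0 0 0 by split=> //; rewrite mulr0 lexx.
elim=> [_|{}l j {}s x hs IH xs hl].
  split=> //=; last by rewrite big_nil.
  move=> x xe; have [_ -> ->] := ents_valid xe.
  by rewrite /time_upto /weight_after !big_nil.
have [|IHc IHe IHk IHen IHi] := IH; first by move=> y yl; apply: hl; rewrite inE yl orbT.
have [/= v0 w0] := hl (j, x.1) (mem_head _ _).
have [y ye xy] := class_mem IHc xs.
have r0 : 0 <= x.1.2.1 by rewrite xy; case: (ents_valid ye).
have tau0 : 0 <= x.1.2.1 * j.2.1 by exact: mulr_ge0.
split.
- rewrite -IHc /extend /= -map_comp; exact: eq_map.
- move=> z /mapP[u us ->]; have [ha hu] := IHe _ us; rewrite /update /=; split.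
    have -> : time_upto u.1.1 ((j, x.1) :: l) =
        time_upto u.1.1 l + (leqz x.1.1 u.1.1 * (x.1.2.1 * j.2.1))%:~R.
      rewrite /time_upto big_cons /leqz /item_class /item_time /=.
      by rewrite /class_index /class_time /=; case: ifP => _; rewrite ?mul1r ?mul0r ?addr0 // addrC.
    by apply: approx_round => //; rewrite mulr_ge0 // /leqz; case: ifP.
  have -> : weight_after u.1.1 ((j, x.1) :: l) =
      weight_after u.1.1 l + (leqz (u.1.1 + 1) x.1.1 * j.2.2)%:~R.
    rewrite /weight_after big_cons /leqz /item_class /item_weight /= /class_index.
    rewrite -ltNge -lezD1.
    by case: ifP => _; rewrite ?mul1r ?mul0r ?addr0 // addrC.
  by apply: approx_round => //; rewrite mulr_ge0 // /leqz; case: ifP.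
- rewrite -[approx _ _ _]/(approx (size l).+1
    (round N (s.1.2 + j.2.2 * (x.2.1 + class_time x.1 * j.2.1) + class_time x.1 * j.2.1 * x.2.2))
    (class_cost ((j, x.1) :: l))).
  have [ha hu] := IHe _ xs.
  have [a0 /andP[a1 a2]] := ha; have [u0 /andP[u1 u2]] := hu; have [k0 /andP[k1 k2]] := IHk.
  have -> : class_cost ((j, x.1) :: l) = class_cost l +
      j.2.2%:~R * (time_upto x.1.1 l + (x.1.2.1 * j.2.1)%:~R) +
      (x.1.2.1 * j.2.1)%:~R * weight_after x.1.1 l by [].
  rewrite /class_time; move: (x.1.2.1 * j.2.1) tau0 => tau tau0.
  set A := time_upto x.1.1 l in a1 a2 *; set U := weight_after x.1.1 l in u1 u2 *.
  set Kc := class_cost l in k1 k2 *.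
  have A0 : 0 <= A by exact: approx_ge0 ha.
  have z0 : 0 <= s.1.2 + j.2.2 * (x.2.1 + tau) + tau * x.2.2.
    by rewrite addr_ge0 ?mulr_ge0 ?addr_ge0 ?mulr_ge0 ?addr_ge0.
  have tauR : (0 : R) <= tau%:~R by rewrite ler0z.
  have wR : (0 : R) <= j.2.2%:~R by rewrite ler0z.
  split; first exact: round_ge0.
  apply/andP; split; last first.
    apply: le_trans (_ : (s.1.2 + j.2.2 * (x.2.1 + tau) + tau * x.2.2)%:~R <= _).
      by rewrite ler_int round_le.
    rewrite !(rmorphD, rmorphM) /=.
    by rewrite !lerD // ler_wpM2l // lerD.
  apply: le_trans (round_ge_rho z0); rewrite exprS -mulrA ler_wpM2l ?rho_ge0 //.
  rewrite !(rmorphD, rmorphM) /= !mulrDr.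
  have p0 : 0 <= rho ^+ size l by rewrite exprn_ge0 // rho_ge0.
  have p1 : rho ^+ size l <= 1 by rewrite exprn_ile1 ?rho_ge0 ?rho_le1.
  rewrite !lerD //.
  + by rewrite mulrCA ler_wpM2l.
  + by rewrite ler_piMl // mulr_ge0.
  + by rewrite mulrCA ler_wpM2l.
- by rewrite /extend /= IHen big_cons addrC.
- by rewrite /extend /= IHi.
Qed.

Lemma runs_exists l : (forall x, x \in l -> x.2 \in [seq y.1 | y : entry <- ents]) ->
  exists s, runs l s.
Proof.
elim: l => [_|[j c] l IH hl]; first by exists (init_state ents); exact: runs_nil.
have [|s hs] := IH; first by move=> x xl; apply: hl; rewrite inE xl orbT.
have : c \in [seq y.1 | y : entry <- ents] by apply: (hl (j, c)); exact: mem_head.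
have -> : [seq y.1 | y : entry <- ents] = [seq y.1 | y : entry <- s.1.1].
  elim: hs => // l' j' s' x _ -> _; rewrite /extend /= -map_comp; exact: eq_map.
by move=> /mapP[x xs ->]; exists (extend N D j s x); exact: runs_cons.
Qed.

Definition dominated (s : state) (T : seq state) :=
  exists2 s' : state, s' \in T & s'.1 = s.1 /\ s'.2.1 <= s.2.1.

Lemma put_self (s : state) T : dominated s (put s T).
Proof.
elim: T => [|t T [s' h1 h2]] /=; first by exists s; rewrite ?inE.
case: eqP => [st|_]; last by exists s' => //; rewrite inE h1 orbT.
case: leP => [h|_]; last by exists s => //; exact: mem_head.
by exists t; rewrite ?mem_head.
Qed.

Lemma put_dominated (s u : state) T : dominated u T -> dominated u (put s T).
Proof.
elim: T => [|t T IH] [s' //]; rewrite inE => /predU1P[->|h] [h1 h2] /=.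
  case: eqP => [st|_]; last by exists t; rewrite ?mem_head.
  case: leP => [_|h]; first by exists t; rewrite ?mem_head.
  exists s; rewrite ?mem_head //; split; first by rewrite st.
  exact: le_trans (ltW h) h2.
have hT : dominated u T by exists s'.
case: eqP => [st|_].
  case: leP => _; first by exists s' => //; rewrite inE h orbT.
  by exists s' => //; rewrite inE h orbT.
by have [s1 k1 k2] := IH hT; exists s1 => //; rewrite inE k1 orbT.
Qed.

Lemma dominated_trans (s u : state) T : u.1 = s.1 -> u.2.1 <= s.2.1 ->
  dominated u T -> dominated s T.
Proof.
by move=> h1 h2 [t tT [h3 h4]]; exists t => //; rewrite h3; split=> //; exact: le_trans h2.
Qed.

Lemma layer_dominated j (s : state) (x : entry) T : s \in T -> x \in s.1.1 ->
  dominated (extend N D j s x) (layer N D j T).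
Proof.
move=> sT xs; rewrite /layer.
have keep u (l : seq entry) s' T' : dominated u T' ->
    dominated u (foldl (fun T x => put (extend N D j s' x) T) T' l).
  by elim: l T' => //= y l IH T' h; apply: IH; exact: put_dominated.
have keep2 u (l : seq state) T' : dominated u T' ->
    dominated u (foldl (fun T' s => ext N D j s T') T' l).
  by elim: l T' => //= y l IH T' h; apply: IH; exact: keep.
case/splitPr: sT => T1 T2; rewrite foldl_cat /=; apply: keep2.
rewrite /ext; case/splitPr: xs => l1 l2; rewrite foldl_cat /=; apply: keep.
exact: put_self.
Qed.

(** The key of an extension depends on the old key alone, and equal insertions shift the energy by
    equal amounts. Replacing a state by one with the same key and less energy is thus compatible
    with all later insertions. *)
Lemma dp_dominated id jobs l (s : state) : runs l s -> [seq x.1 | x <- l] = rev (kept id jobs) ->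
  dominated s (dp N D id [:: init_state ents] jobs).
Proof.
rewrite dpE; move: (kept id jobs) => js.
elim/last_ind: js l s => [|js j IH] l s hs.
  case: hs => // _; exists (init_state ents); first exact: mem_head.
  by split.
rewrite rev_rcons foldl_rcons; case: hs => // {}l j' {}s x hs xs [-> /(IH _ _ hs)].
move=> [s' s'T [h1 h2]].
have xs' : x \in s'.1.1 by rewrite h1.
have := layer_dominated j s'T xs'; apply: dominated_trans.
  by rewrite /extend /= h1.
by rewrite /extend /= lerD2r.
Qed.

End Rounding.

(** * Candidates *)

Lemma class_cost_map (R : realFieldType) (X Y : Type) (d : Order.disp_t) (C : orderType d)
    (w t : X -> R) (c : X -> C) (f : Y -> X) l :
  class_cost w t c [seq f y | y <- l] = class_cost (w \o f) (t \o f) (c \o f) l.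
Proof. by elim: l => //= y l ->; rewrite /time_upto /weight_after !big_map. Qed.

Lemma class_costZ (R : realFieldType) (X : Type) (d : Order.disp_t) (C : orderType d)
    (w t : X -> R) (c : X -> C) a b l :
  class_cost (fun x => a * w x) (fun x => b * t x) c l = a * b * class_cost w t c l.
Proof.
elim: l => [|x l IH] /=; first by rewrite mulr0.
rewrite IH /time_upto /weight_after -!mulr_sumr; ring.
Qed.

Lemma eq_in_time_upto (R : realFieldType) (X : eqType) (d : Order.disp_t) (C : orderType d)
    (t t' : X -> R) (c c' : X -> C) k l :
  {in l, t =1 t'} -> {in l, c =1 c'} -> time_upto t c k l = time_upto t' c' k l.
Proof.
move=> ht hc; rewrite /time_upto big_seq_cond [RHS]big_seq_cond.
apply: eq_big => [y|y /andP[yl _]]; last exact: ht.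
by case yl: (y \in l) => //=; rewrite hc.
Qed.

Lemma eq_in_weight_after (R : realFieldType) (X : eqType) (d : Order.disp_t) (C : orderType d)
    (w w' : X -> R) (c c' : X -> C) k l :
  {in l, w =1 w'} -> {in l, c =1 c'} -> weight_after w c k l = weight_after w' c' k l.
Proof.
move=> hw hc; rewrite /weight_after big_seq_cond [RHS]big_seq_cond.
apply: eq_big => [y|y /andP[yl _]]; last exact: hw.
by case yl: (y \in l) => //=; rewrite hc.
Qed.

Lemma eq_in_class_cost (R : realFieldType) (X : eqType) (d : Order.disp_t) (C : orderType d)
    (w t w' t' : X -> R) (c c' : X -> C) l :
  {in l, w =1 w'} -> {in l, t =1 t'} -> {in l, c =1 c'} ->
  class_cost w t c l = class_cost w' t' c' l.
Proof.
elim: l => //= x l IH hw ht hc.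
have sub y : y \in l -> y \in x :: l by rewrite inE => ->; rewrite orbT.
have [hw' ht' hc'] : [/\ {in l, w =1 w'}, {in l, t =1 t'} & {in l, c =1 c'}].
  by split=> y /sub; auto.
rewrite IH // (hw x) ?(ht x) ?(hc x) ?mem_head //.
by rewrite (eq_in_time_upto _ ht' hc') (eq_in_weight_after _ hw' hc').
Qed.

Lemma perm_map_inv (T : eqType) (U : eqType) (f : T -> U) s t :
  perm_eq s [seq f x | x <- t] -> exists2 t', s = [seq f x | x <- t'] & perm_eq t' t.
Proof.
case: t => [|x0 t]; first by move=> /perm_nilP ->; exists [::].
move=> /(perm_iotaP (f x0))[Is]; rewrite size_map => pI ->.
exists [seq nth x0 (x0 :: t) i | i <- Is]; last by apply/(perm_iotaP x0); exists Is.
rewrite -map_comp; apply/eq_in_map => i; rewrite (perm_mem pI) mem_iota => hi.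
by rewrite (nth_map x0).
Qed.

Lemma uniq_map_inj (T U : eqType) (f : T -> U) s : uniq [seq f x | x <- s] -> {in s &, injective f}.
Proof.
elim: s => //= x s IH /andP[xs /IH {}IH] y z.
rewrite !inE => /predU1P[->|ys] /predU1P[->|zs] // E; last exact: IH.
  by rewrite E map_f in xs.
by rewrite -E map_f in xs.
Qed.

(* ((job, (class, second class)), (q, (xa, xb))): volumes xa / q and xb / q of the job are
   processed in the two classes. *)
Definition plan : Type := ((job * (speed_class * speed_class)) * (int * (int * int)))%type.

Section Plans.
Variables (R : realFieldType) (N D B : int) (J : seq job) (ents : seq entry).
Hypothesis N_gt0 : 0 < N.
Hypothesis ents_valid : forall x : entry, x \in ents -> [/\ 0 <= x.1.2.1, x.2.1 = 0 & x.2.2 = 0].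
Hypothesis J_valid : forall j : job, j \in J -> [/\ 0 <= j.1, 0 <= j.2.1 & 0 <= j.2.2].
Local Notation runs := (runs N D (init_state ents)).
Local Notation classes := [seq x.1 | x : entry <- ents].
Local Notation rho := (rho R N).

Definition plan_item (p : plan) : item :=
  mk_item D p.1.2.1 p.1.2.2 p.1.1 p.2.2.1 p.2.2.2 p.2.1.
Definition plan_weight (p : plan) : R := p.1.1.2.2%:~R.
Definition plan_time (p : plan) : R :=
  (class_time p.1.2.1 * p.2.2.1 + class_time p.1.2.2 * p.2.2.2)%:~R / p.2.1%:~R.
Definition plan_energy (p : plan) : R :=
  (class_energy p.1.2.1 * p.2.2.1 + class_energy p.1.2.2 * p.2.2.2)%:~R / p.2.1%:~R.
Definition plan_class (p : plan) : int := class_index p.1.2.1.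
Definition valid_plan (p : plan) :=
  [/\ p.1.2.1 \in classes /\ p.1.2.2 \in classes, 0 < p.2.1, 0 <= p.2.2.1, 0 <= p.2.2.2 &
     p.2.2.1 + p.2.2.2 = p.2.1 * p.1.1.2.1].

Definition whole (x : job * speed_class) : plan := ((x.1, (x.2, x.2)), (1, (x.1.2.1, 0))).

Lemma pair_candidateP (j : job) s x y c : 0 <= j.2.1 -> pair_candidate D B j s x y = Some c ->
  exists q xa xb, [/\ c = mk_candidate D j s x y q xa xb, 0 < q, 0 <= xa /\ 0 <= xb,
    xa + xb = q * j.2.1 & class_energy x.1 * xa + class_energy y.1 * xb <= q * (B - s.2.1)].
Proof.
move=> v0; rewrite /pair_candidate; case: ifP => [h [<-]|/negbT h1].
  by exists 1, j.2.1, 0; split=> //; lia.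
case: ifP => // /negbT h2; case: ifP => // h3 [<-]; move: h1 h2; rewrite -!ltNge.
set ea := class_energy _; set eb := class_energy _ => h1 h2.
exists (ea - eb), (B - s.2.1 - eb * j.2.1), (ea * j.2.1 - (B - s.2.1)).
by split=> //; [lia|split; lia|ring|rewrite le_eqVlt; apply/orP; left; apply/eqP; ring].
Qed.

Lemma kept_no_job : kept (-1) J = J.
Proof.
apply/all_filterP/allP => j /J_valid[j0 _ _]; rewrite opprK.
by apply/eqP => h; move: j0; rewrite -[j.1](addrK 1) h.
Qed.

Lemma perm_kept (j : job) : uniq [seq k.1 | k <- J] -> j \in J ->
  perm_eq (j :: kept j.1 J) J.
Proof.
move=> uJ jJ; rewrite perm_sym; apply: perm_trans (perm_to_rem jJ) _.
rewrite perm_cons /kept rem_filter ?(map_uniq uJ) //.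
rewrite (eq_in_filter (a2 := predC1 j)) // => k kJ /=.
rewrite subr_eq0; congr negb; apply/eqP/eqP => [h|-> //].
exact: (uniq_map_inj uJ).
Qed.

Lemma class_cost_whole l :
  class_cost plan_weight plan_time plan_class [seq whole x | x <- l] =
  class_cost (item_weight R) (item_time R) item_class l.
Proof.
rewrite class_cost_map; apply: eq_in_class_cost => x _ //=.
by rewrite /plan_time /= mulr0 addr0 divr1.
Qed.

Lemma plan_cost_cons j c1 c2 q xa xb l :
  let t := (class_time c1 * xa + class_time c2 * xb)%:~R / q%:~R in
  class_cost plan_weight plan_time plan_class
    (((j, (c1, c2)), (q, (xa, xb))) :: [seq whole x | x <- l]) =
  class_cost (item_weight R) (item_time R) item_class l +
  j.2.2%:~R * (time_upto (item_time R) item_class (class_index c1) l + t) +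
  t * weight_after (item_weight R) item_class (class_index c1) l.
Proof.
have tE : plan_time \o whole =1 item_time R by move=> x; rewrite /plan_time /= mulr0 addr0 divr1.
rewrite /= class_cost_whole /time_upto /weight_after !big_map.
by congr (_ + _ * (_ + _) + _); apply: eq_bigr => x _; exact: tE.
Qed.

(** The special job is inserted last and without rounding, so that only the errors of the [size l]
    earlier insertions are present. *)
Lemma plan_cost_le (j : job) l s (x y : entry) q xa xb : runs l s -> x \in s.1.1 -> y \in s.1.1 ->
  (forall x, x \in l -> x.1 \in J) ->
  0 <= j.2.2 -> 0 < q -> 0 <= xa -> 0 <= xb ->
  let C := class_cost plan_weight plan_time plan_class
    (((j, (x.1, y.1)), (q, (xa, xb))) :: [seq whole x | x <- l]) in
  rho ^+ size l * C <= (mk_candidate D j s x y q xa xb).1.1%:~R / q%:~R <= C /\ 0 <= C.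
Proof.
move=> hr xs ys hl w0 q0 xa0 xb0; cbv zeta.
have [|hc he hK _ _] := runs_approx R N_gt0 ents_valid hr.
  by move=> z /hl /J_valid[].
have r0 z : z \in s.1.1 -> 0 <= class_time z.1.
  by move=> /(class_mem hc)[z' /ents_valid[h _ _] ->].
have [hA hU] := he x xs.
have k0 := approx_ge0 hK; have a0 := approx_ge0 hA; have u0 := approx_ge0 hU.
have [_ /andP[hk hk']] := hK.
have [_ /andP[ha ha']] := hA; have [_ /andP[hu hu']] := hU.
have qR : (0 : R) < q%:~R by rewrite ltr0z.
rewrite plan_cost_cons /=; move: hk hk' ha ha' hu hu' k0 a0 u0.
set T := class_time x.1 * xa + _; have T0 : 0 <= T by rewrite addr_ge0 // mulr_ge0 // r0.
set t := T%:~R / q%:~R; have t0 : 0 <= t by rewrite divr_ge0 // ?ler0z // ltW.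
have wR : (0 : R) <= j.2.2%:~R by rewrite ler0z.
have -> : (q * s.1.2 + j.2.2 * (q * x.2.1 + T) + T * x.2.2)%:~R / q%:~R =
    s.1.2%:~R + j.2.2%:~R * (x.2.1%:~R + t) + t * x.2.2%:~R :> R.
  by rewrite /t !(rmorphD, rmorphM) /=; field; rewrite gt_eqF.
set Kc := class_cost _ _ _ l; set A := time_upto _ _ _ l; set U := weight_after _ _ _ l.
have p0 : 0 <= rho ^+ size l by rewrite exprn_ge0 // rho_ge0.
have p1 : rho ^+ size l <= 1 by rewrite exprn_ile1 ?rho_ge0 ?rho_le1.
move: (rho ^+ size l) p0 p1 => p p0 p1 hk hk' ha ha' hu hu' k0 a0 u0.
split; last by apply: addr_ge0; [apply: addr_ge0 => //|]; apply: mulr_ge0 => //; exact: addr_ge0.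
apply/andP; split; last by rewrite !lerD // ler_wpM2l // lerD2r.
rewrite !mulrDr !lerD //.
- by rewrite mulrCA ler_wpM2l.
- by rewrite ler_piMl // mulr_ge0.
- by rewrite mulrCA ler_wpM2l.
Qed.

(** Soundness: every candidate carries the items of a genuine assignment within the budget, whose
    true cost exceeds the candidate's value by a controlled factor only. *)
Lemma candidate_plans c : uniq [seq k.1 | k <- J] -> c \in all_candidates N D B J ents ->
  exists F : seq plan, [/\ perm_eq [seq p.1.1 | p <- F] J, c.2 = [seq plan_item p | p <- F],
    forall p, p \in F -> valid_plan p, \sum_(p <- F) plan_energy p <= B%:~R &
    rho ^+ size J * class_cost plan_weight plan_time plan_class F <= c.1.1%:~R / c.1.2%:~R].
Proof.
move=> uJ /all_candidatesP[j [s [x [y [hj hs xs ys E]]]]].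
have hjv : 0 <= j.2.1 /\ 0 <= j.2.2.
  by move: hj; rewrite inE => /predU1P[-> //|/J_valid[]].
have [q [xa [xb [cE q0 [xa0 xb0] xv hE]]]] := pair_candidateP hjv.1 E.
have [_ /(_ _ hs) /reach_runs[l lJ hr]] := dp_table N D (init_state ents) j.1 J.
have hl z : z \in l -> z.1 \in J.
  by move=> /(map_f fst); rewrite -lJ mem_rev mem_filter => /andP[].
have [|hc _ _ hen hi] := runs_approx R N_gt0 ents_valid hr.
  by move=> z /hl /J_valid[].
have [h1 h2] := plan_cost_le hr xs ys hl hjv.2 q0 xa0 xb0.
pose p0 : plan := ((j, (x.1, y.1)), (q, (xa, xb))).
have jobE : [seq p.1.1 | p <- [seq whole x | x <- l]] = rev (kept j.1 J).
  by rewrite -map_comp lJ.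
have itemE : [seq plan_item p | p <- [seq whole x | x <- l]] = s.2.2.
  by rewrite hi -map_comp.
have lvalid p : p \in [seq whole x | x <- l] -> valid_plan p.
  move=> /mapP[z zl ->]; split=> //=; [|by case/J_valid: (hl z zl)|by rewrite mul1r addr0].
  suff : z.2 \in classes by split.
  move: zl; clear -hr; elim: hr => // l' j' s' x hr IH xs; rewrite inE => /predU1P[->|//] /=.
  have hc : [seq x.1 | x <- s'.1.1] = classes.
    elim: hr {IH xs} => // l2 j2 s2 z2 _ <- _; rewrite /extend /= -map_comp; exact: eq_map.
  by rewrite -hc map_f.
have lenergy : \sum_(p <- [seq whole x | x <- l]) plan_energy p = s.2.1%:~R.
  rewrite hen big_map rmorph_sum; apply: eq_bigr => z _.
  by rewrite /plan_energy /= mulr0 addr0 divr1.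
have [jJ|jJ] := boolP (j \in J).
  have [j0 _ _] := J_valid jJ.
  exists (p0 :: [seq whole x | x <- l]); split.
  - rewrite map_cons jobE; apply: perm_trans (perm_kept uJ jJ).
    by rewrite perm_cons perm_rev.
  - by rewrite cE /= j0 itemE.
  - move=> p; rewrite inE => /predU1P[->|/lvalid //].
    by split=> //=; rewrite -hc; split; exact: map_f.
  - rewrite big_cons lenergy -lerBrDr /plan_energy /= ler_pdivrMr ?ltr0z //.
    by rewrite -rmorphB -rmorphM ler_int [(_ - _) * q]mulrC.
  - case/andP: h1 => h1 _; rewrite cE; apply: le_trans h1; rewrite ler_wpM2r //.
    rewrite ler_wiXn2l ?rho_ge0 ?rho_le1 //.
    have /perm_size <- := perm_kept uJ jJ.
    by rewrite /= -(size_map fst l) -lJ size_rev.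
have {hj} jE : j = no_job by move: hj; rewrite inE (negbTE jJ) orbF => /eqP.
(* The volume of [no_job] is 0, so that the candidate describes just the jobs of the table. *)
have [xaE xbE] : xa = 0 /\ xb = 0 by move: xv xa0 xb0; rewrite jE /= mulr0; clear; lia.
exists [seq whole x | x <- l]; split=> //.
- by rewrite jobE jE kept_no_job perm_rev.
- by rewrite cE /= jE itemE.
- rewrite lenergy ler_int -subr_ge0 -(pmulr_rge0 _ q0); apply: le_trans hE.
  by rewrite xaE xbE !mulr0.
- case/andP: h1 => h1 _; rewrite cE; apply: le_trans h1.
  rewrite plan_cost_cons jE xaE xbE !mulr0 addr0 !mul0r !addr0 class_cost_whole.
  by rewrite -(size_map fst l) -lJ size_rev jE kept_no_job.
Qed.

Lemma pair_candidate_whole (j : job) s x y : class_energy x.1 * j.2.1 <= B - s.2.1 ->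
  pair_candidate D B j s x y = Some (mk_candidate D j s x y 1 j.2.1 0).
Proof. by rewrite /pair_candidate => ->. Qed.

(** An assignment without a mixed job is found through [no_job], which costs no energy in any class.
    The entry [x0] ensures that there is a pair of classes to form a candidate from. *)
Lemma exists_whole_candidate l x0 : x0 \in ents ->
  (forall x, x \in l -> x.2 \in classes) -> [seq x.1 | x <- l] = rev J ->
  \sum_(x <- l) item_energy x <= B ->
  exists2 c, c \in all_candidates N D B J ents &
    c.1.1%:~R / c.1.2%:~R <= class_cost (item_weight R) (item_time R) item_class l.
Proof.
move=> xe hl lJ hE; have [s hr] := runs_exists N D hl.
have lJ' z : z \in l -> z.1 \in J by move=> /(map_f fst); rewrite lJ mem_rev.
have [s' sT [s1 s2]] := dp_dominated (id := -1) (jobs := J) hr (etrans lJ (congr1 rev (esym kept_no_job))).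
have [|hc _ _ hen _] := runs_approx R N_gt0 ents_valid hr.
  by move=> z /lJ' /J_valid[].
have [x xs] : exists x, x \in s'.1.1.
  have : x0.1 \in [seq x.1 | x <- s.1.1] by rewrite hc map_f.
  by rewrite -s1 => /mapP[x xs _]; exists x.
have E : class_energy x.1 * no_job.2.1 <= B - s'.2.1.
  by rewrite mulr0 subr_ge0 (le_trans s2) // hen.
exists (mk_candidate D no_job s' x x 1 0 0).
  apply/all_candidatesP; exists no_job, s', x, x; split=> //.
    by exact: pair_candidate_whole.
have xs1 : x \in s.1.1 by rewrite -s1.
have [/andP[_ h] _] := plan_cost_le (j := no_job) hr xs1 xs1 lJ' (lexx 0) ltr01 (lexx 0) (lexx 0).
move: h; rewrite plan_cost_cons !mulr0 addr0 !mul0r !addr0.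
by rewrite /mk_candidate /= s1.
Qed.

(** The dominating state in the table may leave more energy than the given assignment. The candidate
    spends the surplus by moving volume from the slower class [c2] to [c1], possibly the entire job,
    which never increases the processing time. *)
Lemma exists_split_candidate (j : job) c1 c2 l (z : R) : j \in J ->
  c1 \in classes -> c2 \in classes ->
  (forall x, x \in l -> x.2 \in classes) -> [seq x.1 | x <- l] = rev (kept j.1 J) ->
  class_energy c2 < class_energy c1 -> class_time c1 <= class_time c2 ->
  0 <= z <= j.2.1%:~R ->
  (\sum_(x <- l) item_energy x)%:~R + (class_energy c1)%:~R * z +
    (class_energy c2)%:~R * (j.2.1%:~R - z) <= B%:~R ->
  exists2 c, c \in all_candidates N D B J ents &
    c.1.1%:~R / c.1.2%:~R <=
      let t := (class_time c1)%:~R * z + (class_time c2)%:~R * (j.2.1%:~R - z) in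
      class_cost (item_weight R) (item_time R) item_class l +
      j.2.2%:~R * (time_upto (item_time R) item_class (class_index c1) l + t) +
      t * weight_after (item_weight R) item_class (class_index c1) l.
Proof.
move=> jJ c1c c2c hl lJ he ht /andP[z0 zv] hE; cbv zeta.
have [s hr] := runs_exists N D hl.
have lJ' x : x \in l -> x.1 \in J.
  by move=> /(map_f fst); rewrite lJ mem_rev mem_filter => /andP[].
have [s' sT [s1 s2]] := dp_dominated hr lJ.
have hlv x : x \in l -> 0 <= x.1.2.1 /\ 0 <= x.1.2.2 by move=> /lJ' /J_valid[].
have [hc hA _ hen _] := runs_approx R N_gt0 ents_valid hr hlv.
have [_ v0 w0] := J_valid jJ.
have [x xs xE] : exists2 x, x \in s.1.1 & c1 = x.1 by apply/mapP; rewrite hc.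
have [y ys yE] : exists2 x, x \in s.1.1 & c2 = x.1 by apply/mapP; rewrite hc.
suff [q [xa [xb [E q0 xa0 xb0 tE]]]] : exists q xa xb,
    [/\ pair_candidate D B j s' x y = Some (mk_candidate D j s' x y q xa xb), 0 < q, 0 <= xa,
       0 <= xb & (class_time c1 * xa + class_time c2 * xb)%:~R / q%:~R <=
      (class_time c1)%:~R * z + (class_time c2)%:~R * (j.2.1%:~R - z) :> R].
  exists (mk_candidate D j s' x y q xa xb).
    apply/all_candidatesP; exists j, s', x, y; split=> //; rewrite ?s1 //.
    by rewrite inE jJ orbT.
  have [/andP[_ h] _] := plan_cost_le hr xs ys lJ' w0 q0 xa0 xb0.
  have -> : (mk_candidate D j s' x y q xa xb).1 = (mk_candidate D j s x y q xa xb).1.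
    by rewrite /mk_candidate /= s1.
  apply: le_trans h _; rewrite plan_cost_cons -xE -yE.
  have [_ /approx_ge0 u0] := hA x xs.
  rewrite lerD ?lerD2l // ?ler_wpM2l ?ler0z // ?lerD2l //.
  by rewrite ler_wpM2r // xE.
have heR : (class_energy c2)%:~R < (class_energy c1)%:~R :> R by rewrite ltr_int.
have htR : (class_time c1)%:~R <= (class_time c2)%:~R :> R by rewrite ler_int.
have s2R : s'.2.1%:~R <= (\sum_(x <- l) item_energy x)%:~R :> R by rewrite ler_int -hen.
have [h1|h1] := lerP (class_energy c1 * j.2.1) (B - s'.2.1).
  exists 1, j.2.1, 0; split=> //; first by rewrite pair_candidate_whole // -xE.
  rewrite mulr0 addr0 divr1 rmorphM /=; nra.
have B'E : (class_energy c1)%:~R * z + (class_energy c2)%:~R * (j.2.1%:~R - z) <=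
    (B - s'.2.1)%:~R :> R.
  by rewrite rmorphB /=; lra.
have h2 : class_energy c2 * j.2.1 <= B - s'.2.1.
  by rewrite -(ler_int R); apply: le_trans B'E; rewrite rmorphM /=; nra.
have d0 : (0 : R) < (class_energy c1 - class_energy c2)%:~R by rewrite ltr0z subr_gt0.
exists (class_energy c1 - class_energy c2), (B - s'.2.1 - class_energy c2 * j.2.1),
  (class_energy c1 * j.2.1 - (B - s'.2.1)); split.
- rewrite /pair_candidate -xE -yE leNgt h1 /= leNgt he /= h2.
  by rewrite /mk_candidate -xE -yE.
- by rewrite subr_gt0.
- by rewrite subr_ge0.
- by rewrite subr_ge0 ltW.
rewrite ler_pdivrMr //; move: B'E d0; rewrite !(rmorphB, rmorphD, rmorphM) /=.
move: (B%:~R - s'.2.1%:~R : R) => B'.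
move: (class_energy c1)%:~R (class_energy c2)%:~R (class_time c1)%:~R (class_time c2)%:~R
  (j.2.1%:~R) heR htR zv z0 => e1 e2 t1 t2 v heR htR zv z0 B'E d0.
(* The second factor is the surplus of energy over the mixture given by [z]; the time saved by
   spending it is proportional to this product. *)
have : 0 <= (t2 - t1) * (B' - e1 * z - e2 * (v - z)).
  by apply: mulr_ge0; lra.
lra.
Qed.

End Plans.

Local Open Scope classical_set_scope.
Local Open Scope ring_scope.

(** * Step profiles *)

Section PowerAt.
Variables (R : realType) (kappa n : nat) (I : instance kappa n).
Local Notation pw := (@power_at R kappa n I).

Lemma power_atE (x : R) :
  pw x = \sum_(i < kappa) if x == ratr (speed I i) then ratr (power I i) else 0.
Proof. by rewrite /power_at big_mkcond. Qed.

Lemma measurable_power_at : measurable_fun [set: R] pw.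
Proof.
rewrite (_ : pw = fun x => \sum_(i < kappa) if x == ratr (speed I i) then ratr (power I i) else 0); last first.
  by apply/funext => x; exact: power_atE.
apply: measurable_sum => i.
apply: measurable_fun_ifT => //.
rewrite (_ : (fun t => t == _) = fun t => (t <= ratr (speed I i)) && (ratr (speed I i) <= t)).
  by apply: measurable_and; apply: measurable_fun_ler.
by apply/funext => t; exact: eq_le.
Qed.

Lemma power_at0 : pw 0 = 0.
Proof.
rewrite power_atE big1 // => i _; case: eqP => // h.
have : (0 : R) < ratr (speed I i) by rewrite ltr0q speed_gt0.
by rewrite -h ltxx.
Qed.

Lemma power_at_ge0 x : 0 <= pw x.
Proof. by apply: sumr_ge0 => i _; rewrite ler0q power_ge0. Qed.

Lemma power_at_speed i : pw (ratr (speed I i)) = ratr (power I i).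
Proof.
rewrite power_atE (bigD1 i) //= eqxx big1 ?addr0 // => j ji.
case: eqP => // /eqP; rewrite (inj_eq (@fmorph_inj _ _ ratr)) => /eqP h.
have [ij|ij|/val_inj E] := ltngtP i j.
- by have := speed_decr I ij; rewrite h ltxx.
- by have := speed_decr I ij; rewrite h ltxx.
- by rewrite E eqxx in ji.
Qed.

End PowerAt.

Section StepProfile.
Variable R : realType.
Local Notation mu := (@lebesgue_measure R).
Local Notation seg := ((int * int) * (int * int))%type.
Local Notation step := (@step_profile R).
Implicit Type segs : seq seg.

Lemma measurable_step_profile segs : measurable_fun [set: R] (step segs).
Proof.
elim: segs => [|[s d] segs IH] /=; first exact: measurable_cst.
apply: measurable_fun_ifT => //.
  exact: measurable_fun_ltr.
apply: (measurableT_comp IH).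
by apply: measurable_funB.
Qed.

(** A general [g] serves both for energy and for work; [g 0 = 0] makes the idle tail vanish. The
    offset [a] is needed for the induction, in which the remaining segments start later. *)
Lemma integral_step_profile (g : R -> R) segs a :
  measurable_fun setT g -> (forall x, 0 <= g x) -> g 0 = 0 ->
  (forall sd, sd \in segs -> 0 <= frac_val R sd.2) ->
  (\int[mu]_(t in `[a, +oo[) (g (step segs (t - a)))%:E =
   (\sum_(sd <- segs) frac_val R sd.2 * g (frac_val R sd.1))%:E)%E.
Proof.
move=> mg g0 g00; elim: segs a => [|[s d] segs IH] a hd.
  rewrite big_nil -[RHS](integral0 mu `[a, +oo[).
  by apply: eq_integral => t _; rewrite /= g00.
have d0 : 0 <= frac_val R d by exact: (hd (s, d) (mem_head _ _)).
pose f t := (g (step ((s, d) :: segs) (t - a)))%:E.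
have mf A : measurable_fun A f.
  apply: (@measurable_funS _ _ _ _ setT) => //; apply/measurable_EFinP.
  apply: (measurableT_comp mg); apply: (measurableT_comp (measurable_step_profile _)).
  exact: measurable_funB.
have -> : `[a, +oo[%classic = `[a, a + frac_val R d[ `|` `[a + frac_val R d, +oo[ :> set R.
  apply/seteqP; split=> t /=; rewrite !in_itv /= !andbT.
    by move=> at_; case: (ltP t (a + frac_val R d)) => h; [left|right]; rewrite // at_.
  by case=> [/andP[]//|]; apply: le_trans; rewrite lerDl.
rewrite ge0_integral_setU //=; last 2 first.
- by move=> t _; rewrite lee_fin.
- apply/disj_setPS => t /=; rewrite !in_itv /= !andbT => -[/andP[_ h1] h2].
  by move: h1; rewrite ltNge h2.
rewrite big_cons EFinD; congr (_ + _)%E.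
- transitivity (\int[mu]_(t in `[a, (a + frac_val R d)%R[) (cst (g (frac_val R s))%:E t))%E.
    apply: eq_integral => t; rewrite inE /= in_itv /= => /andP[h1 h2].
    by rewrite ltrBlDl h2.
  rewrite integral_cst //= lebesgue_measure_itv /= lte_fin.
  case: ifPn => [_|]; last first.
    rewrite ltrDl -leNgt => d0'; have -> : frac_val R d = 0 by apply/le_anti/andP.
    by rewrite mul0r mule0.
  by rewrite -EFinB addrC addKr -EFinM mulrC.
- rewrite -(IH (a + frac_val R d)); last by move=> sd h; apply: hd; rewrite inE h orbT.
  apply: eq_integral => t; rewrite inE /= in_itv /= andbT => h.
  by rewrite ltrBlDl ltNge h /= opprD addrA.
exact: mf.
Qed.

Definition total_time segs : R := \sum_(sd <- segs) frac_val R sd.2.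

Lemma step_profile_ge segs T : (forall sd, sd \in segs -> 0 <= frac_val R sd.2) ->
  total_time segs <= T -> step segs T = 0.
Proof.
elim: segs T => //= -[s d] segs IH T hd; rewrite /total_time big_cons /= => h.
have h0 : 0 <= total_time segs.
  by rewrite /total_time big_seq; apply: sumr_ge0 => sd h'; apply: hd; rewrite inE h' orbT.
rewrite ltNge (le_trans _ h) /= ?lerDl //.
by apply: IH => [sd h'|]; [apply: hd; rewrite inE h' orbT|rewrite lerBrDl].
Qed.

Lemma step_profile_cat segs1 segs2 t : 0 <= t < total_time segs1 ->
  step (segs1 ++ segs2) t = step segs1 t.
Proof.
elim: segs1 t => [|[s d] segs1 IH] t; rewrite /total_time ?big_nil ?big_cons /=.
  by rewrite ltNge => /andP[->].
move=> /andP[t0 h]; case: ifPn => //; rewrite -leNgt => td.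
by apply: IH; rewrite subr_ge0 td ltrBlDl.
Qed.

Lemma step_profile_ge0 segs t : (forall sd, sd \in segs -> 0 <= frac_val R sd.1) ->
  0 <= step segs t.
Proof.
elim: segs t => //= -[s d] segs IH t hd.
case: ifP => _; first exact: (hd (s, d) (mem_head _ _)).
by apply: IH => sd h; apply: hd; rewrite inE h orbT.
Qed.

(** The inequality suffices, since reaching the volume at some time already bounds the completion
    time. The closed interval includes the end point, where the profile may already belong to
    [segs2]. *)
Lemma work_step_profile segs1 segs2 :
  (forall sd, sd \in segs1 ++ segs2 -> 0 <= frac_val R sd.1 /\ 0 <= frac_val R sd.2) ->
  ((\sum_(sd <- segs1) frac_val R sd.2 * frac_val R sd.1)%:E <=
   \int[mu]_(t in `[0%R, total_time segs1]) (step (segs1 ++ segs2) t)%:E)%E.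
Proof.
move=> hd; set T := total_time segs1.
have hd1 sd : sd \in segs1 -> 0 <= frac_val R sd.1 /\ 0 <= frac_val R sd.2.
  by move=> h; apply: hd; rewrite mem_cat h.
have T0 : 0 <= T.
  by rewrite /T /total_time big_seq; apply: sumr_ge0 => sd /hd1[].
have ms segs A : measurable_fun A (fun t : R => (step segs t)%:E).
  apply: (@measurable_funS _ _ _ _ setT) => //; apply/measurable_EFinP.
  exact: measurable_step_profile.
have s0 t : 0 <= step segs1 t by apply: step_profile_ge0 => sd /hd1[].
apply: (@le_trans _ _ (\int[mu]_(t in `[0%R, T]) (step segs1 t)%:E)%E); last first.
  apply: ge0_le_integral => //=.
  - by move=> t _; rewrite lee_fin.
  - by apply: ms.
  - by apply: ms.
  - move=> t /=; rewrite in_itv /= lee_fin => /andP[t0]; rewrite le_eqVlt => /orP[/eqP ->|tT].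
      rewrite [leLHS]step_profile_ge //; last by move=> sd /hd1[].
      by apply: step_profile_ge0 => sd /hd[].
    by rewrite step_profile_cat ?t0.
(* The integral formula requires a function that is nonnegative everywhere, so the identity is
   replaced by its positive part. *)
pose g (x : R) := Order.max x 0.
have mg : measurable_fun [set: R] g by apply: measurable_maxr.
have -> : ((\sum_(sd <- segs1) frac_val R sd.2 * frac_val R sd.1)%:E =
   \int[mu]_(t in `[0%R, +oo[) (g (step segs1 (t - 0)))%:E)%E.
  rewrite integral_step_profile // => [|x||sd /hd1[]//].
  - congr EFin; rewrite [LHS]big_seq [RHS]big_seq; apply: eq_bigr => sd /hd1[h _].
    by rewrite /g max_l.
  - by rewrite /g le_max lexx orbT.
  - by rewrite /g maxxx.
have -> : `[0%R, +oo[%classic = `[0%R, T] `|` `]T, +oo[ :> set R.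
  apply/seteqP; split=> t /=; rewrite !in_itv /= !andbT.
    by move=> t0; case: (leP t T) => h; [left|right]; rewrite // t0.
  by case=> [/andP[]//|/ltW]; exact: le_trans.
have gE t : g (step segs1 (t - 0)) = step segs1 t by rewrite subr0 /g max_l.
under eq_integral do rewrite gE.
rewrite ge0_integral_setU //=.
- rewrite [X in (_ + X)%E]integral0_eq ?adde0 //.
  move=> t /=; rewrite in_itv /= andbT => /ltW h.
  by rewrite step_profile_ge // => sd /hd1[].
- by apply: ms.
- by move=> t _; rewrite lee_fin.
- apply/disj_setPS => t /=; rewrite !in_itv /= !andbT => -[/andP[_ h1] h2].
  by move: h1; rewrite leNgt h2.
Qed.

End StepProfile.

Lemma take_enum_ord n (m : 'I_n) : take m.+1 (enum 'I_n) = [seq k : 'I_n <- enum 'I_n | (k <= m)%N].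
Proof.
apply: (inj_map val_inj); rewrite map_take val_enum_ord.
have <- := @filter_map _ _ (val : 'I_n -> nat) (fun i => i < m.+1)%N (enum 'I_n).
rewrite val_enum_ord take_iota (minn_idPl (ltn_ord m)).
by have /= -> := @filter_iota_ltn 0 n m.+1 (ltn_ord m).
Qed.

Lemma big_take_enum_ord (R : realType) n (m : 'I_n) (F : 'I_n -> R) :
  \sum_(k <- take m.+1 (enum 'I_n)) F k = \sum_(k < n | (k <= m)%N) F k.
Proof. by rewrite take_enum_ord big_filter big_enum_cond. Qed.

Section UpperBound.
Variables (R : realType) (kappa n : nat) (I : instance kappa n).
Variables (o : {perm 'I_n}) (sg : 'I_n -> seq ((int * int) * (int * int))).
Local Notation segs := (flatten [seq sg (o k) | k <- enum 'I_n]).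
Local Notation S := (Solution o (@step_profile R segs)).
Hypothesis sg_valid : forall j sd, sd \in sg j ->
  0 <= frac_val R sd.2 /\ exists i, frac_val R sd.1 = ratr (speed I i).
Hypothesis sg_volume : forall j,
  \sum_(sd <- sg j) frac_val R sd.2 * frac_val R sd.1 = ratr (volume I j).
Hypothesis sg_energy : \sum_j \sum_(sd <- sg j) frac_val R sd.2 * @power_at R _ _ I (frac_val R sd.1)
  <= ratr (budget I).

Lemma segs_valid sd : sd \in segs -> 0 <= frac_val R sd.1 /\ 0 <= frac_val R sd.2.
Proof.
move=> /flattenP[l /mapP[k _ ->]] /sg_valid[h [i ->]]; split=> //.
by rewrite ler0q ltW // speed_gt0.
Qed.

Lemma work_prefix (j : 'I_n) :
  ((prefix_volume I S j)%:E <=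
   work S (\sum_(k < n | ((o^-1)%g k <= (o^-1)%g j)%N) total_time R (sg k)))%E.
Proof.
pose m := (o^-1)%g j.
pose segs1 := flatten [seq sg (o k) | k <- take m.+1 (enum 'I_n)].
pose segs2 := flatten [seq sg (o k) | k <- drop m.+1 (enum 'I_n)].
have segsE : segs = segs1 ++ segs2 by rewrite -flatten_cat -map_cat cat_take_drop.
have sumE (F : ((int * int) * (int * int)) -> R) : \sum_(sd <- segs1) F sd =
    \sum_(k < n | (k <= m)%N) \sum_(sd <- sg (o k)) F sd.
  by rewrite /segs1 big_flatten /= big_map big_take_enum_ord.
have tE : \sum_(k < n | ((o^-1)%g k <= m)%N) total_time R (sg k) = total_time R segs1.
  rewrite [RHS]sumE (reindex_inj (@perm_inj _ o)) /=.
  by apply: eq_bigl => k; rewrite permK.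
have vE : prefix_volume I S j = \sum_(sd <- segs1) frac_val R sd.2 * frac_val R sd.1.
  by rewrite sumE; apply: eq_bigr => k _; rewrite sg_volume.
rewrite -/m tE vE /work /= segsE; apply: work_step_profile => sd.
by rewrite -segsE; exact: segs_valid.
Qed.

Lemma output_feasible : feasible I S.
Proof.
split=> /=.
- apply: (@measurable_funS _ _ _ _ setT) => //; exact: measurable_step_profile.
- move=> t _; have : forall sd, sd \in segs -> exists i, frac_val R sd.1 = ratr (speed I i).
    by move=> sd /flattenP[l /mapP[k _ ->]] /sg_valid[].
  elim: segs t => [|[s d] l IH] t h; first by left.
  rewrite /=; case: ifP => _; first by right; exact: (h (s, d) (mem_head _ _)).
  by apply: IH => sd sdl; apply: h; rewrite inE sdl orbT.
- exists (total_time R segs); split.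
    by rewrite /total_time big_seq; apply: sumr_ge0 => sd /segs_valid[].
  rewrite /work /=; have := @work_step_profile R segs [::]; rewrite cats0.
  move=> /(_ segs_valid); apply: le_trans; rewrite lee_fin.
  rewrite big_flatten /= big_map big_enum /= (reindex_inj (@perm_inj _ o)) /=.
  by apply: ler_sum => k _; rewrite sg_volume.
- rewrite /energy /=.
  have := @integral_step_profile R (@power_at R _ _ I) segs 0 (@measurable_power_at R _ _ I)
    (@power_at_ge0 R _ _ I) (@power_at0 R _ _ I) (fun sd h => (segs_valid h).2).
  under eq_integral do rewrite subr0.
  move=> ->; rewrite lee_fin big_flatten /= big_map big_enum /=.
  by apply: le_trans sg_energy; rewrite [leRHS](reindex_inj (@perm_inj _ o)).
Qed.

Lemma output_cost : cost I S <=
  \sum_j ratr (weight I j) * \sum_(k < n | ((o^-1)%g k <= (o^-1)%g j)%N) total_time R (sg k).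
Proof.
apply: ler_sum => j _; apply: ler_wpM2l; first by rewrite ler0q weight_ge0.
apply: ge_inf; first by exists 0 => t [].
split; last exact: work_prefix.
apply: sumr_ge0 => k _; rewrite /total_time big_seq; apply: sumr_ge0 => sd h.
by case: (sg_valid h).
Qed.

End UpperBound.

(** * Lower bound on the cost of a schedule *)

Section LowerBound.
Variables (R : realType) (kappa n : nat) (I : instance kappa n) (S : solution R n).
Local Notation mu := (@lebesgue_measure R).
Local Notation f := (profile S).
Local Notation pw := (@power_at R _ _ I).
Hypothesis S_feasible : feasible I S.

Let sub_half t : `[0%R, t]%classic `<=` (`[0%R, +oo[%classic : set R).
Proof. by move=> x /=; rewrite !in_itv /= andbT => /andP[]. Qed.

Let measurable_f t : measurable_fun (`[0%R, t] : set R) f.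
Proof. by case: S_feasible => mf _ _ _; apply: measurable_funS mf => //; exact: sub_half. Qed.

Lemma profile_ge0 t : 0 <= t -> 0 <= f t.
Proof.
case: S_feasible => _ h _ _ /h[->//|[i ->]].
by rewrite ler0q ltW // speed_gt0.
Qed.

Lemma profile_le t : 0 <= t -> f t <= \sum_i ratr (speed I i).
Proof.
have h0 (i : 'I_kappa) : (0 : R) <= ratr (speed I i) by rewrite ler0q ltW // speed_gt0.
case: S_feasible => _ h _ _ /h[->|[i ->]]; first exact: sumr_ge0.
by rewrite (bigD1 i) //= lerDl sumr_ge0.
Qed.

Definition real_work t : R := fine (work S t).
Definition real_energy t : R := fine (\int[mu]_(x in `[0%R, t]) (pw (f x))%:E)%E.

Let lebesgue_itv t : 0 <= t -> mu `[0%R, t] = t%:E.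
Proof.
move=> t0; rewrite lebesgue_measure_itv /= lte_fin.
case: ltP => [_|h]; first by rewrite oppr0 adde0.
by congr EFin; apply/le_anti/andP.
Qed.

Let work_ge0 t : (0 <= work S t)%E.
Proof.
apply: integral_ge0 => x /=; rewrite in_itv /= => /andP[x0 _].
by rewrite lee_fin profile_ge0.
Qed.

Lemma workE t : 0 <= t -> work S t = (real_work t)%:E.
Proof.
move=> t0; rewrite /real_work fineK // ge0_fin_numE //.
apply: (@le_lt_trans _ _ (\int[mu]_(x in `[0%R, t]) (cst (\sum_i ratr (speed I i))%:E x))%E).
  apply: ge0_le_integral => //=.
  - by move=> x; rewrite /= in_itv /= => /andP[x0 _]; rewrite lee_fin profile_ge0.
  - by apply/measurable_EFinP; exact: measurable_f.
  - by move=> x; rewrite /= in_itv /= => /andP[x0 _]; rewrite lee_fin profile_le.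
by rewrite integral_cst //= lebesgue_itv // -EFinM ltry.
Qed.

Let measurable_pw A : measurable_fun A f -> measurable_fun A (fun x => (pw (f x))%:E).
Proof.
move=> mf; apply/measurable_EFinP.
exact: (measurableT_comp (@measurable_power_at R _ _ I) mf).
Qed.

Let energy_t_le t : (\int[mu]_(x in `[0%R, t]) (pw (f x))%:E <= (ratr (budget I))%:E)%E.
Proof.
case: S_feasible => mf _ _; apply: le_trans.
apply: ge0_subset_integral => //.
  exact: measurable_pw.
by move=> x _; rewrite lee_fin power_at_ge0.
Qed.

Lemma energyE t : (\int[mu]_(x in `[0%R, t]) (pw (f x))%:E = (real_energy t)%:E)%E.
Proof.
rewrite /real_energy fineK // ge0_fin_numE.
  by apply: le_lt_trans (energy_t_le t) _; rewrite ltry.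
by apply: integral_ge0 => x _; rewrite lee_fin power_at_ge0.
Qed.

Lemma real_energy_le t : real_energy t <= ratr (budget I).
Proof. by rewrite -lee_fin -energyE; exact: energy_t_le. Qed.

Lemma real_work_le u t : 0 <= u <= t -> real_work u <= real_work t.
Proof.
move=> /andP[u0 ut]; rewrite -lee_fin -!workE //; last exact: le_trans ut.
apply: ge0_subset_integral => //=.
- by apply/measurable_EFinP; exact: measurable_f.
- by move=> x; rewrite /= in_itv /= => /andP[x0 _]; rewrite lee_fin profile_ge0.
- by move=> x /=; rewrite !in_itv /= => /andP[-> /le_trans]; apply.
Qed.

(** Pointwise [c * f <= W + lambda * P(f)]: by hypothesis at each speed, and trivially when idle.
    The difference [g] is nonnegative, so its integral from 0 is monotone in the end point. *)
Lemma tradeoff (lambda W c u t : R) : 0 <= lambda -> 0 <= W -> 0 <= c ->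
  (forall i, ratr (speed I i) * c <= W + lambda * ratr (power I i)) ->
  0 <= u <= t ->
  c * (real_work t - real_work u) <=
  W * (t - u) + lambda * (real_energy t - real_energy u).
Proof.
move=> l0 W0 c0 hc /andP[u0 ut].
pose g x := W + lambda * pw (f x) - c * f x.
pose G t := (\int[mu]_(x in `[0%R, t]) (g x)%:E)%E.
have g_ge0 x : 0 <= x -> 0 <= g x.
  move=> x0; rewrite /g subr_ge0; case: S_feasible => _ /(_ _ x0) + _ _.
  case=> [->|[i ->]]; first by rewrite mulr0 power_at0 mulr0 addr0.
  by rewrite power_at_speed mulrC.
have mpf s : measurable_fun (`[0%R, s] : set R) (fun x => lambda * pw (f x)).
  apply: measurable_funM; first exact: measurable_cst.
  by apply: (measurableT_comp (@measurable_power_at R _ _ I)); exact: measurable_f.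
have mcf s : measurable_fun (`[0%R, s] : set R) (fun x => c * f x).
  by apply: measurable_funM; [exact: measurable_cst|exact: measurable_f].
have mg s : measurable_fun (`[0%R, s] : set R) g.
  apply: measurable_funB; last exact: mcf.
  by apply: measurable_funD; [exact: measurable_cst|exact: mpf].
(* Stated as an identity between sums of nonnegative integrals, which can be added and scaled in the
   extended reals without integrability conditions. *)
have G_id s : 0 <= s -> (G s + (c * real_work s)%:E = (W * s + lambda * real_energy s)%:E)%E.
  move=> s0; have h0 x : `[0%R, s]%classic x -> 0 <= x by rewrite /= in_itv /= => /andP[].
  have -> : (c * real_work s)%:E = (\int[mu]_(x in `[0%R, s]) (c * f x)%:E)%E.
    rewrite EFinM -workE //; under [RHS]eq_integral do rewrite EFinM.
    rewrite ge0_integralZl //=; first by apply/measurable_EFinP; exact: measurable_f.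
    by move=> x /h0 x0; rewrite lee_fin profile_ge0.
  rewrite /G -ge0_integralD //=; last 4 first.
  - by move=> x /h0 x0; rewrite lee_fin g_ge0.
  - by apply/measurable_EFinP; exact: mg.
  - by move=> x /h0 x0; rewrite lee_fin mulr_ge0 ?profile_ge0.
  - by apply/measurable_EFinP; exact: mcf.
  transitivity (\int[mu]_(x in `[0%R, s]) (cst W%:E x + (lambda * pw (f x))%:E))%E.
    by apply: eq_integral => x _; rewrite -EFinD /g subrK.
  rewrite ge0_integralD //=; last 2 first.
  - by move=> x _; rewrite lee_fin mulr_ge0 ?power_at_ge0.
  - by apply/measurable_EFinP; exact: mpf.
  rewrite integral_cst //= lebesgue_itv // EFinD; congr (_ + _)%E.
  rewrite EFinM -energyE; under eq_integral do rewrite EFinM.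
  rewrite ge0_integralZl //=; first by apply: measurable_pw; exact: measurable_f.
  by move=> x _; rewrite lee_fin power_at_ge0.
have t0 : 0 <= t by exact: le_trans ut.
have GE s : 0 <= s -> G s = (W * s + lambda * real_energy s - c * real_work s)%:E.
  by move=> s0; rewrite EFinB -G_id // addeK.
have : (G u <= G t)%E.
  apply: ge0_subset_integral => //=.
  - by apply/measurable_EFinP; exact: mg.
  - by move=> x; rewrite /= in_itv /= => /andP[x0 _]; rewrite lee_fin g_ge0.
  - by move=> x /=; rewrite !in_itv /= => /andP[-> /le_trans]; apply.
by rewrite !GE // lee_fin; lra.
Qed.

End LowerBound.

(** * Summation by parts over the completion times *)

Section Abel.
Variables (R : realFieldType) (T : eqType) (w v t : T -> R) (wk en phi : R -> R).
Variables (lambda E : R).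
Hypothesis lambda_ge0 : 0 <= lambda.
Hypothesis w_ge0 : forall j, 0 <= w j.
Hypothesis phi_ge0 : forall W, 0 <= W -> 0 <= phi W.
Hypothesis phi_mono : forall W W', 0 <= W -> W <= W' -> phi W <= phi W'.
Hypothesis en_le : forall x, en x <= E.
Hypothesis tradeoff : forall W x y, 0 <= W -> 0 <= x <= y ->
  phi W * (wk y - wk x) <= W * (y - x) + lambda * (en y - en x).

Fixpoint schedule (l : seq T) (u p : R) : Prop :=
  if l is j :: l' then [/\ u <= t j, p + v j <= wk (t j) & schedule l' (t j) (p + v j)]
  else True.

Fixpoint suffix_bound (l : seq T) : R :=
  if l is j :: l' then v j * phi (\sum_(k <- l) w k) + suffix_bound l' else 0.

(** [phi W] is a lower bound for the price of a unit of work while weight [W] is waiting. Work done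
    by time [u] beyond the required [p] is a credit, kept in the last term; it is carried to later
    jobs, whose waiting weight and hence price are no larger. *)
Lemma schedule_bound l u p : 0 <= u -> p <= wk u -> schedule l u p ->
  suffix_bound l <= \sum_(j <- l) w j * (t j - u) + lambda * (E - en u)
                    + phi (\sum_(j <- l) w j) * (wk u - p).
Proof.
elim: l u p => [|j l IH] u p u0 pu.
  rewrite !big_nil /= => _; have := phi_ge0 (lexx 0); have := en_le u => h1 h2.
  by rewrite add0r addr_ge0 ?mulr_ge0 ?subr_ge0.
move=> [ut pj hl]; have t0 : 0 <= t j by exact: le_trans ut.
have := IH _ _ t0 pj hl.
have W0 : 0 <= \sum_(k <- l) w k by exact: sumr_ge0.
have W1 : 0 <= \sum_(k <- j :: l) w k by exact: sumr_ge0.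
have Wle : \sum_(k <- l) w k <= \sum_(k <- j :: l) w k by rewrite big_cons lerDr.
have hut : 0 <= u <= t j by rewrite u0 ut.
have := tradeoff W1 hut; have phile := phi_mono W0 Wle.
rewrite [suffix_bound (j :: l)]/=; move: phile.
have -> : \sum_(k <- j :: l) w k * (t k - u) =
    \sum_(k <- l) w k * (t k - t j) + (\sum_(k <- j :: l) w k) * (t j - u).
  rewrite !big_cons [in RHS]mulrDl addrCA; congr (_ + _).
  by rewrite mulr_suml -big_split; apply: eq_bigr => k _ /=; ring.
move: (\sum_(k <- j :: l) w k) (\sum_(k <- l) w k) (suffix_bound l) => W W' sb.
move: (\sum_(k <- l) w k * (t k - t j)) => X h1 h2 h3.
have h4 : phi W' * (wk (t j) - (p + v j)) <= phi W * (wk (t j) - (p + v j)).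
  by rewrite ler_wpM2r // subr_ge0.
nra.
Qed.

Lemma schedule_intro l u p : path <=%R u (map t l) ->
  (forall l1 j l2, l = l1 ++ j :: l2 -> p + \sum_(k <- l1) v k + v j <= wk (t j)) ->
  schedule l u p.
Proof.
elim: l u p => //= j l IH u p /andP[ut pl] h; split=> //.
  by have := h [::] j l erefl; rewrite big_nil addr0.
apply: IH => // l1 k l2 lE; have := h (j :: l1) k l2; rewrite lE big_cons addrA.
exact.
Qed.

Lemma suffix_boundE l : uniq l ->
  suffix_bound l = \sum_(j <- l) v j * phi (\sum_(k <- l | (index j l <= index k l)%N) w k).
Proof.
elim: l => [|j l IH]; first by rewrite big_nil.
rewrite cons_uniq => /andP[jl ul]; rewrite big_cons [LHS]/= IH //.
congr (v j * phi _ + _).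
  by apply: eq_bigl => k; rewrite /= eqxx.
rewrite !big_seq; apply: eq_bigr => k kl; congr (v k * phi _).
have kj : (j == k) = false by apply: contraNF jl => /eqP ->.
rewrite big_cons /= kj eqxx ltn0 /= [LHS]big_seq_cond [RHS]big_seq_cond.
apply: eq_bigl => i; case il: (i \in l) => //=.
have -> : (j == i) = false by apply: contraNF jl => /eqP ->.
by rewrite ltnS.
Qed.

End Abel.

Section LowerBound.
Variables (R : realType) (kappa n : nat) (I : instance kappa n) (S : solution R n).
Hypothesis S_feasible : feasible I S.
Variables (lambda : R) (phi : R -> R).
Hypothesis lambda_ge0 : 0 <= lambda.
Hypothesis phi_ge0 : forall W, 0 <= W -> 0 <= phi W.
Hypothesis phi_mono : forall W W', 0 <= W -> W <= W' -> phi W <= phi W'.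
Hypothesis phi_le : forall W i, 0 <= W ->
  ratr (speed I i) * phi W <= W + lambda * ratr (power I i).

Local Notation w j := (ratr (weight I j) : R).
Local Notation v j := (ratr (volume I j) : R).
Local Notation o := (job_order S).
Local Notation pos j := ((o^-1)%g j).
Local Notation C := (completion_time I S).

Let w_ge0 j : 0 <= w j. Proof. by rewrite ler0q weight_ge0. Qed.
Let v_ge0 j : 0 <= v j. Proof. by rewrite ler0q volume_ge0. Qed.

Let finish j := [set t : R | 0 <= t /\ ((prefix_volume I S j)%:E <= work S t)%E].

Let finish_neq0 j : finish j !=set0.
Proof.
case: S_feasible => _ _ [t [t0 ht]] _; exists t; split=> //.
apply: le_trans ht; rewrite lee_fin /prefix_volume.
rewrite [leRHS](reindex_inj (@perm_inj _ o)) /=.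
by rewrite [leRHS](bigID (fun k : 'I_n => (k <= pos j)%N)) /= lerDl sumr_ge0.
Qed.

Let finish_lbound j : has_lbound (finish j).
Proof. by exists 0 => t []. Qed.

Lemma completion_time_ge0 j : 0 <= C j.
Proof. by apply: lb_le_inf => [|t []//]; exact: finish_neq0. Qed.

Lemma completion_time_mono j k : (pos j <= pos k)%N -> C j <= C k.
Proof.
move=> jk; apply: lb_le_inf => [|t [t0 ht]]; first exact: finish_neq0.
apply: ge_inf; first exact: finish_lbound.
split=> //.
apply: le_trans ht; rewrite lee_fin /prefix_volume.
rewrite [leRHS](bigID (fun i : 'I_n => (i <= pos j)%N)) /=.
rewrite [X in _ <= X + _](eq_bigl (fun i : 'I_n => (i <= pos j)%N)); first by rewrite lerDl sumr_ge0.
move=> i; case: (leqP i (pos j)) => ij; last by rewrite andbF.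
by rewrite (leq_trans ij jk).
Qed.

Lemma work_completion_time j d : 0 < d -> prefix_volume I S j <= real_work S (C j + d).
Proof.
move=> d0; have [|t [t0 ht] td] := @inf_adherent R (finish j) d d0; first by split; [exact: finish_neq0|exact: finish_lbound].
rewrite -lee_fin (le_trans ht) // (workE S_feasible) // lee_fin.
apply: (real_work_le S_feasible).
by rewrite t0 ltW.
Qed.

(** Completion times are infima, and the work is known to reach the prefix volume only after a
    positive delay [d]. The delay raises the weighted cost by at most [e], which is arbitrary; the
    [+ 1] in the denominator covers total weight 0. *)
Theorem lower_bound :
  \sum_j v j * phi (\sum_(k | (pos j <= pos k)%N) w k) <= cost I S + lambda * ratr (budget I).
Proof.
apply/ler_addgt0Pr => e e0.
pose W := \sum_j w j; have W0 : 0 <= W by exact: sumr_ge0.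
pose d := e / (W + 1); have d0 : 0 < d by rewrite divr_gt0 // ltr_wpDl.
pose t j := C j + d.
pose l := [seq o k | k <- enum 'I_n].
have l_uniq : uniq l by rewrite map_inj_uniq ?enum_uniq //; exact: perm_inj.
have index_l k : index k l = pos k.
  by rewrite -{1}(permKV o k) index_map ?index_enum_ord //; exact: perm_inj.
have sum_l (F : 'I_n -> R) (P : pred 'I_n) : \sum_(k <- l | P k) F k = \sum_(k | P k) F k.
  rewrite big_map big_enum_cond [RHS](reindex_inj (@perm_inj _ o)).
  by [].
have t_sorted : path <=%R 0 (map t l).
  rewrite (path_sortedE le_trans); apply/andP; split.
    by apply/allP => _ /mapP[k _ ->]; rewrite addr_ge0 ?completion_time_ge0 // ltW.
  rewrite -map_comp sorted_map.
  apply: (@sub_sorted _ (relpre val leq)); last by rewrite -sorted_map val_enum_ord iota_sorted.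
  by move=> i k /= ik; rewrite lerD2r completion_time_mono // !permK.
have hsch : schedule (fun j => v j) t (real_work S) l 0 0.
  apply: schedule_intro => // l1 j l2 lE; rewrite add0r.
  apply: le_trans (work_completion_time j d0); rewrite le_eqVlt; apply/orP; left; apply/eqP.
  have jl1 : j \notin l1.
    by move: l_uniq; rewrite lE cat_uniq => /and3P[_ /hasPn h _]; apply: (h j); exact: mem_head.
  have sz : size l1 = pos j by rewrite -index_l lE index_cat (negbTE jl1) /= eqxx addn0.
  rewrite /prefix_volume -big_take_enum_ord -(big_map o xpredT (fun k => v k)) map_take -/l lE.
  by rewrite -sz take_cat ltnNge leqnSn /= subSnn /= take0 big_cat /= big_seq1.
have htr W' x y : 0 <= W' -> 0 <= x <= y -> phi W' * (real_work S y - real_work S x) <=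
    W' * (y - x) + lambda * (real_energy I S y - real_energy I S x).
  by move=> W0' xy; apply: tradeoff => // [|i]; [exact: phi_ge0|exact: phi_le].
have work0 : real_work S 0 = 0 by rewrite /real_work /work set_itv1 integral_set1.
have work0_le : 0 <= real_work S 0 by rewrite work0.
have := schedule_bound lambda_ge0 w_ge0 phi_ge0 phi_mono (real_energy_le S_feasible)
  htr (lexx 0) work0_le hsch.
rewrite suffix_boundE // sum_l.
under eq_bigr do rewrite sum_l.
under eq_bigr do under eq_bigl do rewrite !index_l.
move=> /le_trans; apply.
rewrite work0 subr0 mulr0 addr0.
have en0 : 0 <= real_energy I S 0.
  by apply: fine_ge0; apply: integral_ge0 => x _; rewrite lee_fin power_at_ge0.
have -> : \sum_(j <- l) w j * (t j - 0) = cost I S + W * d.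
  rewrite sum_l /cost /W mulr_suml -big_split; apply: eq_bigr => j _ /=.
  by rewrite subr0 mulrDr.
have Wd : W * d <= e.
  have W1 : 0 < W + 1 by rewrite ltr_wpDl.
  by rewrite /d mulrA ler_pdivrMr // mulrC ler_pM2l // lerDl.
have : lambda * (ratr (budget I) - real_energy I S 0) <= lambda * ratr (budget I).
  by rewrite ler_wpM2l // gerBl.
lra.
Qed.

End LowerBound.

(** * Structure of optimal schedules *)

Section Structure.
Variables (R : realType) (kappa n : nat) (I : instance kappa n) (S : solution R n).
Hypothesis S_feasible : feasible I S.

Local Notation w j := (ratr (weight I j) : R).
Local Notation v j := (ratr (volume I j) : R).
Local Notation s i := (ratr (speed I i) : R).
Local Notation P i := (ratr (power I i) : R).
Local Notation E := (ratr (budget I) : R).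
Local Notation r i := (s i)^-1.
Local Notation e i := (P i / s i).
Local Notation pos j := (((job_order S)^-1)%g j).

Let w_ge0 j : 0 <= w j. Proof. by rewrite ler0q weight_ge0. Qed.
Let v_ge0 j : 0 <= v j. Proof. by rewrite ler0q volume_ge0. Qed.
Let s_gt0 i : 0 < s i. Proof. by rewrite ltr0q speed_gt0. Qed.
Let r_gt0 i : 0 < r i. Proof. by rewrite invr_gt0. Qed.
Let e_ge0 i : 0 <= e i. Proof. by apply: divr_ge0; [rewrite ler0q power_ge0|exact: ltW]. Qed.

Definition weight_from j : R := \sum_(k | (pos j <= pos k)%N) w k.

(* Jobs of weight 0 are treated as if they were scheduled last. *)
Definition remaining j : R := if w j == 0 then 0 else weight_from j.

Let weight_from_ge0 j : 0 <= weight_from j. Proof. exact: sumr_ge0. Qed.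

Lemma remaining_ge0 j : 0 <= remaining j.
Proof. by rewrite /remaining; case: ifP. Qed.

Lemma remaining_le j : remaining j <= weight_from j.
Proof. by rewrite /remaining; case: ifP. Qed.

Lemma remaining_gt0 j : 0 < w j -> 0 < remaining j.
Proof.
move=> wj; rewrite /remaining gt_eqF // /weight_from (bigD1 j) //=.
by rewrite ltr_wpDr // sumr_ge0.
Qed.

Lemma remaining_lt x y : 0 < w x -> (pos x < pos y)%N -> remaining y < remaining x.
Proof.
move=> wx xy; apply: le_lt_trans (remaining_le y) _.
rewrite /remaining gt_eqF // /weight_from [ltRHS](bigD1 x) //=.
apply: (@le_lt_trans _ _ (\sum_(k | (pos x <= pos k)%N && (k != x)) w k)); last by rewrite ltrDr.
rewrite [leRHS](bigID (fun k : 'I_n => (pos y <= pos k)%N)) /=.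
rewrite [X in _ <= X + _](eq_bigl (fun k : 'I_n => (pos y <= pos k)%N)).
  by rewrite lerDl sumr_ge0.
move=> k; case: (leqP (pos y) (pos k)) => yk; last by rewrite andbF.
rewrite andbT (leq_trans (ltnW xy) yk) /=.
by apply: contraTneq yk => ->; rewrite -ltnNge.
Qed.

Section Dual.
Variables (i0 : 'I_kappa) (lambda : R).
Hypothesis lambda_ge0 : 0 <= lambda.

Let phi W := W * r [arg min_(i < i0) (W * r i + lambda * e i)]%O
             + lambda * e [arg min_(i < i0) (W * r i + lambda * e i)]%O.

Let phi_min W k : phi W <= W * r k + lambda * e k.
Proof. by rewrite /phi; case: arg_minP => // i _ h; exact: h. Qed.

(** Here [phi W] is the least Lagrangian cost of a unit of work. As a minimum of functions
    increasing in [W] it is monotone, which permits replacing the true waiting weight by the smaller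
    [remaining]. *)
Lemma dual_bound (sigma : 'I_n -> 'I_kappa) :
  (forall j, cheapest (fun i => r i) (fun i => e i) lambda (remaining j) (sigma j)) ->
  \sum_j v j * (remaining j * r (sigma j) + lambda * e (sigma j)) <= cost I S + lambda * E.
Proof.
move=> hsig.
have phi_ge0 W : 0 <= W -> 0 <= phi W.
  by move=> W0; rewrite /phi addr_ge0 // mulr_ge0 // ltW.
have phi_mono W W' : 0 <= W -> W <= W' -> phi W <= phi W'.
  move=> W0 WW'; rewrite {2}/phi; set i := [arg min_(_ < _) _]%O.
  by apply: le_trans (phi_min W i) _; rewrite lerD2r ler_wpM2r // ltW.
have phi_le W i : 0 <= W -> s i * phi W <= W + lambda * P i.
  move=> W0; rewrite mulrC -ler_pdivlMr //; apply: le_trans (phi_min W i) _.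
  by rewrite mulrDl mulrA.
apply: le_trans (lower_bound S_feasible lambda_ge0 phi_ge0 phi_mono phi_le).
apply: ler_sum => j _; apply: ler_wpM2l => //.
apply: le_trans (phi_mono _ _ (remaining_ge0 j) (remaining_le j)).
exact: hsig.
Qed.

End Dual.

(** The lower bound at a high price of energy: with a shortage [d] and the price [(cost + 1) / d],
    it would exceed the cost of [S]. *)
Lemma min_energy (i0 : 'I_kappa) : (forall i, e i0 <= e i) -> (\sum_j v j) * e i0 <= E.
Proof.
move=> hmin; rewrite leNgt; apply/negP => hlt.
pose d := (\sum_j v j) * e i0 - E; have d0 : 0 < d by rewrite subr_gt0.
have cost_ge0 : 0 <= cost I S.
  by apply: sumr_ge0 => j _; rewrite mulr_ge0 // completion_time_ge0.
pose lambda := (cost I S + 1) / d.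
have l0 : 0 <= lambda by apply: divr_ge0; [exact: addr_ge0|exact: ltW].
have phi_le W i : 0 <= W -> s i * (lambda * e i0) <= W + lambda * P i.
  move=> W0; apply: (@le_trans _ _ (lambda * P i)); last by rewrite lerDr.
  rewrite mulrCA ler_wpM2l // mulrC -ler_pdivlMr //.
have := @lower_bound R kappa n I S S_feasible lambda (fun=> lambda * e i0) l0
  (fun _ _ => mulr_ge0 l0 (e_ge0 i0)) (fun _ _ _ _ => lexx _) phi_le.
rewrite -mulr_suml => h.
have : lambda * d <= cost I S by rewrite /d; lra.
by rewrite /lambda divfK ?lt0r_neq0 // gerDl ler10.
Qed.

(** Without speeds the condition [phi_le] is void, so that [phi] may be an arbitrarily large
    constant, incompatible with a positive volume. *)
Lemma no_speed_volume : kappa = 0%N -> forall j, v j = 0.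
Proof.
move=> k0 j; apply/le_anti; rewrite v_ge0 andbT leNgt; apply/negP => vj.
have V0 : 0 < \sum_j v j by rewrite (bigD1 j) //= ltr_wpDr // sumr_ge0.
pose c := (cost I S + 1) / \sum_j v j.
have cost_ge0 : 0 <= cost I S.
  by apply: sumr_ge0 => k _; rewrite mulr_ge0 // completion_time_ge0.
have c0 : 0 <= c by apply: divr_ge0; [exact: addr_ge0|exact: ltW].
have phi_le W (i : 'I_kappa) : 0 <= W -> s i * c <= W + 0 * P i.
  by have := ltn_ord i; rewrite {2}k0.
have := @lower_bound R kappa n I S S_feasible 0 (fun=> c) (lexx 0)
  (fun _ _ => c0) (fun _ _ _ _ => lexx _) phi_le.
by rewrite -mulr_suml mul0r addr0 /c mulrC divfK ?lt0r_neq0 // gerDl ler10.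
Qed.

(** Adding the two minimality conditions cancels the energies and leaves
    [(W - W') * (r k - r i) >= 0]; indices grow as speeds fall. *)
Lemma cheapest_mono lambda W W' i k :
  cheapest (fun i => r i) (fun i => e i) lambda W i ->
  cheapest (fun i => r i) (fun i => e i) lambda W' k ->
  W' < W -> (i <= k)%N.
Proof.
move=> hi hk hW; have h1 := hi k; have h2 := hk i.
have rik : r i <= r k by rewrite -(ler_pM2l (_ : 0 < W - W')) ?subr_gt0 //; lra.
rewrite leqNgt; apply/negP => ki; move: rik.
by rewrite lef_pV2 ?posrE // leNgt ltr_rat speed_decr.
Qed.

Definition smith_before (y x : 'I_n) := w x != 0 -> w y != 0 /\ v y * w x <= v x * w y.

(** The share of the pair in the sum of [remaining x * t x]: [y] pays for waiting during [x] if [S]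
    runs [x] no later. A job [x] of weight 0 charges nothing, in accordance with [remaining]. *)
Definition order_cost (t : 'I_n -> R) (x y : 'I_n) : R :=
  if (0 < w x) && (pos x <= pos y)%N then w y * t x else 0.

Lemma pair_order_cost (t : 'I_n -> R) l : perm_eq l (enum 'I_n) ->
  pair_cost (order_cost t) l = \sum_j remaining j * t j.
Proof.
move=> pl; rewrite /pair_cost (perm_big _ pl) big_enum /=; apply: eq_bigr => x _.
rewrite (perm_big _ pl) big_enum /= /order_cost /remaining.
rewrite lt_neqAle w_ge0 andbT eq_sym; case: eqP => _ /=; first by rewrite mul0r big1.
by rewrite -big_mkcond /weight_from mulr_suml.
Qed.

(** For positive weights: if [S] and the classes order the two jobs alike, the share of [S] contains
    the class cost. If [S] runs [x] first and the classes run [y] first, [remaining] drops from [x]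
    to [y] and the first hypothesis compares the costs. The opposite disagreement contradicts the
    second one. *)
Lemma order_cost_pair (t : 'I_n -> R) (c : 'I_n -> int) (x y : 'I_n) :
  x != y -> (forall j, 0 <= t j) ->
  (remaining y < remaining x -> c y <= c x -> w y != 0 /\ w x * t y <= w y * t x) ->
  (remaining x < remaining y -> c y <= c x) ->
  (if (c y <= c x)%O then w x * t y else w y * t x) <= order_cost t x y + order_cost t y x.
Proof.
move=> xy t0 h1 h2.
have oc_ge0 a b : 0 <= order_cost t a b by rewrite /order_cost; case: ifP => // _; exact: mulr_ge0.
have sum_ge0 : 0 <= order_cost t x y + order_cost t y x by exact: addr_ge0.
have gt0 a : w a != 0 -> 0 < w a by rewrite lt_neqAle w_ge0 andbT eq_sym.
have posne a b : a != b -> (pos a < pos b)%N \/ (pos b < pos a)%N.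
  by rewrite -(inj_eq (@perm_inj _ (job_order S)^-1%g)) -val_eqE neq_ltn => /orP.
have ocl a b : 0 < w a -> (pos a < pos b)%N -> order_cost t a b = w b * t a.
  by move=> wa ab; rewrite /order_cost wa ltnW.
case: ifP => [cyx|cxy].
- have [->|wx] := eqVneq (w x) 0; first by rewrite mul0r.
  have wx0 := gt0 _ wx.
  have [wy|wy] := eqVneq (w y) 0.
    have : remaining y < remaining x.
      by rewrite {1}/remaining wy eqxx remaining_gt0.
    by move=> /h1 /(_ cyx)[]; rewrite wy eqxx.
  have wy0 := gt0 _ wy.
  have [pxy|pyx] := posne _ _ xy; last by rewrite (ocl _ _ wy0 pyx) lerDr.
  have [_ h] := h1 (remaining_lt wx0 pxy) cyx.
  by apply: le_trans h _; rewrite (ocl _ _ wx0 pxy) lerDl.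
- have [->|wy] := eqVneq (w y) 0; first by rewrite mul0r.
  have wy0 := gt0 _ wy.
  have hyx : remaining y <= remaining x.
    by rewrite leNgt; apply/negP => /h2; rewrite cxy.
  have wx : w x != 0.
    apply/eqP => wx; move: hyx; rewrite {2}/remaining wx eqxx leNgt.
    by rewrite remaining_gt0.
  have [pxy|pyx] := posne _ _ xy; last first.
    by move: (remaining_lt wy0 pyx); rewrite ltNge hyx.
  by rewrite (ocl _ _ (gt0 _ wx) pxy) lerDl.
Qed.

Let int_of (i : 'I_kappa) : int := (i : nat)%:Z.

Let t_ge0 (sigma : 'I_n -> 'I_kappa) j : 0 <= v j * r (sigma j).
Proof. by rewrite mulr_ge0 // ltW. Qed.

Let cheapest_int lambda W W' i k :
  cheapest (fun i => r i) (fun i => e i) lambda W i ->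
  cheapest (fun i => r i) (fun i => e i) lambda W' k ->
  W' < W -> int_of i <= int_of k.
Proof. by move=> hi hk hW; rewrite lez_nat; exact: cheapest_mono hi hk hW. Qed.

(** The class schedule is compared pair by pair with the bound of [dual_bound] at the critical
    price. If [lambda = 0], energy drops out of the bound. Otherwise the two classes of the mixed
    job are equally cheap, so the bound does not see the mixture, and since exactly [E] is used the
    energy terms cancel. *)
Theorem split_structure (i0 : 'I_kappa) (L : seq 'I_n) : perm_eq L (enum 'I_n) ->
  pairs_all (fun x y => smith_before y x) L ->
  exists sigma : 'I_n -> 'I_kappa,
    (energy_of (fun j => v j) (fun i => e i) sigma <= E /\
     class_cost (fun j => w j) (fun j => v j * r (sigma j)) (fun j => int_of (sigma j)) L
       <= cost I S) \/
    exists j a x, [/\ e (sigma j) < e a, r a < r (sigma j), 0 <= x <= v j,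
      \sum_(k | k != j) v k * e (sigma k) + x * e a + (v j - x) * e (sigma j) = E &
      class_cost (fun j => w j)
        (fun k => if k == j then x * r a + (v j - x) * r (sigma j) else v k * r (sigma k))
        (fun k => if k == j then int_of a else int_of (sigma k))
        (j :: [seq k <- L | k != j]) <= cost I S].
Proof.
move=> pL hL.
have [i1 _ i1min] := @arg_minP _ R _ i0 xpredT (fun i => e i) isT.
have hmin i : e i1 <= e i by exact: i1min.
have [lambda [sigma [l0 hsig hE hsplit]]] := exists_optimal_split remaining_ge0
  (fun i => ltW (r_gt0 i)) (min_energy hmin) hmin.
exists sigma.
have uL : uniq L by rewrite (perm_uniq pL) enum_uniq.
have hdual := dual_bound i0 l0 hsig.
have normal_pair t c : (forall j, 0 <= t j) -> (forall x y, remaining x < remaining y -> c y <= c x) ->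
    forall x y, x != y -> smith_before y x ->
    t x = v x * r (sigma x) -> c x = int_of (sigma x) ->
    t y = v y * r (sigma y) -> c y = int_of (sigma y) ->
    (if (c y <= c x)%O then w x * t y else w y * t x) <= order_cost t x y + order_cost t y x.
  move=> t0 cmono x y xy smith tx cx ty cy; apply: order_cost_pair => // [uyx cyx|/cmono //].
  have wx : w x != 0.
    by apply/eqP => wx; move: uyx; rewrite {2}/remaining wx eqxx ltNge remaining_ge0.
  have [wy h] := smith wx; split=> //.
  (* Less remaining weight forces a class no earlier, the premise says no later. The classes thus
     coincide and Smith's order decides. *)
  have /val_inj E1 : nat_of_ord (sigma y) = nat_of_ord (sigma x).
    have : int_of (sigma x) <= int_of (sigma y) by exact: cheapest_int (hsig x) (hsig y) uyx.
    by move: cyx; rewrite cx cy !lez_nat => h1 h2; apply/eqP; rewrite eqn_leq h1 h2.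
  rewrite tx ty E1; have := ler_wpM2r (ltW (r_gt0 (sigma x))) h.
  by congr (_ <= _); ring.
case: hsplit => [lam0|[j [a [ha eba rab hlt]]]].
- left; split=> //; pose t j := v j * r (sigma j); pose c j := int_of (sigma j).
  apply: (@le_trans _ _ (\sum_j remaining j * t j)).
    rewrite -(pair_order_cost t pL); apply: class_cost_le => [x|].
      rewrite /order_cost leqnn andbT; case: ltP => // wx.
      have -> : w x = 0 by apply/le_anti; rewrite wx w_ge0.
      by rewrite mul0r.
    apply: pairs_all_imply (pairs_all_and hL (pairs_all_neq uL)) => x y [smith xy].
    apply: (normal_pair t c) => // [k|k l]; first exact: t_ge0.
    exact: cheapest_int.
  move: hdual; rewrite lam0 mul0r addr0; apply: le_trans.
  by apply: ler_sum => k _; rewrite mul0r addr0 /t mulrCA.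
right; pose b := sigma j; pose x := (E - energy_of (fun j => v j) (fun i => e i) sigma) / (e a - e b).
have d0 : 0 < e a - e b by rewrite subr_gt0.
have xd : x * (e a - e b) = E - energy_of (fun j => v j) (fun i => e i) sigma.
  by rewrite /x divfK // lt0r_neq0.
have x0 : 0 <= x by rewrite /x divr_ge0 ?subr_ge0 // ltW.
have xv : x <= v j by rewrite -(ler_pM2r d0) xd; move: hlt; rewrite -/b; lra.
exists j, a, x; split=> //; first by rewrite x0.
  move: xd; rewrite /energy_of (bigD1 j) //= -/b; lra.
pose t k := if k == j then x * r a + (v j - x) * r (sigma j) else v k * r (sigma k).
pose c k := if k == j then int_of a else int_of (sigma k).
have t0 k : 0 <= t k.
  rewrite /t; case: ifP => _; last exact: t_ge0.
  by rewrite addr_ge0 // mulr_ge0 ?subr_ge0 // ltW.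
have ab : int_of a < int_of b.
  rewrite ltz_nat; move: rab; rewrite ltf_pV2 ?posrE // ltr_rat -/b => sab.
  rewrite ltnNge leq_eqVlt negb_or; apply/andP; split.
    by apply: contraTneq sab => /val_inj ->; rewrite ltxx.
  by apply: contraTN sab => /(speed_decr I); rewrite -leNgt; exact: ltW.
(* This includes the mixed job [j], placed in [a], because [a] is also cheapest at its remaining
   weight. *)
have cmono y z : remaining y < remaining z -> c z <= c y.
  rewrite /c; case: (eqVneq z j) => [->|zj]; case: (eqVneq y j) => [->|yj] h.
  - by rewrite ltxx in h.
  - exact: cheapest_int ha (hsig y) h.
  - exact: cheapest_int (hsig z) ha h.
  - exact: cheapest_int (hsig z) (hsig y) h.
have pL' : perm_eq (j :: [seq k <- L | k != j]) (enum 'I_n).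
  apply: (perm_trans _ pL); rewrite perm_sym -rem_filter //; apply: perm_to_rem.
  by rewrite (perm_mem pL) mem_enum.
apply: (@le_trans _ _ (\sum_k remaining k * t k)).
  rewrite -(pair_order_cost t pL'); apply: class_cost_le => [y|].
    rewrite /order_cost leqnn andbT; case: ltP => // wx.
    have -> : w y = 0 by apply/le_anti; rewrite wx w_ge0.
    by rewrite mul0r.
  split; last first.
    have hfil : pairs_all (fun x y => x != j /\ y != j) [seq k <- L | k != j].
      elim: (L) => //= z l IH; case: ifP => //= zj; split=> //.
      apply/(pairs_allP (fun x y => x != j /\ y != j)) => y.
      by rewrite mem_filter => /andP[].
    have := pairs_all_and hfil
      (pairs_all_filter (predC1 j) (pairs_all_and hL (pairs_all_neq uL))).
    apply: pairs_all_imply => y z [[yj zj] [smith yz]].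
    by apply: (normal_pair t c) => //; rewrite /t /c ?(negbTE yj) ?(negbTE zj).
  apply/(pairs_allP (fun x y => (if (c y <= c x)%O then w x * t y else w y * t x)
    <= order_cost t x y + order_cost t y x)) => y.
  rewrite mem_filter => /andP[yj _].
  apply: (@order_cost_pair t c) => // [|uy cy|/cmono //]; first by rewrite eq_sym.
  (* This is why [j] can come last in class [a] regardless of Smith's order: a job with less
     remaining weight is in class [b] or later, strictly behind [a], which contradicts the
     premise. *)
  have : int_of b <= c y by rewrite /c (negbTE yj); exact: cheapest_int (hsig j) (hsig y) uy.
  by move: cy; rewrite {2}/c eqxx => h1 h2; have := lt_le_trans ab (le_trans h2 h1); rewrite ltxx.
have -> : \sum_k remaining k * t k =
    \sum_k v k * (remaining k * r (sigma k) + lambda * e (sigma k)) - lambda * E.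
  rewrite (bigD1 j) //= [in RHS](bigD1 j) //= -/b.
  have -> : \sum_(i | i != j) v i * (remaining i * r (sigma i) + lambda * e (sigma i)) =
     \sum_(i | i != j) remaining i * t i + lambda * \sum_(i | i != j) v i * e (sigma i).
    rewrite mulr_sumr -big_split; apply: eq_bigr => k /negbTE kj /=.
    by rewrite /t kj; ring.
  have hEj : E = v j * e b + \sum_(i | i != j) v i * e (sigma i) + x * (e a - e b).
    by have := xd; rewrite /energy_of (bigD1 j) //= -/b; lra.
  have tie : remaining j * r a + lambda * e a = remaining j * r b + lambda * e b.
    by apply/le_anti; rewrite (ha b) (hsig j a).
  rewrite {1}/t eqxx -/b {1}hEj.
  move: (\sum_(i | _) remaining i * t i) (\sum_(i | _) v i * e _) => X Y.
  have : x * (remaining j * r a + lambda * e a) = x * (remaining j * r b + lambda * e b) by rewrite tie.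
  lra.
by rewrite lerBlDr.
Qed.

End Structure.

(** * Order of the output *)

(** [l] has the latest insertion first, while inside a class the jobs run in the order of insertion;
    hence [rev]. *)
Definition layout (X : Type) (C : eqType) (c : X -> C) (cs : seq C) (l : seq X) : seq X :=
  flatten [seq rev [seq x <- l | c x == k] | k <- cs].

Lemma layout_map (X Y : Type) (C : eqType) (c : X -> C) (f : Y -> X) cs l :
  layout c cs [seq f y | y <- l] = [seq f y | y <- layout (c \o f) cs l].
Proof.
by rewrite /layout map_flatten -map_comp; congr flatten; apply: eq_map => k /=; rewrite filter_map map_rev.
Qed.

Lemma layout_cons (X : Type) (C : eqType) (c : X -> C) k cs l :
  layout c (k :: cs) l = rev [seq x <- l | c x == k] ++ layout c cs l.
Proof. by []. Qed.

Lemma output_layout (items : seq item) (ents : seq entry) :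
  output items ents =
  let l := layout (fun x : item => x.1.1) [seq x.1.1 | x <- ents] items in
  ([seq x.1.2.1 | x <- l], flatten [seq [:: x.2.1; x.2.2] | x <- l]).
Proof.
rewrite /output; elim: ents => //= x ents ->; rewrite layout_cons.
move: (layout _ _ _) => l; rewrite /put_class.
elim/last_ind: items => [|items i IH] //=.
rewrite foldl_rcons IH /put_item filter_rcons subr_eq0.
by case: eqP => //= _; rewrite rev_rcons.
Qed.

Lemma perm_refl_eq (T : eqType) (s t : seq T) : s = t -> perm_eq s t.
Proof. by move=> ->. Qed.

Section Layout.
Variables (R : realFieldType) (X : eqType) (d : Order.disp_t) (C : orderType d).
Variables (w t : X -> R) (c : X -> C).

Lemma perm_layout cs l : uniq cs -> perm_eq (layout c cs l) [seq x <- l | c x \in cs].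
Proof.
elim: cs => [_|k cs IH /andP[kcs /IH {}IH]]; first by rewrite /layout /= filter_pred0.
have := permEl (perm_filterC (fun x => c x == k) [seq x <- l | c x \in k :: cs]).
rewrite -!filter_predI; apply: perm_trans; rewrite layout_cons; apply: perm_cat.
  rewrite perm_rev; apply: perm_refl_eq; apply: eq_filter => x /=.
  by rewrite inE; case: eqP.
apply: perm_trans IH _; apply: perm_refl_eq; apply: eq_filter => x /=.
by rewrite inE; case: eqP => //= ->; apply: negbTE.
Qed.

Lemma big_layout (f : X -> R) cs l : uniq cs ->
  \sum_(x <- layout c cs l) f x = \sum_(x <- l | c x \in cs) f x.
Proof. by move=> u; rewrite (perm_big _ (perm_layout l u)) big_filter. Qed.

(** With processing times in place of volumes and [phi = id], [suffix_bound] is the total weighted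
    completion time of a sequence, and the increment has the form used in [class_cost]. *)
Lemma suffix_bound_insert l1 x l2 :
  suffix_bound w t id (l1 ++ x :: l2) = suffix_bound w t id (l1 ++ l2) +
    w x * (\sum_(y <- l1) t y + t x) + t x * \sum_(y <- l2) w y.
Proof.
elim: l1 => [|y l1 IH] /=; first by rewrite big_cons big_nil; ring.
rewrite IH !(big_cons, big_cat) /=; ring.
Qed.

(** The head of [l] is put at the end of its class, preceded by the classes up to its own and
    followed by the later ones, which are the two sums in [class_cost]. *)
Lemma suffix_bound_layout cs l : sorted <%O cs -> (forall x, x \in l -> c x \in cs) ->
  suffix_bound w t id (layout c cs l) = class_cost w t c l.
Proof.
move=> scs; have ucs := sorted_uniq lt_trans ltxx scs.
elim: l => [_|x l IH hl].
  by rewrite /layout; elim: (cs) => //= k cs' ->.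
have hl' y : y \in l -> c y \in cs by move=> yl; apply: hl; rewrite inE yl orbT.
have {}IH := IH hl'.
have [cs1 [cs2 csE]] : exists cs1 cs2, cs = cs1 ++ c x :: cs2.
  by case/splitPr: (hl x (mem_head _ _)) => p1 p2; exists p1, p2.
have [lt1 lt2] : (forall k, k \in cs1 -> (k < c x)%O) /\ (forall k, k \in cs2 -> (c x < k)%O).
  move: scs; rewrite csE (sorted_pairwise lt_trans) pairwise_cat pairwise_cons.
  move=> /and3P[/allrelP h1 _ /andP[/allP h2 _]]; split=> // k k1.
  by apply: h1 => //; exact: mem_head.
have skip cs' : c x \notin cs' -> layout c cs' (x :: l) = layout c cs' l.
  move=> h; congr flatten; apply/eq_in_map => k kcs' /=.
  by case: eqP => // E; rewrite E kcs' in h.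
have layout_cat a b l' : layout c (a ++ b) l' = layout c a l' ++ layout c b l'.
  by rewrite /layout map_cat flatten_cat.
move: ucs; rewrite csE cat_uniq /= => /and3P[u1 /norP[n1 _] /andP[n2 u2]].
have sE (a : seq C) : a ++ c x :: cs2 = rcons a (c x) ++ cs2 by rewrite cat_rcons.
pose l1 := layout c (rcons cs1 (c x)) l; pose l2 := layout c cs2 l.
have E1 : layout c cs (x :: l) = l1 ++ x :: l2.
  rewrite csE layout_cat skip // /l1 -cats1 layout_cat -catA; congr (_ ++ _).
  rewrite layout_cons /= eqxx skip // rev_cons cat_rcons.
  by rewrite /layout /= cats0.
have E2 : layout c cs l = l1 ++ l2 by rewrite csE sE layout_cat.
rewrite -csE E1 suffix_bound_insert -E2 IH /=; congr (_ + _ * (_ + _) + _ * _).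
- rewrite big_layout ?rcons_uniq ?n1 // /time_upto.
  rewrite big_seq_cond [RHS]big_seq_cond; apply: eq_bigl => y.
  case yl: (y \in l) => //=; have := hl' y yl; rewrite csE mem_rcons !mem_cat !inE.
  case: eqP => [->|_ /=]; first by rewrite lexx.
  by case/orP => [h|/lt2 h]; [rewrite h (ltW (lt1 _ h))|rewrite leNgt h; apply: contraTF h => /lt1; rewrite -leNgt => /ltW].
- rewrite big_layout // /weight_after.
  rewrite big_seq_cond [RHS]big_seq_cond; apply: eq_bigl => y.
  case yl: (y \in l) => //=; have := hl' y yl; rewrite csE !mem_cat !inE -ltNge.
  case: eqP => [->|_ /=]; first by rewrite ltxx (negbTE n2).
  by case/orP => [/lt1 h|h]; [rewrite ltNge (ltW h); apply: contraTF h => /lt2; rewrite -leNgt => /ltW|rewrite h lt2].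
Qed.

End Layout.

(** * Scaling the instance *)

Lemma perm_insert j l : perm_eq (insert j l) (j :: l).
Proof.
elim: l => //= k l IH; case: ifP => // _.
have := IH; rewrite -(perm_cons k) => /perm_trans; apply.
by rewrite -[k :: j :: l]/([:: k] ++ [:: j] ++ l) perm_catCA.
Qed.

Lemma perm_isort l : perm_eq (isort l) l.
Proof. by elim: l => //= j l IH; apply: perm_trans (perm_insert j _) _; rewrite perm_cons. Qed.

Lemma smith_total x y : ~~ smith x y -> smith y x.
Proof.
rewrite /smith; case: eqVneq => //= _; case: eqVneq => //= _.
by rewrite -ltNge => /ltW.
Qed.

Lemma smith_trans y x z : 0 <= x.2.2 -> 0 <= y.2.2 -> 0 <= z.2.2 ->
  smith x y -> smith y z -> smith x z.
Proof.
rewrite /smith => x0 y0 z0; case: (eqVneq z.2.2 0) => //= _.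
case: (eqVneq y.2.2 0) => //= hy; case: (eqVneq x.2.2 0) => //= hx h1 h2.
have y1 : 0 < y.2.2 by rewrite lt_neqAle eq_sym hy.
rewrite -(ler_pM2r y1).
have -> : x.2.1 * z.2.2 * y.2.2 = x.2.1 * y.2.2 * z.2.2 by ring.
apply: le_trans (ler_wpM2r z0 h1) _.
have -> : y.2.1 * x.2.2 * z.2.2 = y.2.1 * z.2.2 * x.2.2 by ring.
apply: le_trans (ler_wpM2r x0 h2) _.
by rewrite le_eqVlt; apply/orP; left; apply/eqP; ring.
Qed.

Lemma pairwise_isort l : (forall j : job, j \in l -> 0 <= j.2.2) -> pairwise smith (isort l).
Proof.
elim: l => //= j l IH hl.
have {}IH : pairwise smith (isort l) by apply: IH => k kl; apply: hl; rewrite inE kl orbT.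
have j0 : 0 <= j.2.2 by apply: hl; exact: mem_head.
have : forall k : job, k \in isort l -> 0 <= k.2.2.
  by move=> k; rewrite mem_isort => kl; apply: hl; rewrite inE kl orbT.
elim: (isort l) IH => //= k s IH /andP[/allP ks ss] hs.
have k0 : 0 <= k.2.2 by apply: hs; exact: mem_head.
case: ifPn => [jk|/smith_total kj] /=.
  rewrite jk ss; apply/andP; split; last by apply/andP; split=> //; apply/allP.
  apply/allP => i ik; apply: (smith_trans j0 k0 _ jk (ks i ik)).
  by apply: hs; rewrite inE ik orbT.
rewrite IH //= ?andbT; last by move=> i ik; apply: hs; rewrite inE ik orbT.
by apply/allP => i; rewrite (perm_mem (perm_insert j s)) inE => /predU1P[->|/ks].
Qed.

Lemma pairs_all_pairwise (X : eqType) (r : rel X) (P : X -> X -> Prop) l :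
  (forall x y, r x y -> P x y) -> pairwise r l -> pairs_all P l.
Proof.
move=> h; elim: l => //= x l IH /andP[/allP hx /IH]; split=> //.
by apply/pairs_allP => y /hx /h.
Qed.

Lemma pairwise_rev (X : Type) (r : rel X) (l : seq X) :
  pairwise r (rev l) = pairwise (fun x y => r y x) l.
Proof.
by elim: l => //= x l IH; rewrite rev_cons -cats1 pairwise_cat IH /= andbT allrel1r all_rev.
Qed.

Lemma dvd_atom_product_seq (T : Type) (enc : T -> sexp) (z : int) x l1 l2 :
  (z %| atom_product (enc x))%Z -> (z %| atom_product (enc_seq enc (l1 ++ x :: l2)))%Z.
Proof.
move=> h; elim: l1 => [|y l1 IH] /=; first by rewrite dvdz_mulr.
by rewrite dvdz_mull.
Qed.

Lemma intr_divz (F : numFieldType) (a b z : int) : b != 0 -> (b %| z)%Z ->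
  ((z * a %/ b)%Z)%:~R = z%:~R * (a%:~R / b%:~R) :> F.
Proof.
move=> b0 bz; have b0' : b%:~R != 0 :> F by rewrite intr_eq0.
by apply: (mulIf b0'); rewrite -rmorphM divzK ?dvdz_mulr // rmorphM /=; field.
Qed.

Lemma index_fromE (T : Type) n (f : 'I_n -> T) :
  index_from 0 [seq f j | j <- enum 'I_n] = [seq ((j : nat)%:Z, f j) | j : 'I_n <- enum 'I_n].
Proof.
suff h (s : seq 'I_n) m : map val s = iota m (size s) ->
    index_from m%:Z [seq f j | j <- s] = [seq ((j : nat)%:Z, f j) | j : 'I_n <- s].
  by apply: h; rewrite val_enum_ord size_enum_ord.
elim: s m => //= j s IH m [-> /IH]; rewrite -addn1 PoszD => ->; by [].
Qed.

Definition frac_of (q : rat) : int * int := (numq q, denq q).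

Section Instance.
Variables (R : realType) (kappa n : nat) (I : instance kappa n) (eps : rat).

Definition raw_jobs := [seq (frac_of (volume I j), frac_of (weight I j)) | j <- enum 'I_n].
Definition raw_speeds := [seq (frac_of (speed I i), frac_of (power I i)) | i <- enum 'I_kappa].
Local Notation on_raw f := (f raw_jobs raw_speeds (numq (budget I)) (denq (budget I)) (numq eps) (denq eps)).
Local Notation D := (on_raw scale).
Local Notation N := (precision raw_jobs (numq eps) (denq eps)).
Local Notation B := (on_raw scaled_budget).
Local Notation J := (on_raw scaled_jobs).
Local Notation ents := (on_raw scaled_entries).
Local Notation DR := (D%:~R : R).

Lemma enc_input_raw : enc_input I eps = on_raw enc_raw.
Proof.
have h (T : Type) (F : T -> (int * int) * (int * int)) G (l : seq T) :
    (forall j, enc_rates (F j) = enc_pair enc_rat enc_rat (G j)) ->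
    enc_seq (enc_pair enc_rat enc_rat) [seq G j | j <- l] = enc_seq enc_rates [seq F j | j <- l].
  by move=> FG; elim: l => //= j l ->; rewrite FG.
rewrite /enc_input /enc_instance /enc_raw /raw_jobs /raw_speeds.
by congr (Node (Node _ (Node _ _)) _); apply: h.
Qed.

Definition job_of (k : 'I_n) : job :=
  mk_job D ((k : nat)%:Z, (frac_of (volume I k), frac_of (weight I k))).
Definition class_of (i : 'I_kappa) : speed_class :=
  (mk_entry D ((i : nat)%:Z, (frac_of (speed I i), frac_of (power I i)))).1.

Lemma valid_raw_jobs x : x \in raw_jobs -> valid_job x.
Proof.
by move=> /mapP[j _ ->]; split; rewrite /= ?denq_gt0 // numq_ge0 (volume_ge0, weight_ge0).
Qed.

Lemma valid_raw_speeds x : x \in raw_speeds -> valid_speed x.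
Proof.
move=> /mapP[j _ ->]; split; rewrite /= ?denq_gt0 //; last by rewrite numq_ge0 power_ge0.
by rewrite numq_gt0 speed_gt0.
Qed.

Lemma D_gt0 : 0 < DR.
Proof. by rewrite ltr0z; exact: atom_product_gt0. Qed.

Lemma dvd_scale x z : (x \in raw_jobs \/ x \in raw_speeds) ->
  (z %| atom_product (enc_rates x))%Z -> (z %| D)%Z.
Proof.
have mem l : x \in l -> (z %| atom_product (enc_rates x))%Z ->
    (z %| atom_product (enc_seq enc_rates l))%Z.
  by case/path.splitPr => l1 l2; exact: dvd_atom_product_seq.
rewrite /scale /enc_raw -[atom_product _]/(_ * _ * (_ * _)) => -[] /mem h /h {}h; apply: dvdz_mulr.
  exact: dvdz_mulr.
by apply: dvdz_mull; exact: dvdz_mulr.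
Qed.

Lemma dvd_rates x z : 0 < z -> z \in [:: x.1.1; x.1.2; x.2.1; x.2.2] ->
  (z %| atom_product (enc_rates x))%Z.
Proof.
rewrite /= => z0; rewrite !inE => /or4P[] /eqP <-; rewrite [z <= 0]leNgt z0 /=.
- by rewrite !dvdz_mulr.
- by rewrite dvdz_mulr // dvdz_mull.
- by rewrite dvdz_mull // dvdz_mulr.
- by rewrite !dvdz_mull.
Qed.

Lemma mk_scaled (a z : int) : 0 < z -> (z %| D)%Z -> ((D * a %/ z)%Z)%:~R = DR * (a%:~R / z%:~R) :> R.
Proof. by move=> z0 zD; apply: intr_divz => //; rewrite gt_eqF. Qed.

Lemma job_volume k : (job_of k).2.1%:~R = DR * ratr (volume I k) :> R.
Proof.
apply: mk_scaled; first exact: denq_gt0.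
apply: (@dvd_scale (frac_of (volume I k), frac_of (weight I k))).
  by left; apply/mapP; exists k; rewrite ?mem_enum.
by apply: dvd_rates; rewrite ?denq_gt0 // !inE eqxx !orbT.
Qed.

Lemma job_weight k : (job_of k).2.2%:~R = DR * ratr (weight I k) :> R.
Proof.
apply: mk_scaled; first exact: denq_gt0.
apply: (@dvd_scale (frac_of (volume I k), frac_of (weight I k))).
  by left; apply/mapP; exists k; rewrite ?mem_enum.
by apply: dvd_rates; rewrite ?denq_gt0 // !inE eqxx !orbT.
Qed.

Lemma class_of_time i : (class_time (class_of i))%:~R = DR / ratr (speed I i) :> R.
Proof.
have s0 : 0 < numq (speed I i) by rewrite numq_gt0 speed_gt0.
rewrite /ratr invf_div; apply: mk_scaled => //.
apply: (@dvd_scale (frac_of (speed I i), frac_of (power I i))).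
  by right; apply/mapP; exists i; rewrite ?mem_enum.
by apply: dvd_rates => //; rewrite !inE eqxx.
Qed.

Lemma class_of_energy i : (class_energy (class_of i))%:~R =
  DR ^+ 2 * (ratr (power I i) / ratr (speed I i)) :> R.
Proof.
rewrite rmorphM /= -/(class_time (class_of i)) class_of_time mk_scaled ?denq_gt0 //.
  by rewrite expr2 /ratr; ring.
apply: (@dvd_scale (frac_of (speed I i), frac_of (power I i))).
  by right; apply/mapP; exists i; rewrite ?mem_enum.
by apply: dvd_rates; rewrite ?denq_gt0 // !inE eqxx !orbT.
Qed.

Lemma scaled_budgetE : B%:~R = DR ^+ 3 * ratr (budget I) :> R.
Proof.
rewrite /scaled_budget intr_divz ?denq_eq0 //; first by rewrite !rmorphM /= !exprS expr0 mulr1 !mulrA.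
apply: dvdz_mull; rewrite /scale /= [denq _ <= 0]leNgt denq_gt0 /=.
by apply: dvdz_mulr; do 3 apply: dvdz_mull.
Qed.

Lemma scaled_classes : [seq x.1 | x : entry <- ents] = [seq class_of i | i <- enum 'I_kappa].
Proof. by rewrite /scaled_entries /raw_speeds index_fromE -!map_comp. Qed.

Lemma smith_job_of j k : smith (job_of j) (job_of k) -> smith_before R I j k.
Proof.
have DR0 := D_gt0.
rewrite /smith /smith_before -!(intr_eq0 R) -(ler_int R) !rmorphM /= !job_volume !job_weight.
rewrite !mulf_eq0 gt_eqF //=; case: ifP => //= _; case: ifP => //= _ h _; split=> //.
have D2 : 0 < DR * DR by exact: mulr_gt0.
by rewrite -(ler_pM2l D2) mulrACA [leRHS]mulrACA.
Qed.

(** Jobs are inserted in sorted order, and a list of insertions starts with the latest one, so that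
    Smith's order is stated for the reversed list. *)
Lemma scaled_jobsE : exists L : seq 'I_n, [/\ J = [seq job_of k | k <- L], perm_eq L (enum 'I_n) &
  pairs_all (fun x y => smith_before R I y x) (rev L)].
Proof.
have p : perm_eq J [seq job_of k | k <- enum 'I_n].
  by apply: perm_trans (perm_isort _) _; rewrite /raw_jobs index_fromE -map_comp.
have [L JL pL] := perm_map_inv p; exists L; split=> //.
apply: (@pairs_all_pairwise _ (fun x y => smith (job_of y) (job_of x))) => [x y|].
  exact: smith_job_of.
rewrite pairwise_rev -pairwise_map -JL; apply: pairwise_isort => j.
rewrite -(mem_isort _) (perm_mem p) => /mapP[k _ ->].
by rewrite -(ler0z R) job_weight mulr_ge0 ?ler0q ?weight_ge0 // ltW // D_gt0.
Qed.

Lemma job_of_ge0 k : [/\ 0 <= (job_of k).1, 0 <= (job_of k).2.1 & 0 <= (job_of k).2.2].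
Proof.
have DR0 := ltW D_gt0.
split=> //; rewrite -(ler0z R) (job_volume, job_weight) mulr_ge0 // ler0q ?volume_ge0 ?weight_ge0 //.
Qed.

End Instance.

(** * Approximation guarantee *)

Section Approximation.
Variables (R : realType) (kappa n : nat) (I : instance kappa n) (eps : rat).
Hypothesis eps_gt0 : 0 < eps.
Local Notation on_raw f :=
  (f (raw_jobs I) (raw_speeds I) (numq (budget I)) (denq (budget I)) (numq eps) (denq eps)).
Local Notation D := (on_raw scale).
Local Notation N := (precision (raw_jobs I) (numq eps) (denq eps)).
Local Notation B := (on_raw scaled_budget).
Local Notation J := (on_raw scaled_jobs).
Local Notation ents := (on_raw scaled_entries).
Local Notation DR := (D%:~R : R).
Local Notation job_of := (job_of I eps).
Local Notation class_of := (class_of I eps).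
Local Notation w j := (ratr (weight I j) : R).
Local Notation v j := (ratr (volume I j) : R).
Local Notation r i := ((ratr (speed I i))^-1 : R).
Local Notation e i := (ratr (power I i) / ratr (speed I i) : R).

Lemma instance_precision_gt0 : 0 < N.
Proof.
by apply: (precision_gt0 (sp := raw_speeds I) (bn := 0) (bd := 0) _ (denq_gt0 _) (leq_addr _ _) (leq_addl _ _));
  rewrite numq_gt0.
Qed.

Lemma instance_entries_valid (x : entry) : x \in ents -> [/\ 0 <= x.1.2.1, x.2.1 = 0 & x.2.2 = 0].
Proof.
move=> /mapP[y]; rewrite /raw_speeds index_fromE => /mapP[i _ ->] ->; split=> //=.
by rewrite -(ler0z R) (class_of_time R I eps i) divr_ge0 ?ler0q ?(ltW (speed_gt0 I i)) // ltW // D_gt0.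
Qed.

Lemma instance_jobs_valid (j : job) : j \in J -> [/\ 0 <= j.1, 0 <= j.2.1 & 0 <= j.2.2].
Proof. by have [L [-> _ _]] := scaled_jobsE R I eps; move=> /mapP[k _ ->]; exact: job_of_ge0. Qed.

Lemma instance_jobs_uniq : uniq [seq k.1 | k <- J].
Proof.
have [L [-> pL _]] := scaled_jobsE R I eps; rewrite -map_comp map_inj_uniq.
  by rewrite (perm_uniq pL) enum_uniq.
by move=> j k [/val_inj].
Qed.

Lemma class_of_mem i : class_of i \in [seq x.1 | x : entry <- ents].
Proof. by rewrite scaled_classes map_f // mem_enum. Qed.

Lemma item_energy_of k i : (item_energy (job_of k, class_of i))%:~R = DR ^+ 3 * (v k * e i) :> R.
Proof. rewrite rmorphM /= class_of_energy job_volume; ring. Qed.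

Lemma item_time_of k i : item_time R (job_of k, class_of i) = DR ^+ 2 * (v k * r i).
Proof. rewrite /item_time rmorphM /= class_of_time job_volume; ring. Qed.

Lemma item_weight_of k i : item_weight R (job_of k, class_of i) = DR * w k.
Proof. exact: job_weight. Qed.

Lemma kept_map_job_of L j :
  kept (job_of j).1 [seq job_of k | k <- L] = [seq job_of k | k <- [seq k <- L | k != j]].
Proof.
rewrite /kept filter_map; congr map; apply: eq_filter => k /=.
by rewrite subr_eq0 eqz_nat.
Qed.

(** Completeness against an arbitrary feasible schedule: the structure theorem supplies an
    assignment of no larger cost, and rounding down can only lower the value of the candidate found
    for it. *)
Lemma exists_good_candidate (S : solution R n) (i0 : 'I_kappa) : feasible I S ->
  exists2 c, c \in all_candidates N D B J ents & c.1.1%:~R / c.1.2%:~R <= DR ^+ 3 * cost I S.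
Proof.
move=> hS; have N0 := instance_precision_gt0.
have [L [JE pL sL]] := scaled_jobsE R I eps.
have D0 := D_gt0 R I eps.
have D3 : 0 < DR ^+ 3 by exact: exprn_gt0.
have prL : perm_eq (rev L) (enum 'I_n) by rewrite perm_rev.
pose runl sigma l := [seq (job_of k, class_of (sigma k)) | k : 'I_n <- l].
have runl_classes sigma l x : x \in runl sigma l -> x.2 \in [seq x.1 | x : entry <- ents].
  by move=> /mapP[k _ ->]; exact: class_of_mem.
have [sigma [[hE hC]|[j [a [z [ea ra /andP[z0 zv] hE hC]]]]]] := split_structure hS i0 prL sL.
  have [x0 x0e] : exists x0, x0 \in ents.
    by have /mapP[x xe _] := class_of_mem i0; exists x.
  have [||c cA hc] := exists_whole_candidate (B := B) (l := runl sigma (rev L)) R D N0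
    instance_entries_valid instance_jobs_valid x0e (runl_classes sigma (rev L)).
  - by rewrite -map_comp JE map_rev.
  - rewrite -(ler_int R) rmorph_sum scaled_budgetE big_map.
    rewrite (eq_bigr _ (fun k _ => item_energy_of k (sigma k))) -mulr_sumr ler_pM2l //.
    by rewrite (perm_big _ prL) big_enum.
  exists c => //; apply: le_trans hc _; rewrite class_cost_map.
  rewrite (eq_in_class_cost (w' := fun k => DR * w k) (t' := fun k => DR ^+ 2 * (v k * r (sigma k)))
    (c' := fun k => ((sigma k : nat) : int))).
  - by rewrite class_costZ -exprS ler_wpM2l // ltW.
  - by move=> k _; exact: item_weight_of.
  - by move=> k _; exact: item_time_of.
  - by [].
have jL : j \in L by rewrite (perm_mem pL) mem_enum.
pose l := [seq k <- rev L | k != j].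
have lj k : k \in l -> (k == j) = false by rewrite mem_filter => /andP[/negbTE].
have he : class_energy (class_of (sigma j)) < class_energy (class_of a).
  by rewrite -(ltr_int R) !class_of_energy ltr_pM2l // exprn_gt0.
have ht : class_time (class_of a) <= class_time (class_of (sigma j)).
  by rewrite -(ler_int R) !class_of_time ler_pM2l // ltW.
have hz : 0 <= DR * z <= (job_of j).2.1%:~R.
  by rewrite job_volume (mulr_ge0 (ltW D0) z0) ler_pM2l.
have jJ : job_of j \in J by rewrite JE map_f.
have [||c cA hc] := exists_split_candidate (B := B) (l := runl sigma l) D N0
    instance_entries_valid instance_jobs_valid jJ (class_of_mem a) (class_of_mem (sigma j))
    (runl_classes sigma l) _ he ht hz.
- by rewrite -map_comp JE kept_map_job_of -map_rev -filter_rev.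
- rewrite rmorph_sum scaled_budgetE big_map -hE.
  rewrite (eq_bigr _ (fun k _ => item_energy_of k (sigma k))) -mulr_sumr.
  rewrite big_filter (perm_big _ prL) big_enum_cond /= !class_of_energy job_volume.
  rewrite le_eqVlt; apply/orP; left; apply/eqP; ring.
exists c => //; apply: le_trans hc _.
apply: le_trans (ler_wpM2l (ltW D3) hC); rewrite -/l.
pose t' k := if k == j then z * r a + (v j - z) * r (sigma j) else v k * r (sigma k).
pose c' k := if k == j then (a : nat)%:Z else (sigma k : nat)%:Z.
rewrite -/t' -/c'.
pose f (k : 'I_n) := (job_of k, class_of (sigma k)).
have hw : {in l, item_weight R \o f =1 fun k => DR * w k} by move=> k _; exact: item_weight_of.
have ht' : {in l, item_time R \o f =1 fun k => DR ^+ 2 * t' k}.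
  by move=> k /lj kj; rewrite /t' kj; exact: item_time_of.
have hc' : {in l, item_class \o f =1 c'} by move=> k /lj kj; rewrite /c' kj.
rewrite class_cost_map (eq_in_class_cost hw ht' hc') class_costZ -exprS.
have -> : time_upto (item_time R) item_class (class_index (class_of a)) (runl sigma l) =
    DR ^+ 2 * time_upto t' c' (class_index (class_of a)) l.
  rewrite {1}/time_upto big_map -/(time_upto (item_time R \o f) (item_class \o f) _ l).
  by rewrite (eq_in_time_upto _ ht' hc') /time_upto -mulr_sumr.
have -> : weight_after (item_weight R) item_class (class_index (class_of a)) (runl sigma l) =
    DR * weight_after (fun k => w k) c' (class_index (class_of a)) l.
  rewrite {1}/weight_after big_map -/(weight_after (item_weight R \o f) (item_class \o f) _ l).
  by rewrite (eq_in_weight_after _ hw hc') /weight_after -mulr_sumr.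
rewrite /= job_volume job_weight !class_of_time.
have -> : t' j = z * r a + (v j - z) * r (sigma j) by rewrite /t' eqxx.
have -> : c' j = class_index (class_of a) by rewrite /c' eqxx.
by rewrite le_eqVlt; apply/orP; left; apply/eqP; ring.
Qed.

End Approximation.

Lemma exists_map (T : eqType) (U : Type) (u0 : U) (s : seq T) (t : seq U) :
  uniq s -> size t = size s -> exists f, t = [seq f x | x <- s].
Proof.
elim: s t => [|x s IH] [|u t] //=.
move=> /andP[xs us] [/(IH _ us)[f ->]].
exists (fun y => if y == x then u else f y); rewrite eqxx; congr cons.
by apply/eq_in_map => y ys; case: eqP => // yx; rewrite -yx ys in xs.
Qed.

Lemma exists_perm n (s : seq 'I_n) : perm_eq s (enum 'I_n) ->
  exists o : {perm 'I_n}, s = [seq o k | k <- enum 'I_n].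
Proof.
rewrite -val_ord_tuple => /tuple_permP[q ->]; exists q.
by apply: eq_map => k; rewrite tnth_ord_tuple.
Qed.

(** * From candidates to feasible schedules *)

Section Output.
Variables (R : realType) (kappa n : nat) (I : instance kappa n) (eps : rat).
Hypothesis eps_gt0 : 0 < eps.
Local Notation on_raw f :=
  (f (raw_jobs I) (raw_speeds I) (numq (budget I)) (denq (budget I)) (numq eps) (denq eps)).
Local Notation D := (on_raw scale).
Local Notation N := (precision (raw_jobs I) (numq eps) (denq eps)).
Local Notation B := (on_raw scaled_budget).
Local Notation J := (on_raw scaled_jobs).
Local Notation ents := (on_raw scaled_entries).
Local Notation DR := (D%:~R : R).
Local Notation job_of := (job_of I eps).
Local Notation class_of := (class_of I eps).
Local Notation w j := (ratr (weight I j) : R).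
Local Notation v j := (ratr (volume I j) : R).
Local Notation s i := (ratr (speed I i) : R).

Lemma segment_of i x q : 0 < q -> 0 <= x ->
  let sd := mk_segment D (class_speed (class_of i)) x q in
  [/\ [&& 0 < sd.1.2, 0 < sd.2.2 & 0 <= sd.2.1], frac_val R sd.1 = s i &
      frac_val R sd.2 = x%:~R / (q%:~R * DR) / s i].
Proof.
move=> q0 x0 sd; have D0 : 0 < D by exact: atom_product_gt0.
have s0 : 0 < numq (speed I i) by rewrite numq_gt0 speed_gt0.
split=> //.
  apply/and3P; split; rewrite /sd /mk_segment /=; first exact: denq_gt0.
    by apply: mulr_gt0; [exact: mulr_gt0|exact: s0].
  by apply: mulr_ge0 => //; exact: denq_ge0.
rewrite /sd /mk_segment /frac_val -[class_speed _]/(frac_of (speed I i)); cbn [fst snd].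
move: (scale _ _ _ _ _ _) D0 (denq_gt0 (speed I i)) s0 => d d0 e0 s0.
rewrite /ratr /frac_of; cbn [fst snd]; rewrite !rmorphM.
have ne0 z : 0 < z -> z%:~R != 0 :> R by move=> z0; rewrite intr_eq0 gt_eqF.
by move: (numq _) (denq _) e0 s0 => a b b0 a0; field; rewrite !ne0.
Qed.

Definition job_segments (p : plan) : seq segment :=
  [:: (plan_item D p).2.1; (plan_item D p).2.2].

Lemma valid_planE p : valid_plan ents p ->
  exists a b, p.1.2.1 = class_of a /\ p.1.2.2 = class_of b.
Proof.
rewrite /valid_plan scaled_classes => -[[/mapP[a _ ->] /mapP[b _ ->]] _ _ _ _].
by exists a, b.
Qed.

Lemma job_segments_valid p sd : valid_plan ents p -> sd \in job_segments p ->
  [&& 0 < sd.1.2, 0 < sd.2.2 & 0 <= sd.2.1] /\ exists i, frac_val R sd.1 = s i.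
Proof.
move=> hp; have [a [b [pa pb]]] := valid_planE hp; case: hp => _ q0 xa0 xb0 _.
rewrite !inE => /orP[] /eqP ->; rewrite /= ?pa ?pb.
  by have [h1 h2 _] := segment_of a q0 xa0; split=> //; exists a.
by have [h1 h2 _] := segment_of b q0 xb0; split=> //; exists b.
Qed.

Lemma job_segments_sums p k : valid_plan ents p -> p.1.1 = job_of k ->
  [/\ \sum_(sd <- job_segments p) frac_val R sd.2 * frac_val R sd.1 = v k,
      DR ^+ 3 * \sum_(sd <- job_segments p) frac_val R sd.2 * power_at I (frac_val R sd.1)
        = plan_energy R p &
      DR ^+ 2 * total_time R (job_segments p) = plan_time R p].
Proof.
move=> hp pk; have [a [b [pa pb]]] := valid_planE hp; case: hp => _ q0 xa0 xb0 xE.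
have D0 : DR != 0 by rewrite gt_eqF // D_gt0.
have qR : p.2.1%:~R != 0 :> R by rewrite intr_eq0 gt_eqF.
have sR i : s i != 0 by rewrite gt_eqF // ltr0q speed_gt0.
rewrite /total_time /job_segments !big_cons !big_nil !addr0 /plan_item /mk_item /= pa pb.
have [_ -> ->] := segment_of a q0 xa0; have [_ -> ->] := segment_of b q0 xb0.
split.
- have : p.2.2.1%:~R + p.2.2.2%:~R = p.2.1%:~R * (DR * v k) :> R.
    by rewrite -job_volume -rmorphM -rmorphD xE pk.
  move=> xER; rewrite !divfK // -mulrDl xER.
  by move: DR D0 (p.2.1%:~R) qR => d d0 q qR; field; rewrite qR d0.
- rewrite !power_at_speed /plan_energy pa pb intrD [(_ * p.2.2.1)%:~R]intrM [(_ * p.2.2.2)%:~R]intrM !class_of_energy.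
  move: DR D0 (p.2.1%:~R) qR (sR a) (sR b) => d d0 q qR; move: (s a) (s b) => sa sb a0 b0.
  by field; rewrite qR d0 a0 b0.
- rewrite /plan_time pa pb intrD [(_ * p.2.2.1)%:~R]intrM [(_ * p.2.2.2)%:~R]intrM !class_of_time.
  move: DR D0 (p.2.1%:~R) qR (sR a) (sR b) => d d0 q qR; move: (s a) (s b) => sa sb a0 b0.
  by field; rewrite qR d0 a0 b0.
Qed.

Lemma sorted_class_indices : sorted <%O [seq x.1.1 | x : entry <- ents].
Proof.
rewrite -[X in sorted _ X]/(map (class_index \o fst) ents) map_comp scaled_classes -map_comp.
rewrite -[X in sorted _ X]/(map (Posz \o val) (enum 'I_kappa)) map_comp val_enum_ord sorted_map.
by apply: sub_sorted (iota_ltn_sorted 0 kappa) => x y /=; rewrite ltz_nat.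
Qed.

(** The output follows the layout of the classes, so that its planned completion times add up to the
    class cost of the plans; the rounding error bound for plans then applies. *)
Lemma candidate_output c : c \in all_candidates N D B J ents ->
  exists S : solution R n, [/\ represents (enc_out (output c.2 ents)) S, feasible I S &
    rho R N ^+ n * (DR ^+ 3 * cost I S) <= c.1.1%:~R / c.1.2%:~R].
Proof.
move=> cA; have N0 : 0 < N by exact: instance_precision_gt0.
have D0 := D_gt0 R I eps.
have [F [pF cE hF eF costF]] := candidate_plans R N0 (@instance_entries_valid R _ _ I eps)
  (@instance_jobs_valid R _ _ I eps) (@instance_jobs_uniq R _ _ I eps) cA.
have [L [JE pL _]] := scaled_jobsE R I eps.
have [M FM pM] : exists2 M, [seq p.1.1 | p <- F] = [seq job_of k | k <- M] & perm_eq M (enum 'I_n).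
  apply: perm_map_inv; apply: perm_trans pF _; rewrite JE; exact: perm_map.
have uM : uniq M by rewrite (perm_uniq pM) enum_uniq.
have inM k : k \in M by rewrite (perm_mem pM) mem_enum.
(* Each job has exactly one plan in [F], so that the plans can be indexed by the jobs. *)
have [G FE] : exists G, F = [seq G k | k <- M].
  have p0 : plan := ((no_job, ((0, (0, (0, (0, 0)))), (0, (0, (0, (0, 0)))))), (0, (0, 0))).
  by apply: (exists_map p0 uM); rewrite -(size_map (fun p : plan => p.1.1) F) FM size_map.
have GV k : valid_plan ents (G k) by apply: hF; rewrite FE map_f.
have GJ k : (G k).1.1 = job_of k.
  by move: FM; rewrite FE -map_comp => /eq_in_map /(_ k (inM k)).
pose cs := [seq x.1.1 | x : entry <- ents].
have scs : sorted <%O cs by exact: sorted_class_indices.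
pose cl k := plan_class (G k).
have clcs k : cl k \in cs.
  have [a [b [pa _]]] := valid_planE (GV k); rewrite /cl /plan_class pa.
  by have /mapP[x xe ->] := class_of_mem I eps a; apply/mapP; exists x.
pose order := layout cl cs M.
have porder : perm_eq order (enum 'I_n).
  apply: perm_trans (perm_layout _ _ (sorted_uniq lt_trans ltxx scs)) _.
  by rewrite (_ : [seq x <- M | cl x \in cs] = M) //; apply/all_filterP/allP => k _; exact: clcs.
have [q oE] := exists_perm porder.
pose sg k := job_segments (G k).
have outE : output c.2 ents = ([seq (k : nat)%:Z | k : 'I_n <- order], flatten [seq sg k | k <- order]).
  have cE' : c.2 = [seq plan_item D (G k) | k <- M] by rewrite cE FE -map_comp.
  rewrite output_layout cE' layout_map; cbv zeta; rewrite -[layout _ _ M]/order.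
  by rewrite -!map_comp; congr pair; apply: eq_map => k; rewrite /= GJ.
have sg_valid k sd : sd \in sg k -> [&& 0 < sd.1.2, 0 < sd.2.2 & 0 <= sd.2.1] /\
    exists i, frac_val R sd.1 = s i.
  by apply: job_segments_valid; exact: GV.
have sg_valid' k sd : sd \in sg k -> 0 <= frac_val R sd.2 /\ exists i, frac_val R sd.1 = s i.
  move=> /sg_valid[/and3P[_ h1 h2] h]; split=> //.
  by rewrite divr_ge0 ?ler0z // ltW.
have sg_volume k : \sum_(sd <- sg k) frac_val R sd.2 * frac_val R sd.1 = v k.
  by have [] := job_segments_sums (GV k) (GJ k).
have sg_energy : \sum_k \sum_(sd <- sg k) frac_val R sd.2 * @power_at R _ _ I (frac_val R sd.1)
    <= ratr (budget I).
  have D3 : 0 < DR ^+ 3 by exact: exprn_gt0.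
  rewrite -(ler_pM2l D3) -scaled_budgetE; apply: le_trans eF.
  rewrite FE big_map (perm_big _ pM) big_enum mulr_sumr /=; apply: ler_sum => k _.
  by have [_ <- _] := job_segments_sums (GV k) (GJ k).
exists (Solution q (@step_profile R (flatten [seq sg (q k) | k <- enum 'I_n]))); split.
- exists (flatten [seq sg (q k) | k <- enum 'I_n]); split=> //; last first.
    by apply/allP => sd /flattenP[l /mapP[k _ ->]] /sg_valid[].
  have idsE (l : seq 'I_n) : enc_seq Atom [seq (k : nat)%:Z | k : 'I_n <- l] =
      enc_seq (fun k : 'I_n => Atom (k : nat)%:Z) l by elim: l => //= k l ->.
  by rewrite outE /enc_out /enc_pair [fst _]/= [snd _]/= idsE oE -[X in flatten X]map_comp.
- exact: output_feasible.
have idx k : index k order = (q^-1)%g k.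
  by rewrite oE -{1}(permKV q k) index_map ?index_enum_ord //; exact: perm_inj.
have costE : cost I (Solution q (@step_profile R (flatten [seq sg (q k) | k <- enum 'I_n])))
    <= class_cost (fun k => w k) (fun k => total_time R (sg k)) cl M.
  apply: le_trans (output_cost q sg_valid' sg_volume) _.
  rewrite -(suffix_bound_layout _ _ scs) -/order; last by [].
  rewrite suffix_boundE ?(perm_uniq porder) ?enum_uniq // (perm_big _ porder) big_enum /=.
  rewrite (eq_bigr (fun j => \sum_k if ((q^-1)%g k <= (q^-1)%g j)%N then w j * total_time R (sg k) else 0)).
    rewrite exchange_big /= le_eqVlt; apply/orP; left; apply/eqP; apply: eq_bigr => k _.
    rewrite (perm_big _ porder) big_enum_cond mulr_sumr [RHS]big_mkcond /=; apply: eq_bigr => j _.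
    by rewrite !idx; case: ifP => // _; rewrite mulrC.
  by move=> j _; rewrite mulr_sumr big_mkcond.
have sJ : size J = n by rewrite JE size_map (perm_size pL) size_enum_ord.
apply: le_trans costF; rewrite sJ.
have p0 : 0 <= rho R N ^+ n by rewrite exprn_ge0 // rho_ge0.
apply: ler_wpM2l => //; apply: le_trans (ler_wpM2l _ costE) _.
  by rewrite exprn_ge0 // ltW.
rewrite FE class_cost_map [leRHS](eq_in_class_cost (w' := fun k => DR * w k)
  (t' := fun k => DR ^+ 2 * total_time R (sg k)) (c' := cl)) //.
- by rewrite class_costZ -exprS.
- by move=> k _; rewrite /= /plan_weight GJ job_weight.
- by move=> k _; rewrite /=; have [_ _ <-] := job_segments_sums (GV k) (GJ k).
Qed.

End Output.

Lemma bernoulli_inequality (R : realFieldType) (x : R) n : 0 <= x <= 1 ->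
  1 - n%:R * x <= (1 - x) ^+ n.
Proof.
move=> /andP[x0 x1]; elim: n => [|n IH]; first by rewrite mul0r subr0 expr0.
rewrite exprS; have h : 0 <= 1 - x by rewrite subr_ge0.
apply: le_trans (ler_wpM2l h IH).
have : 0 <= (n%:R : R) * x * x by rewrite !mulr_ge0.
rewrite -addn1 natrD; lra.
Qed.

(** * Choice of the precision and conclusion *)

Section Conclusion.
Variables (R : realType) (kappa n : nat) (I : instance kappa n) (eps : rat).
Hypothesis eps_gt0 : 0 < eps.
Local Notation on_raw f :=
  (f (raw_jobs I) (raw_speeds I) (numq (budget I)) (denq (budget I)) (numq eps) (denq eps)).
Local Notation D := (on_raw scale).
Local Notation N := (precision (raw_jobs I) (numq eps) (denq eps)).
Local Notation B := (on_raw scaled_budget).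
Local Notation J := (on_raw scaled_jobs).
Local Notation ents := (on_raw scaled_entries).
Local Notation q := (denq eps %/ numq eps)%Z.

Lemma inv_eps_bounds (F : realFieldType) : 0 <= q /\ (q%:~R <= (ratr eps : F)^-1 < (q + 1)%:~R).
Proof.
have n0 : 0 < numq eps by rewrite numq_gt0.
have d0 := denq_gt0 eps.
have nF : (0 : F) < (numq eps)%:~R by rewrite ltr0z.
split; first by rewrite divz_ge0 // ltW.
rewrite /ratr invf_div ler_pdivlMr // ltr_pdivrMr // -!intrM ler_int ltr_int.
have := divz_eq (denq eps) (numq eps); have := modz_ge0 (denq eps) (lt0r_neq0 n0).
have := ltz_pmod (denq eps) n0.
move: (_ %% _)%Z (_ %/ _)%Z => a b; move: (numq _) (denq _); clear; nia.
Qed.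

(** By Bernoulli, [rho ^ n >= 1 - n / N >= (1 + q) / (2 + q)] with [q] the integer part of
    [1 / eps]. Multiplied by [1 + eps] this is at least 1, because [(1 + q) * eps >= 1]. *)
Lemma precision_suffices : 1 <= rho R N ^+ n * (1 + ratr eps).
Proof.
have [q0 /andP[_ q1]] := inv_eps_bounds R.
have e0 : (0 : R) < ratr eps by rewrite ltr0q.
have N0 : 0 < N by exact: instance_precision_gt0.
have NR : (0 : R) < N%:~R by rewrite ltr0z.
have x01 : 0 <= (N%:~R : R)^-1 <= 1.
  by rewrite invr_ge0 ltW // invf_le1 // ler1z; lia.
have e1 : 0 <= 1 + ratr eps :> R by rewrite addr_ge0 // ltW.
apply: le_trans (ler_wpM2r e1 (bernoulli_inequality n x01)).
have NE : N%:~R = (n%:R + 1) * (2 + q%:~R) :> R.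
  by rewrite /precision size_map size_enum_ord intrM !intrD.
have q1' : 1 < (q%:~R + 1) * ratr eps :> R by rewrite -ltr_pdivrMr // mul1r -[1]/(1%:~R) -intrD.
have q0' : 0 <= q%:~R :> R by rewrite ler0z.
have q2 : 0 < 2 + q%:~R :> R by rewrite ltr_pwDl.
have n1 : 0 < n%:R + 1 :> R by rewrite ltr_wpDl.
have hn : n%:R * (N%:~R)^-1 <= (2 + q%:~R)^-1 :> R.
  rewrite NE invfM mulrA ler_piMl //; first by rewrite invr_ge0 ltW.
  by rewrite ler_pdivrMr // mul1r lerDl.
apply: (@le_trans _ _ ((1 - (2 + q%:~R)^-1) * (1 + ratr eps))); last first.
  by rewrite ler_wpM2r // lerB.
move: (q%:~R : R) (ratr eps : R) q0' q1' q2 e0 => a b a0 ab a2 b0.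
have -> : 1 - (2 + a)^-1 = (1 + a) / (2 + a) by field; rewrite gt_eqF.
rewrite mulrAC ler_pdivlMr //; lra.
Qed.

Lemma cost_ge0 (S : solution R n) : feasible I S -> 0 <= cost I S.
Proof.
move=> hS; apply: sumr_ge0 => j _; apply: mulr_ge0; first by rewrite ler0q weight_ge0.
exact: completion_time_ge0.
Qed.

Lemma candidate_speed c : c \in all_candidates N D B J ents -> exists i : 'I_kappa, True.
Proof.
move=> /all_candidatesP[j [s [x [y [_ hs xs _ _]]]]].
have [_ /(_ _ hs) /reach_runs[l lJ hr]] := dp_table N D (init_state ents) j.1 J.
have N0 : 0 < N by exact: instance_precision_gt0.
have [|hc _ _ _ _] := runs_approx R N0 (@instance_entries_valid R _ _ I eps) hr.
  move=> z /(map_f fst); rewrite -lJ mem_rev mem_filter => /andP[_ zJ].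
  by have [_ h1 h2] := instance_jobs_valid R zJ.
have /(map_f (fun x => x.1)) : x \in s.1.1 by [].
by rewrite hc scaled_classes => /mapP[i _ _]; exists i.
Qed.

(** Up to the factor [D ^ 3], the best value is at most the cost of every feasible schedule, hence
    at most the infimum, and at least [rho ^ n] times the cost of the output. *)
Lemma best_output c (S0 : solution R n) : feasible I S0 ->
  best_candidate N D B J ents = Some c ->
  exists S : solution R n, [/\ represents (enc_out (output c.2 ents)) S, feasible I S &
    cost I S <= (1 + ratr eps) * opt_cost R I].
Proof.
move=> hS0 bE; have cA := best_candidate_mem bE; have [i0 _] := candidate_speed cA.
have [S [repS hS hc]] := candidate_output R eps_gt0 cA.
exists S; split=> //; have S_ge0 := cost_ge0 hS.
have D3 : 0 < (D%:~R : R) ^+ 3 by rewrite exprn_gt0 // D_gt0.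
have e1 : 0 <= 1 + ratr eps :> R by rewrite addr_ge0 // ler0q ltW.
have h : rho R N ^+ n * cost I S <= opt_cost R I.
  apply: lb_le_inf; first by exists (cost I S0), S0.
  move=> _ [S' hS' <-]; have [c' c'A hc'] := exists_good_candidate eps_gt0 i0 hS'.
  have [c2 c2E le_c] := best_candidate_min c'A; move: c2E le_c; rewrite bE => -[<-] le_c.
  have den c1 : c1 \in all_candidates N D B J ents -> (0 : R) < c1.1.2%:~R.
    by move=> /all_candidatesP[j [s [x [y [_ _ _ _ /pair_candidate_den_gt0]]]]]; rewrite ltr0z.
  rewrite -(ler_pM2l D3) mulrCA; apply: le_trans hc _; apply: le_trans hc'.
  rewrite ler_pdivrMr ?den // mulrAC ler_pdivlMr ?den // -!intrM ler_int.
  exact: le_c.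
apply: le_trans (ler_wpM2l e1 h).
have := precision_suffices; rewrite mulrA [_ * rho R N ^+ n]mulrC => h1.
by rewrite -{1}[cost I S]mul1r ler_wpM2r.
Qed.

(** With at least one speed, the schedule [S0] would give rise to a candidate. So there are no
    speeds, all volumes are 0, and every job is complete at time 0. *)
Lemma trivial_output (S0 : solution R n) : feasible I S0 ->
  best_candidate N D B J ents = None ->
  exists S : solution R n, [/\ represents (Node (enc_seq Atom [seq j.1 | j <- J]) (Atom 0)) S,
    feasible I S & cost I S <= (1 + ratr eps) * opt_cost R I].
Proof.
move=> hS0 bE.
have k0 : kappa = 0%N.
  case: (posnP kappa) => // k0; have [c cA _] := exists_good_candidate eps_gt0 (Ordinal k0) hS0.
  by have [c2] := best_candidate_min cA; rewrite bE.
have v0 := no_speed_volume hS0 k0.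
have [L [JE pL _]] := scaled_jobsE R I eps.
have [p oE] := exists_perm pL.
pose sg (k : 'I_n) : seq ((int * int) * (int * int)) := [::].
have sgE (l : seq 'I_n) : flatten [seq sg (p k) | k <- l] = [::] by elim: l.
have sg_valid k sd : sd \in sg k -> 0 <= frac_val R sd.2 /\ exists i, frac_val R sd.1 = ratr (speed I i).
  by [].
have sg_volume k : \sum_(sd <- sg k) frac_val R sd.2 * frac_val R sd.1 = ratr (volume I k).
  by rewrite big_nil v0.
have budget_ge0 : 0 <= ratr (budget I) :> R.
  case: hS0 => _ _ _ hE; rewrite -lee_fin; apply: le_trans hE.
  by apply: integral_ge0 => t _; rewrite lee_fin power_at_ge0.
have sg_energy : \sum_k \sum_(sd <- sg k) frac_val R sd.2 * @power_at R _ _ I (frac_val R sd.1)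
    <= ratr (budget I).
  by rewrite big1 // => k _; rewrite big_nil.
exists (Solution p (@step_profile R (flatten [seq sg (p k) | k <- enum 'I_n]))); split.
- exists [::]; rewrite sgE; split=> //; congr (Node _ _).
  rewrite JE /= -oE -map_comp.
  by elim: L {JE pL oE} => //= k l ->.
- exact: output_feasible.
apply: le_trans (output_cost p sg_valid sg_volume) _.
rewrite big1 => [|k _]; last by rewrite big1 ?mulr0 // => j _; rewrite /total_time big_nil.
rewrite mulr_ge0 ?addr_ge0 ?ler0q ?(ltW eps_gt0) //.
by apply: lb_le_inf => [|_ [S' hS' <-]]; [exists (cost I S0), S0|exact: cost_ge0].
Qed.

End Conclusion.

Theorem theorem7 (R : realType) (kappa : nat) :
  exists (A : program) (c d : nat),
  forall (n : nat) (I : instance kappa n) (eps : rat), 0 < eps ->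
  exists (out : sexp) (time : nat),
    [/\ runs_in A (enc_input I eps) out time,
        time%:R <= c%:R * (1 + (sexp_size (enc_input I eps))%:R + eps^-1) ^+ d
        & (exists S : solution R n, feasible I S) ->
          exists S : solution R n,
            [/\ represents out S,
                feasible I S
              & cost I S <= (1 + ratr eps) * opt_cost R I]].
Proof.
have [c [d hcd]] := poly_bounded_time kappa.
exists prog, c, d => n I eps eps_gt0.
(* The integer part of [1 / eps] is added to the input size because the precision, and with it the
   table, grows with [1 / eps] rather than with the bit length of [eps]. *)
pose Y := (sexp_size (enc_input I eps) + `|(denq eps %/ numq eps)%Z|)%N.
have numq_eps : 0 < numq eps by rewrite numq_gt0.
have raw_le := leq_addr `|(denq eps %/ numq eps)%Z|%N (sexp_size (enc_input I eps)).
rewrite {1}enc_input_raw in raw_le.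
have inv_le : (`|(denq eps %/ numq eps)%Z| <= Y)%N by exact: leq_addl.
have speeds_size : size (raw_speeds I) = kappa by rewrite size_map size_enum_ord.
have [b evb hb] := ev_raw (@valid_raw_jobs _ _ I) (@valid_raw_speeds _ _ I) numq_eps
  (denq_gt0 eps) raw_le inv_le.
have size_out := sexp_size_result (@valid_raw_jobs _ _ I) (@valid_raw_speeds _ _ I) numq_eps
  (denq_gt0 eps) raw_le inv_le.
rewrite speeds_size in hb size_out.
set out := result _ _ _ _ _ _ in evb size_out.
exists out, (b + sexp_size out)%N; split.
- by exists b; first by rewrite enc_input_raw.
- have : (b + sexp_size out <= c * Y.+1 ^ d)%N by apply: leq_trans (hcd Y); exact: leq_add.
  rewrite -(ler_nat rat) natrM natrX => /le_trans; apply; apply: ler_wpM2l => //.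
  have [q0 /andP[q1 _]] := inv_eps_bounds eps_gt0 rat.
  have i0 : 0 <= eps^-1 by rewrite invr_ge0 ltW.
  apply: lerXn2r; rewrite ?nnegrE //; first by apply: addr_ge0 => //; apply: addr_ge0.
  rewrite -natr1 /Y natrD addrC addrA lerD2l natr_absz ger0_norm //.
  by move: q1; rewrite {1}/ratr divq_num_den.
move=> [S0 hS0]; rewrite /out /result /best; case bE: best_candidate => [c'|].
  exact: (best_output eps_gt0 hS0 bE).
exact: (trivial_output eps_gt0 hS0 bE).
Qed.
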